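(* Suppose Assumptions (A3) and (A4) hold. Fix $\gamma_0\in(0,a_0)$ and suppose $\delta\in\big(0,\min\{a(\alpha)^{1/(1+\alpha)},\,a_0-\gamma_0\}\big)$. Let $\vartheta=\frac{1-2\sigma\gamma_0}{e^{-\omega}+2\delta\sigma}$. Then there exist $N_0\in\mathbb{N}$ and $C_1\in(0,\infty)$ such that for all $\varepsilon>0$ and all $n\ge0$, $$P(\mathcal{W}_1(\mu_n^N,\mu_n)>\varepsilon)\le P(\mathcal{W}_1(\mu_0^N,\mu_0)>2\sigma\gamma_0\vartheta^n\varepsilon)+C_1\varepsilon^{-(1+\alpha)}N^{-\frac{\alpha}{d+2}}$$ for all $N>N_0\big(\max\{1,\log^+\varepsilon\}\big)^{\frac{d+2}{d}}$.
   Context: Setting. Fix integers $d,m\ge1$, a real $d\times d$ matrix $A$ with operator norm $\|A\|$, $\delta>0$, a Borel probability measure $\theta$ on $\mathbb{R}^m$, and a measurable $f:\mathbb{R}^d\times\mathcal{P}_1(\mathbb{R}^d)\times\mathbb{R}^m\to\mathbb{R}^d$. $\mathcal{P}_1(\mathbb{R}^d)$: Borel probability measures on $\mathbb{R}^d$ with finite first moment, with the Wasserstein-1 distance $\mathcal{W}_1(\mu,\nu)=\inf E|X-Y|$ over couplings. Particle system: for each $N\ge1$, $\{X_0^{i,N}\}_{i=1}^N$ are exchangeable, each with law $\mu_0\in\mathcal{P}_1(\mathbb{R}^d)$; $\{\epsilon_n^i\}_{i,n\ge1}$ i.i.d. with law $\theta$, independent of the initial conditions; $X_{n+1}^{i,N}=AX_n^{i,N}+\delta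 f(X_n^{i,N},\mu_n^N,\epsilon_{n+1}^i)$, $\mu_n^N=\frac1N\sum_{i=1}^N\delta_{X_n^{i,N}}$. Nonlinear evolution: $\Psi(\mu)$ is the law of $AX+\delta f(X,\mu,\epsilon)$ with $(X,\epsilon)\sim\mu\otimes\theta$, and $\mu_{n+1}=\Psi(\mu_n)$. $D(z):=\sup\frac{|f(x_1,\mu_1,z)-f(x_2,\mu_2,z)|}{|x_1-x_2|+\mathcal{W}_1(\mu_1,\mu_2)}$ (supremum over $(x_1,\mu_1)\neq(x_2,\mu_2)$), $D_1(z):=|f(0,\delta_0,z)|$, $\sigma:=\int D\,d\theta$, $a_0:=\frac{1-e^{-\omega}}{2\sigma}$, $a(\alpha):=\frac{4^{-\alpha}-e^{-(1+\alpha)\omega}}{2\sigma_1(\alpha)}$, $\log^+ x=\max\{\log x,0\}$. (A3): $\|A\|\le e^{-\omega}$ for some $\omega>0$. (A4): for some $\alpha>0$, $\int|x|^{1+\alpha}\mu_0(dx)<\infty$, $\sigma_1(\alpha):=\int D^{1+\alpha}d\theta<\infty$, $\int D_1^{1+\alpha}d\theta<\infty$. *)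

(* Defs.v *)
From HB Require Import structures.
From mathcomp Require Import all_boot all_order all_algebra.
From mathcomp Require Import fingroup perm.
From mathcomp Require Import all_classical all_reals all_analysis.

Set Implicit Arguments.
Unset Strict Implicit.
Unset Printing Implicit Defensive.

Import Order.TTheory GRing.Theory Num.Theory.
Import numFieldNormedType.Exports.

Local Open Scope classical_set_scope.
Local Open Scope ring_scope.

(* R^d as column vectors, equipped with its Borel sigma-algebra
   (generated by the open sets of the usual (product = Euclidean) topology). *)
Definition Rd (R : realType) (d : nat) :=
  g_sigma_algebraType (@open 'cV[R]_d).

Definition enorm (R : realType) (d : nat) (x : 'cV[R]_d) : R :=
  Num.sqrt (\sum_(i < d) x i ord0 ^+ 2).

Definition opnorm (R : realType) (d : nat) (A : 'M[R]_d) : R :=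
  sup [set enorm (A *m x) | x in [set x : 'cV[R]_d | enorm x <= 1]].

Definition meas (R : realType) (d : nat) := set (Rd R d) -> \bar R.

Definition is_prob (R : realType) (dT : measure_display) (T : measurableType dT)
    (mu : set T -> \bar R) : Prop :=
  [/\ mu set0 = 0%E, (forall A, measurable A -> (0 <= mu A)%E),
      semi_sigma_additive mu & mu setT = 1%E].

Definition P1 (R : realType) (d : nat) (mu : meas R d) : Prop :=
  is_prob mu /\ (\int[mu]_x (enorm (x : 'cV[R]_d))%:E < +oo)%E.

Definition coupling (R : realType) (d : nat) (mu nu : meas R d)
    (pi : set (Rd R d * Rd R d) -> \bar R) : Prop :=
  [/\ is_prob pi,
      (forall A, measurable A -> pi (A `*` setT) = mu A) &
      (forall B, measurable B -> pi (setT `*` B) = nu B)].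

Definition W1 (R : realType) (d : nat) (mu nu : meas R d) : \bar R :=
  ereal_inf [set (\int[pi]_p (enorm ((p.1 : 'cV[R]_d) - p.2))%:E)%E
            | pi in coupling mu nu].

(* Borel sigma-algebra of (P_1, W_1), generated by the open W_1-balls
   ((P_1, W_1) is separable, so balls generate the open sets) *)
Definition W1_balls (R : realType) (d : nat) : set (set (meas R d)) :=
  [set S | exists mu r, [/\ P1 mu, 0 < r &
     S = [set nu | P1 nu /\ (W1 mu nu < r%:E)%E]]].

Definition borel_P1 (R : realType) (d : nat) : set (set (meas R d)) :=
  <<s [set mu | P1 mu], @W1_balls R d >>.

Definition f_measurable (R : realType) (d m : nat)
    (f : Rd R d -> meas R d -> Rd R m -> Rd R d) : Prop :=
  forall B : set (Rd R d), measurable B ->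
    <<s [set p : (Rd R d * meas R d) * Rd R m | P1 p.1.2],
        [set X | exists A S C, [/\ measurable A, @borel_P1 R d S, measurable C &
                 X = A `*` S `*` C]] >>
      [set p | P1 p.1.2 /\ B (f p.1.1 p.1.2 p.2)].

Definition Dlip (R : realType) (d m : nat)
    (f : Rd R d -> meas R d -> Rd R m -> Rd R d) (z : Rd R m) : \bar R :=
  ereal_sup [set y | exists x1 mu1 x2 mu2,
     [/\ P1 mu1, P1 mu2, (x1, mu1) <> (x2, mu2) &
     y = ((enorm ((f x1 mu1 z : 'cV[R]_d) - f x2 mu2 z))%:E *
          ((enorm ((x1 : 'cV[R]_d) - x2))%:E + W1 mu1 mu2)^-1)%E]].

Definition D1 (R : realType) (d m : nat)
    (f : Rd R d -> meas R d -> Rd R m -> Rd R d) (z : Rd R m) : \bar R :=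
  (enorm (f (0 : 'cV[R]_d) (@dirac _ (Rd R d) (0 : 'cV[R]_d) R) z : 'cV[R]_d))%:E.

Definition empirical (R : realType) (d N : nat) (x : 'I_N -> Rd R d) : meas R d :=
  fun B => (((N%:R)^-1)%:E * \sum_(i < N) @dirac _ (Rd R d) (x i) R B)%E.

(* Psi(mu) = law of A X + delta f(X, mu, eps), (X, eps) ~ mu (x) theta *)
Definition Psi (R : realType) (d m : nat) (A : 'M[R]_d) (delta : R)
    (f : Rd R d -> meas R d -> Rd R m -> Rd R d) (theta : meas R m)
    (mu : meas R d) : meas R d :=
  fun B => (\int[mu]_x theta [set z | B ((A *m (x : 'cV[R]_d) + delta *: f x mu z)%R : 'cV[R]_d)])%E.

Definition mu_nl (R : realType) (d m : nat) (A : 'M[R]_d) (delta : R)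
    (f : Rd R d -> meas R d -> Rd R m -> Rd R d) (theta : meas R m)
    (mu0 : meas R d) (n : nat) : meas R d :=
  iter n (Psi A delta f theta) mu0.

(* the particle system X_n^{i,N}; eps n i plays the role of eps_{n+1}^{i+1} *)
Fixpoint particles (R : realType) (d m : nat) (A : 'M[R]_d) (delta : R)
    (f : Rd R d -> meas R d -> Rd R m -> Rd R d) (Omega : Type)
    (X0 : forall N : nat, 'I_N -> Omega -> Rd R d)
    (eps : nat -> nat -> Omega -> Rd R m) (N n : nat) : 'I_N -> Omega -> Rd R d :=
  match n with
  | 0 => X0 N
  | n'.+1 => fun i w =>
      let Xn := @particles R d m A delta f Omega X0 eps N n' in
      (A *m (Xn i w : 'cV[R]_d) + delta *: f (Xn i w) (empirical (fun j => Xn j w)) (eps n' i w) : 'cV[R]_d)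
  end.

Definition exchangeable (R : realType) (dO : measure_display) (Omega : measurableType dO)
    (P : set Omega -> \bar R) (d : nat) (X0 : forall N : nat, 'I_N -> Omega -> Rd R d) : Prop :=
  forall N (s : {perm 'I_N}) (B : 'I_N -> set (Rd R d)), (forall i, measurable (B i)) ->
    P (\bigcap_(i in [set: 'I_N]) (X0 N (s i) @^-1` B i)) =
    P (\bigcap_(i in [set: 'I_N]) (X0 N i @^-1` B i)).

Definition iid_indep (R : realType) (dO : measure_display) (Omega : measurableType dO)
    (P : set Omega -> \bar R) (d m : nat) (theta : meas R m)
    (X0 : forall N : nat, 'I_N -> Omega -> Rd R d)
    (eps : nat -> nat -> Omega -> Rd R m) : Prop :=
  forall N (B : 'I_N -> set (Rd R d)) (s : seq (nat * nat)) (C : nat * nat -> set (Rd R m)),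
    (forall i, measurable (B i)) -> uniq s -> (forall k, measurable (C k)) ->
    P (\bigcap_(i in [set: 'I_N]) (X0 N i @^-1` B i) `&`
       \bigcap_(k in [set` s]) (eps k.1 k.2 @^-1` C k)) =
    (P (\bigcap_(i in [set: 'I_N]) (X0 N i @^-1` B i)) * \prod_(k <- s) theta (C k))%E.

Definition logp (R : realType) (x : R) : R := Num.max (ln x) 0.

Arguments particles {R d m} A delta f {Omega} X0 eps N n.

(* Main.v *)
(* Write q = e^(-omega) + 2 delta sigma. The map Psi is q-Lipschitz for W_1, and mu_(n+1)^N is an
   empirical sample of size N, conditionally independent given the past, from a law of mean
   Psi(mu_n^N). Hence W_1(mu_(n+1)^N, mu_(n+1)) <= E_n + q W_1(mu_n^N, mu_n), with a sampling error
   E_n that is controlled on a grid of about N^(d/(d+2)) cubes: truncation, discretisation and the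
   deviations of the cell frequencies together give a (1+alpha)-th moment of order N^(-alpha/(d+2)),
   uniformly in n because delta^(1+alpha) < a(alpha) makes the (1+alpha)-th moments of the particles
   satisfy a contracting recursion. Splitting the level e into eta e for E_n and (1 - eta) e for the
   rest, Markov's inequality gives a geometric series of ratio ((1 - eta)/q)^(-(1+alpha)) < 1.
   The bound holds for all N >= 1, so N_0 = 0. *)
Require Import Defs.
From HB Require Import structures.
From mathcomp Require Import all_boot all_order all_algebra.
From mathcomp Require Import fingroup perm.
From mathcomp Require Import all_classical all_reals all_analysis.
From mathcomp Require Import measurable_realfun.
From mathcomp Require Import ring lra.
From mathcomp Require Import giry.
Set Implicit Arguments.
Unset Strict Implicit.
Unset Printing Implicit Defensive.
Import Order.TTheory GRing.Theory Num.Theory.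
Import numFieldNormedType.Exports.
Local Open Scope classical_set_scope.
Local Open Scope ring_scope.

(** * Real inequalities *)

Section real_inequalities.
Variable R : realType.
Implicit Types a b c p r t u x y z : R.

(** Given the configuration at time n, the next particles are independent but not identically
    distributed: only the average of their laws is Psi(mu_n^N). Hence the two moment estimates,
    Rosenthal's inequality for the tails and the growth of integer moments for the cell frequencies,
    are proved for independent summands with different laws. Conditioning is replaced by Fubini:
    integrands carry two copies of the sample point, one for the past and one for the new noises,
    and independence allows the first to be frozen. Scales: put p = 1 + alpha, x = N^(1/(d+2)), and
    let rho^p bound the conditional p-th moment. The cubes have side about rho x^(-alpha/p), the box
    has radius about rho x^(1/p). Truncation costs radius^(-alpha) rho^p, discretisation the side,
    the frequencies radius times sqrt(x^d / N) = radius / x. All three are of order rho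
    x^(-alpha/p), whose p-th power is rho^p N^(-alpha/(d+2)); Markov's inequality for this power
    gives the factor e^(-(1+alpha)). *)

Lemma powR_le a b r : 0 <= r -> 0 <= a -> a <= b -> a `^ r <= b `^ r.
Proof.
move=> r0 a0 ab; apply: ge0_ler_powR => //; rewrite nnegrE //; exact: le_trans ab.
Qed.

Lemma powR_ge1 a r : 1 <= a -> 0 <= r -> 1 <= a `^ r.
Proof. by move=> a1 r0; have := ler_powR a1 r0; rewrite powRr0. Qed.

Lemma le_one_plus_powR u p : 0 <= u -> 1 <= p -> u <= 1 + u `^ p.
Proof.
move=> u0 p1; have [u1|u1] := leP u 1; first by rewrite (le_trans u1)// lerDl powR_ge0.
apply: (@le_trans _ _ (u `^ p)); last by rewrite lerDr.
by rewrite -[X in X <= _](powRr1 u0); apply: ler_powR => //; exact: ltW.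
Qed.

Lemma powRN_lt1 t p : 0 < p -> 1 < t -> t `^ (- p) < 1.
Proof.
move=> p0 t1; have t0 := lt_trans ltr01 t1.
rewrite powRN invf_lt1 ?powR_gt0//.
rewrite [X in X < _](_ : 1 = 1 `^ p); last by rewrite powR1.
by apply: gt0_ltr_powR; rewrite ?nnegrE// ltW.
Qed.

(** Absorbs half of an unknown quantity into the left side; Rosenthal's inequality is closed this
    way. *)
Lemma le_half_absorb x y : x <= y + x / 2 -> x <= 2 * y.
Proof. by lra. Qed.

Lemma powRS p a : 0 < p -> 0 <= a -> a `^ (1 + p) = a * a `^ p.
Proof.
move=> p0 a0; rewrite powRD ?powRr1// ; apply/implyP => /eqP h; exfalso.
by move: h p0; lra.
Qed.

Lemma convex_powR2 p (t : R) a b : 1 <= p -> 0 <= t <= 1 -> 0 <= a -> 0 <= b ->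
  (t * a + (1 - t) * b) `^ p <= t * a `^ p + (1 - t) * b `^ p.
Proof.
move=> p1 /andP[t0 t1] a0 b0.
have := @convex_powR R p p1 (Itv01 t0 t1) a b.
rewrite !inE/= !in_itv/= !andbT => /(_ a0 b0).
by rewrite !convRE/=.
Qed.

(** The constant 2^(p-1) is the sharp one, from convexity at the midpoint. Two uses of it produce
    exactly the 4^alpha of a(alpha), where the cruder [powR_sum2] would lose a factor. *)
Lemma powR_mean2 p a b : 1 <= p -> 0 <= a -> 0 <= b ->
  (a + b) `^ p <= 2 `^ (p - 1) * (a `^ p + b `^ p).
Proof.
move=> p1 a0 b0.
have := @convex_powR2 p 2^-1 (2 * a) (2 * b) p1.
rewrite !mulrA mulVf ?pnatr_eq0// mul1r.
have -> : (1 - 2^-1) * 2 = 1 :> R by field.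
rewrite mul1r => /(_ _ _ _)/le_trans; apply; try lra; try (apply: mulr_ge0 => //; lra).
rewrite !powRM ?ler0n// powRB// ?pnatr_eq0 ?implybT// powRr1 ?ler0n//.
set u := 2 `^ p; rewrite le_eqVlt; apply/orP; left; apply/eqP; by field.
Qed.

(** The sum is at most twice its larger term. Unlike convexity this also covers exponents below 1,
    such as p - 1 = alpha. *)
Lemma powR_sum2 r a b : 0 <= r -> 0 <= a -> 0 <= b ->
  (a + b) `^ r <= 2 `^ r * (a `^ r + b `^ r).
Proof.
move=> r0 a0 b0.
wlog ab : a b a0 b0 / a <= b => [hw|].
  have [|/ltW] := leP a b; first exact: hw.
  by rewrite addrC [X in _ * X]addrC; exact: hw.
apply: (@le_trans _ _ ((2 * b) `^ r)).
  by apply: powR_le => //; lra.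
rewrite powRM// ler_wpM2l ?powR_ge0// lerDr powR_ge0//.
Qed.

(** Jensen's inequality for the uniform average. The induction peels off one term, which leaves a
    convex combination of two points. *)
Lemma powR_mean (N : nat) p (a : 'I_N -> R) : 1 <= p -> (0 < N)%N ->
  (forall i, 0 <= a i) ->
  (N%:R^-1 * \sum_(i < N) a i) `^ p <= N%:R^-1 * \sum_(i < N) a i `^ p.
Proof.
move=> p1; case: N a => // N a _.
elim: N a => [|N IH] a a0.
  by rewrite !big_ord_recl !big_ord0 invr1 !mul1r !addr0.
rewrite big_ord_recl [X in _ <= _ * X]big_ord_recl.
set S := \sum_(i < N.+1) _; set S' := \sum_(i < N.+1) _.
pose n : R := N.+1%:R; pose n1 : R := N.+2%:R.
have avg_split (u v : R) : n1^-1 * (u + v) = n1^-1 * u + (1 - n1^-1) * (n^-1 * v).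
  have -> : n1 = n + 1 by rewrite /n1 -natr1.
  have : 0 < n by rewrite ltr0n.
  clearbody n => n_gt0; field; apply/andP; split; apply: lt0r_neq0; lra.
have n0 : 0 < n by rewrite ltr0n.
have n10 : 0 < n1 by rewrite ltr0n.
have n1E : n1 = n + 1 by rewrite /n /n1 -[in LHS]natr1.
have -> : N.+2%:R^-1 * (a ord0 + S) = n1^-1 * a ord0 + (1 - n1^-1) * (n^-1 * S).
  exact: avg_split.
have S0 : 0 <= S by apply: sumr_ge0.
apply: le_trans (convex_powR2 p1 _ _ _) _ => //.
- rewrite invr_ge0 ltW//= invf_le1//; lra.
- by rewrite mulr_ge0// invr_ge0 ltW.
have -> : N.+2%:R^-1 * (a ord0 `^ p + S') = n1^-1 * a ord0 `^ p + (1 - n1^-1) * (n^-1 * S').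
  exact: avg_split.
rewrite lerD2l ler_wpM2l//; last by apply: IH => i; exact: a0.
rewrite subr_ge0 invf_le1//; lra.
Qed.

(** Young's inequality with a free weight L: either Z <= L m, and the first term dominates, or m < Z
    / L, and the second does. A large L makes the coefficient of Z^p small enough to be absorbed. *)
Lemma mul_powR_young (m Z L p : R) : 1 <= p -> 0 <= m -> 0 <= Z -> 0 < L ->
  m * Z `^ (p - 1) <= L `^ (p - 1) * m `^ p + L^-1 * Z `^ p.
Proof.
move=> p1 m0 Z0 L0; have p10 : 0 <= p - 1 by lra.
have E x : 0 <= x -> x `^ p = x * x `^ (p - 1).
  move=> x0; rewrite mulr_powRB1//; lra.
have [ZL|LZ] := leP Z (L * m).
  apply: (@le_trans _ _ (m * (L * m) `^ (p - 1))).
    by rewrite ler_wpM2l// powR_le.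
  rewrite powRM ?(ltW L0)// mulrCA -E// lerDl mulr_ge0 ?powR_ge0// invr_ge0 ltW//.
apply: (@le_trans _ _ (L^-1 * Z `^ p)); last first.
  by rewrite lerDr mulr_ge0 ?powR_ge0.
rewrite E// mulrA ler_wpM2r ?powR_ge0// mulrC ler_pdivlMr// mulrC; exact: ltW.
Qed.

(** The recursion records one multiplication by Q + t under t^2 <= 64 Q and t <= 64 Q: the new
    second-order term gives 64 (k + 1), the old remainder is multiplied by at most 65 Q. *)
Fixpoint taylor_const (k : nat) : R :=
  if k is k'.+1 then 64 * k'.+1%:R + 65 * taylor_const k' else 0.

Lemma taylor_const_ge0 k : 0 <= taylor_const k.
Proof. elim: k => //= k IH; apply: addr_ge0; apply: mulr_ge0 => //; lra. Qed.

(** A first-order expansion in which t is of order sqrt(Q), so that the remainder is of order Q^k,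
    one power below the leading term. *)
Lemma exprD_taylor (k : nat) (Q t : R) : 1 <= Q -> t ^+ 2 <= 64 * Q -> 0 <= Q + t ->
  (Q + t) ^+ k.+1 <= Q ^+ k.+1 + k.+1%:R * Q ^+ k * t + taylor_const k * Q ^+ k.
Proof.
move=> Q1 tQ Qt0.
have tQ' : t <= 64 * Q by nra.
elim: k => [|k IH]; first by rewrite !expr1 expr0 /= mulr1 mul1r mul0r addr0.
rewrite exprS; apply: le_trans (ler_wpM2l Qt0 IH) _ => /=.
have C0 := taylor_const_ge0 k; set C := taylor_const k in C0 *.
have q0 : 0 <= Q ^+ k by apply: exprn_ge0; lra.
rewrite !exprS; set q := Q ^+ k in q0 *.
set n : R := k.+1%:R; have n0 : 0 <= n by rewrite /n ler0n.
have -> : k.+2%:R = n + 1 by rewrite /n -[in LHS]natr1.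
rewrite -subr_ge0.
have -> : Q * (Q * q) + (n + 1) * (Q * q) * t + (64 * n + 65 * C) * (Q * q) -
  (Q + t) * (Q * q + n * q * t + C * q) =
  n * q * (64 * Q - t ^+ 2) + C * q * (64 * Q - t) by ring.
by apply: addr_ge0; apply: mulr_ge0; rewrite ?mulr_ge0// subr_ge0.
Qed.

Lemma expr_one_plus_le (N : nat) (c : R) : 0 <= c -> (1 + c / N%:R) ^+ N <= expR c.
Proof.
move=> c0; case: N => [|N]; first by rewrite expr0 -expR0 ler_expR.
have -> : expR c = expR (c / N.+1%:R) ^+ N.+1.
  by rewrite -expRM_natl -mulr_natl mulrC divfK// pnatr_eq0.
apply: lerXn2r; rewrite ?nnegrE ?expR_ge0 ?expR_ge1Dx//.
by rewrite addr_ge0// divr_ge0.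
Qed.
End real_inequalities.

(** * Measure-theoretic preliminaries *)

Section measure_aux.
Context d (T : measurableType d) (R : realType).
Local Open Scope ereal_scope.
Import HBNNSimple.

(** The integral evaluates the set function only on preimages under simple functions, which are
    measurable. This makes a raw [meas] interchangeable with a bundled [probability]. *)
Lemma eq_set_integral (mu nu : set T -> \bar R) (D : set T) (f : T -> \bar R) :
  (forall A, measurable A -> mu A = nu A) ->
  \int[mu]_(x in D) f x = \int[nu]_(x in D) f x.
Proof.
move=> mn; rewrite /integral.
have E (g : T -> \bar R) :
  [set sintegral mu h | h in [set h : {nnsfun T >-> R} | forall x, (h x)%:E <= g x]] =
  [set sintegral nu h | h in [set h : {nnsfun T >-> R} | forall x, (h x)%:E <= g x]].
  by apply: eq_imagel => h _; rewrite /sintegral; apply: eq_fsbigr => x _; rewrite mn.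
by rewrite !E.
Qed.

(* No measurability is assumed: [Dlip f], a supremum over an uncountable family, need not be
   measurable, so all integrals of [Dlip] are only used as upper bounds. *)
Lemma le_integral_nm (mu : {measure set T -> \bar R}) (f g : T -> \bar R) :
  (forall x, 0 <= f x) -> (forall x, f x <= g x) ->
  \int[mu]_x f x <= \int[mu]_x g x.
Proof.
move=> f0 fg; have g0 x : 0 <= g x by exact: le_trans (f0 x) (fg x).
rewrite !ge0_integralTE//; apply: le_ereal_sup => _ [h /= hf <-].
by exists h => //= x; exact: le_trans (hf x) (fg x).
Qed.

(* [is_prob mu] says nothing about the values of [mu] on non-measurable sets. *)
Definition regularize (mu : set T -> \bar R) : set T -> \bar R :=
  fun A => if `[< measurable A >] then mu A else 0.

Lemma regularizeE (mu : set T -> \bar R) A : measurable A -> regularize mu A = mu A.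
Proof. by move=> mA; rewrite /regularize asboolT. Qed.

Lemma is_prob_probability (mu : set T -> \bar R) : is_prob mu ->
  exists P : probability T R, forall A, measurable A -> P A = mu A.
Proof.
move=> [mu0 mu_ge0 musig mu1].
have r0 : regularize mu set0 = 0 by rewrite regularizeE.
have rge0 A : 0 <= regularize mu A.
  by rewrite /regularize; case: ifPn => // /asboolP /mu_ge0.
have rsig : semi_sigma_additive (regularize mu).
  move=> F mF tF mUF; rewrite regularizeE//.
  under eq_fun do under eq_bigr do rewrite regularizeE//.
  exact: musig.
pose m := @isMeasure.Build _ T R _ r0 rge0 rsig.
pose M : {measure set T -> \bar R} := HB.pack (regularize mu) m.
have M1 : M setT = 1 by rewrite /M/= regularizeE.
pose Q := @Measure_isProbability.Build _ T R M M1.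
pose P : probability T R := HB.pack (regularize mu) m Q.
by exists P => A mA; rewrite /= regularizeE.
Qed.

Lemma integral_cst_probability (P : probability T R) (c : \bar R) : \int[P]_x c = c.
Proof.
rewrite (integral_cst P measurableT).
by transitivity (c * 1); [congr (c * _); exact: probability_setT|exact: mule1].
Qed.

Lemma probability_is_prob (P : probability T R) : is_prob P.
Proof. split => //; [exact: measure_semi_sigma_additive|exact: probability_setT]. Qed.

End measure_aux.

Section pushforward_aux.
Context d1 d2 (T1 : measurableType d1) (T2 : measurableType d2) (R : realType).
Local Open Scope ereal_scope.

Lemma pushforward_probability (P : probability T1 R) (f : T1 -> T2) :
  measurable_fun setT f ->
  exists Q : probability T2 R, (forall A, Q A = P (f @^-1` A)) /\
    forall h : T2 -> \bar R, measurable_fun setT h -> (forall x, 0 <= h x) ->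
      \int[Q]_y h y = \int[P]_x h (f x).
Proof.
move=> mf; pose f' : {mfun T1 >-> T2} := HB.pack f (isMeasurableFun.Build _ _ _ _ f mf).
exists (distribution P f'); split => // h mh h0.
by rewrite /distribution ge0_integral_pushforward.
Qed.

End pushforward_aux.

(** * Independent sigma-algebras and Fubini's theorem *)

Section decoupling.
Context d (T : measurableType d) (R : realType).
Variable P : probability T R.
Variables GA GB : set (set T).
Hypotheses (mGA : GA `<=` measurable) (mGB : GB `<=` measurable).
Hypotheses (IGA : setI_closed GA) (IGB : setI_closed GB).
Hypotheses (TGA : GA setT) (TGB : GB setT).
Local Open Scope ereal_scope.
Hypothesis indep : forall A B, GA A -> GB B -> P (A `&` B) = P A * P B.

Let sub_sigma (G : set (set T)) A : G `<=` measurable -> <<s G >> A -> measurable A.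
Proof.
by move=> mG; apply: smallest_sub => //; exact: sigma_algebra_measurable.
Qed.

(** With B fixed, both sides are finite measures in A; they agree on the pi-system G, hence on the
    sigma-algebra that it generates. *)
Lemma indep_pi_lambda (G : set (set T)) (B : set T) :
  G `<=` measurable -> setI_closed G -> G setT -> measurable B ->
  (forall A, G A -> P (A `&` B) = P A * P B) ->
  forall A, <<s G >> A -> P (A `&` B) = P A * P B.
Proof.
move=> mG IG TG mB h A sA.
have fB : P B \is a fin_num by rewrite fin_num_measure.
have rB : (0 <= fine (P B))%R by rewrite fine_ge0.
have := @g_sigma_algebra_measure_unique _ R T G mG (fun=> setT) (fun=> TG)
  (bigcup_const _ _) (mrestr P mB) (mscale (NngNum rB) P) IG.
move=> /(_ _ _ _ A sA) H.
have scE C : mscale (NngNum rB) P C = P C * P B.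
  by rewrite /mscale muleC; congr (_ * _); exact: fineK.
transitivity (mrestr P mB A) => //; rewrite -scE; apply: H; first by exists 0%N.
- by move=> C GC; transitivity (P C * P B); [exact: h|exact/esym/scE].
- move=> _; rewrite -[X in X < _]/(P (setT `&` B)) setTI; apply: le_lt_trans (probability_le1 P mB) _.
  by rewrite ltry.
Qed.

Lemma indep_sigma A B : <<s GA >> A -> <<s GB >> B -> P (A `&` B) = P A * P B.
Proof.
move=> sA sB; rewrite setIC muleC.
apply: (@indep_pi_lambda GB) => //; first exact: sub_sigma sA.
move=> C GC; rewrite setIC muleC.
by apply: (@indep_pi_lambda GA) => //; [exact: mGB|move=> D GD; exact: indep].
Qed.

Lemma measurable_id_sigma (G : set (set T)) : G `<=` measurable ->
  measurable_fun setT (id : T -> g_sigma_algebraType G).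
Proof. by move=> mG _ A mA; rewrite setTI; exact: sub_sigma mA. Qed.

(* Fubini for independent sigma-algebras: one of the two copies of [w] may be frozen. *)
Lemma decoupling_integral
  (F : g_sigma_algebraType GA * g_sigma_algebraType GB -> \bar R) :
  measurable_fun setT F -> (forall x, 0 <= F x) ->
  \int[P]_w F (w, w) = \int[P]_w \int[P]_v F (w, v).
Proof.
move=> mF F0.
have mA := measurable_id_sigma mGA; have mB := measurable_id_sigma mGB.
have mAB : measurable_fun setT
    (fun w : T => (w, w) : g_sigma_algebraType GA * g_sigma_algebraType GB).
  exact: measurable_fun_pair.
have [PA [PAE PAI]] := pushforward_probability P mA.
have [PB [PBE PBI]] := pushforward_probability P mB.
have [Q [QE QI]] := pushforward_probability P mAB.
transitivity (\int[Q]_x F x); first by rewrite QI.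
(* The law of the diagonal map into the two sub-sigma-algebras is the product of its marginals: on
   rectangles this is independence, and rectangles determine the product measure. *)
transitivity (\int[PA \x PB]_x F x).
  apply: eq_set_integral => X mX; apply/esym; apply: product_measure_unique => //.
  move=> A B sA sB; rewrite -[LHS]/(Q (A `*` B)) QE.
  by rewrite -[X in X * _]/(PA A) -[X in _ * X]/(PB B) PAE PBE; exact: indep_sigma.
rewrite fubini_tonelli1// /fubini_F PAI//.
- apply: eq_integral => w _; rewrite PBI//.
  exact: measurableT_comp.
- exact: (@measurable_fun_fubini_tonelli_F _ _ _ _ _ PB).
- by move=> x; apply: integral_ge0.
Qed.
End decoupling.

(** * Borel measurability through coordinates *)

Section Rd_measurability.
Context dd (T : measurableType dd) (R : realType) (d : nat).

Lemma measurable_coord (i : 'I_d) :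
  measurable_fun setT (fun x : Rd R d => (x : 'cV[R]_d) i ord0).
Proof.
apply: (measurability (@RGenOInfty.G R)); first exact: RGenOInfty.measurableE.
move=> _ [_ [r ->] <-]; rewrite setTI.
apply: sub_sigma_algebra; apply: open_comp; last exact: interval_open.
by move=> x _; exact: coord_continuous.
Qed.

Lemma measurable_Rd_coord (h : T -> Rd R d) (i : 'I_d) : measurable_fun setT h ->
  measurable_fun setT (fun w => (h w : 'cV[R]_d) i ord0).
Proof. by move=> mh; exact: (measurableT_comp (measurable_coord i) mh). Qed.

(** An open set is the union of the boxes with rational centre and radius 1/(n+1) that it contains.
    These are countably many, so the Borel sigma-algebra is controlled by the coordinates. *)
Lemma measurable_Rd (h : T -> Rd R d) :
  (forall i, measurable_fun setT (fun w => (h w : 'cV[R]_d) i ord0)) ->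
  measurable_fun setT h.
Proof.
move=> mh; apply: (@measurability _ _ T (Rd R d) setT h (@open 'cV[R]_d)) => //.
move=> _ [U oU <-]; rewrite setTI.
pose box (qn : {ffun 'I_d -> rat} * nat) : set 'cV[R]_d :=
  [set x | forall i, `|x i ord0 - ratr (qn.1 i)| < qn.2.+1%:R^-1].
have -> : h @^-1` U = \bigcup_(qn : {ffun 'I_d -> rat} * nat)
    (if `[< box qn `<=` U >] then h @^-1` (box qn) else set0).
  apply/seteqP; split=> [w Uw|w [qn _]]; last first.
    by case: ifPn => // /asboolP; exact.
  have /nbhs_ballP[e /= e0 eU] : nbhs (h w : 'cV[R]_d) U by exact: open_nbhs_nbhs.
  have [n ne] : exists n, n.+1%:R^-1 < e / 2 :> R.
    by have := @near_infty_natSinv_lt R (PosNum (divr_gt0 e0 (ltr0n R 2)));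
      case=> n _ /(_ n (leqnn n)); exists n.
  have q_ i : exists q : rat, `|(h w : 'cV[R]_d) i ord0 - ratr q| < n.+1%:R^-1 :> R.
    have [q] : exists q : rat, ratr q \in `](h w : 'cV[R]_d) i ord0 - n.+1%:R^-1,
        ((h w : 'cV[R]_d) i ord0 : R)[.
      by apply: rat_in_itvoo; rewrite ltrBlDr ltrDl.
    rewrite in_itv/= => /andP[q1 q2]; exists q.
    by rewrite gtr0_norm ?subr_gt0// ltrBlDl -ltrBlDr.
  have [q hq] := choice q_.
  exists ([ffun i => q i], n) => //.
  have bw : box ([ffun i => q i], n) (h w) by move=> i; rewrite /= ffunE; exact: hq.
  rewrite asboolT// => x bx; apply: eU; split => // i j.
  rewrite ord1 /ball/=.
  have := bx i; have := bw i; rewrite /= ffunE => h1 h2.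
  rewrite (_ : _ - _ = ((h w : 'cV[R]_d) i ord0 - ratr (q i)) - (x i ord0 - ratr (q i))); last by ring.
  apply: le_lt_trans (ler_normB _ _) _.
  by rewrite (splitr e) ltrD// (lt_trans _ ne).
apply: countable_bigcupT_measurable => [|qn]; first exact: countableP.
case: ifPn => // _.
have -> : h @^-1` box qn = \bigcap_(i : 'I_d)
    (setT `&` (fun w => (h w : 'cV[R]_d) i ord0 - ratr (qn.1 i)) @^-1`
       (ball (0:R) qn.2.+1%:R^-1)).
  apply/seteqP; split => [w bw i _|w bw i].
    by split => //=; rewrite /ball/= sub0r normrN; exact: bw.
  by have [_] := bw i I; rewrite /ball/= sub0r normrN.
apply: fin_bigcap_measurable => // i _.
by apply: measurable_funB => //; exact: measurable_ball.
Qed.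

Lemma measurable_enorm (h : T -> Rd R d) : measurable_fun setT h ->
  measurable_fun setT (fun w => enorm (h w : 'cV[R]_d)).
Proof.
move=> mh; rewrite /enorm.
apply: (@measurableT_comp _ _ _ _ _ _ (@Num.sqrt R)) => //.
  by apply: continuous_measurable_fun; exact: sqrt_continuous.
apply: measurable_sum => i; apply: measurable_funX.
exact: measurable_Rd_coord.
Qed.

Lemma measurable_RdB (g h : T -> Rd R d) : measurable_fun setT g -> measurable_fun setT h ->
  measurable_fun setT (fun w => ((g w : 'cV[R]_d) - h w : 'cV[R]_d) : Rd R d).
Proof.
move=> mg mh; apply: measurable_Rd => i.
under eq_fun do rewrite mxE [X in _ + X]mxE.
by apply: measurable_funB; exact: measurable_Rd_coord.
Qed.

Lemma measurable_RdD (g h : T -> Rd R d) : measurable_fun setT g -> measurable_fun setT h ->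
  measurable_fun setT (fun w => ((g w : 'cV[R]_d) + h w : 'cV[R]_d) : Rd R d).
Proof.
move=> mg mh; apply: measurable_Rd => i.
under eq_fun do rewrite mxE.
by apply: measurable_funD; exact: measurable_Rd_coord.
Qed.

Lemma measurable_RdZ (c : R) (h : T -> Rd R d) : measurable_fun setT h ->
  measurable_fun setT (fun w => (c *: (h w : 'cV[R]_d) : 'cV[R]_d) : Rd R d).
Proof.
move=> mh; apply: measurable_Rd => i.
under eq_fun do rewrite mxE.
by apply: measurable_funM => //; exact: measurable_Rd_coord.
Qed.

Lemma measurable_Rd_mulmx (A : 'M[R]_d) (h : T -> Rd R d) : measurable_fun setT h ->
  measurable_fun setT (fun w => (A *m (h w : 'cV[R]_d) : 'cV[R]_d) : Rd R d).
Proof.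
move=> mh; apply: measurable_Rd => i.
under eq_fun do rewrite mxE.
apply: measurable_sum => j; apply: measurable_funM => //.
exact: measurable_Rd_coord.
Qed.
End Rd_measurability.

(** * Empirical measures and couplings *)

Section finite_mixture.
Context dd (T : measurableType dd) (R : realType).
Local Open Scope ereal_scope.

Lemma finite_mixture (N : nat) (g : 'I_N -> R) (x : 'I_N -> T) :
  (forall i, 0 <= g i)%R ->
  exists m : {measure set T -> \bar R},
    (forall A, m A = \sum_(i < N) (g i)%:E * \d_(x i) A) /\
    (forall h : T -> \bar R, measurable_fun setT h -> (forall y, 0 <= h y) ->
      \int[m]_y h y = \sum_(i < N) (g i)%:E * h (x i)).
Proof.
move=> g0.
(* [msum] takes a family indexed by the naturals; indices from N on are sent to the zero measure. *)
pose m_ (n : nat) : {measure set T -> \bar R} :=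
  if insub n is Some i then mscale (NngNum (g0 i)) (\d_(x i) : {measure set T -> \bar R}) else mzero.
have mE (i : 'I_N) : m_ i = mscale (NngNum (g0 i)) (\d_(x i) : {measure set T -> \bar R}) :> {measure set T -> \bar R}.
  by rewrite /m_ valK.
exists (msum m_ N); split => [A|h mh h0].
  by rewrite /= /msum; apply: eq_bigr => i _; rewrite mE.
rewrite ge0_integral_measure_sum//; apply: eq_bigr => i _.
by rewrite mE ge0_integral_mscale//= integral_dirac//= diracT mul1e.
Qed.

Lemma finite_mixture_probability (N : nat) (g : 'I_N -> R) (x : 'I_N -> T) :
  (forall i, 0 <= g i)%R -> (\sum_(i < N) g i = 1)%R ->
  exists m : probability T R,
    (forall A, measurable A -> m A = \sum_(i < N) (g i)%:E * \d_(x i) A) /\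
    (forall h : T -> \bar R, measurable_fun setT h -> (forall y, 0 <= h y) ->
      \int[m]_y h y = \sum_(i < N) (g i)%:E * h (x i)).
Proof.
move=> g0 g1; have [m [mE mI]] := finite_mixture x g0.
have [|P PE] := @is_prob_probability _ T R m.
  split => //; first exact: measure_semi_sigma_additive.
  rewrite mE; under eq_bigr do rewrite diracT mule1.
  by rewrite sumEFin g1.
exists P; split => [A mA|h mh h0]; first by rewrite PE.
by rewrite (eq_set_integral _ _ PE) mI.
Qed.
End finite_mixture.

Section empirical_measure.
Variables (R : realType) (d : nat).
Local Open Scope ereal_scope.

Lemma empiricalE (N : nat) (x : 'I_N -> Rd R d) A :
  empirical x A = \sum_(i < N) ((N%:R^-1)%:E * \d_(x i) A).
Proof. by rewrite /empirical ge0_sume_distrr. Qed.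

Lemma empirical_mixture (N : nat) (x : 'I_N -> Rd R d) : (0 < N)%N ->
  is_prob (empirical x) /\
  (forall h : Rd R d -> \bar R, measurable_fun setT h -> (forall y, 0 <= h y) ->
      \int[empirical x]_y h y = \sum_(i < N) (N%:R^-1)%:E * h (x i)).
Proof.
move=> N0.
have [||m [mE mI]] := @finite_mixture_probability _ (Rd R d) R N (fun=> N%:R^-1)%R x.
- by move=> i; rewrite invr_ge0.
- by rewrite sumr_const card_ord -[X in X = _]mulr_natr mulVf// pnatr_eq0 -lt0n.
have E A : measurable A -> empirical x A = m A by move=> mA; rewrite empiricalE mE.
split; last by move=> h mh h0; rewrite (eq_set_integral _ _ E) mI.
split.
- by rewrite E.
- by move=> A mA; rewrite E.
- move=> F mF tF mUF; rewrite E//; under eq_fun do under eq_bigr do rewrite E//.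
  exact: measure_semi_sigma_additive.
- by rewrite E// probability_setT.
Qed.

Lemma P1_empirical (N : nat) (x : 'I_N -> Rd R d) : (0 < N)%N -> P1 (empirical x).
Proof.
move=> N0; have [h1 h2] := empirical_mixture x N0; split => //.
rewrite h2//.
- by rewrite sumEFin ltry.
- by apply/measurable_EFinP; apply: measurable_enorm.
- by move=> y; rewrite lee_fin /enorm sqrtr_ge0.
Qed.
End empirical_measure.

(** * Euclidean norm and elementary properties of W_1 *)

Section W1_basic.
Variables (R : realType) (d : nat).
Local Open Scope ereal_scope.
Implicit Types mu nu : meas R d.

Lemma enorm_ge0 (x : 'cV[R]_d) : (0 <= enorm x)%R.
Proof. by rewrite /enorm sqrtr_ge0. Qed.

Lemma enorm0 : enorm (0 : 'cV[R]_d) = 0%R.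
Proof. by rewrite /enorm big1 ?sqrtr0// => i _; rewrite mxE expr0n. Qed.

Lemma enormN (x : 'cV[R]_d) : enorm (- x) = enorm x.
Proof. by rewrite /enorm; congr Num.sqrt; apply: eq_bigr => i _; rewrite mxE sqrrN. Qed.

Lemma enorm_sym (x y : 'cV[R]_d) : enorm (x - y) = enorm (y - x).
Proof. by rewrite -enormN opprB. Qed.

Lemma enorm_sqr (x : 'cV[R]_d) : (enorm x ^+ 2 = \sum_(i < d) x i ord0 ^+ 2)%R.
Proof. by rewrite /enorm sqr_sqrtr// sumr_ge0// => i _; exact: sqr_ge0. Qed.

Lemma cauchy_schwarz_sum (I : finType) (a b : I -> R) :
  (\sum_i a i * b i <= Num.sqrt (\sum_i a i ^+ 2) * Num.sqrt (\sum_i b i ^+ 2))%R.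
Proof.
set A := (\sum_i a i ^+ 2)%R; set B := (\sum_i b i ^+ 2)%R.
have A0 : (0 <= A)%R by apply: sumr_ge0 => i _; exact: sqr_ge0.
have B0 : (0 <= B)%R by apply: sumr_ge0 => i _; exact: sqr_ge0.
(* Sum of the squares (s a_i - t b_i)^2. The choice s = |b|, t = |a| gives the inequality after
   division by |a| |b|, so the case where this product vanishes is treated apart. *)
have H (s t : R) : (s * t * 2 * (\sum_i a i * b i) <= s ^+ 2 * A + t ^+ 2 * B)%R.
  rewrite /A /B !mulr_sumr -big_split/=; apply: ler_sum => i _.
  have := sqr_ge0 (s * a i - t * b i); rewrite -subr_ge0; congr (_ <= _)%R; ring.
have := H (Num.sqrt B) (Num.sqrt A); rewrite !sqr_sqrtr// => {}H.
have [/eqP AB0|ABn0] := eqVneq (Num.sqrt A * Num.sqrt B)%R 0%R.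
  move: AB0; rewrite mulf_eq0 => AB0; rewrite (eqP (_ : (Num.sqrt A * Num.sqrt B)%R == 0%R)) ?mulf_eq0//.
  rewrite big1// => i _.
  have Z (c : I -> R) : Num.sqrt (\sum_i c i ^+ 2) == 0%R -> c i = 0%R.
    rewrite sqrtr_eq0 => h; apply/eqP; rewrite -sqrf_eq0 eq_le sqr_ge0 andbT.
    apply: le_trans h; rewrite (bigD1 i)//= lerDl sumr_ge0// => j _; exact: sqr_ge0.
  by case/orP: AB0 => /Z ->; rewrite ?mul0r ?mulr0.
have AB0 : (0 < Num.sqrt A * Num.sqrt B)%R by rewrite lt_neqAle eq_sym ABn0 mulr_ge0 ?sqrtr_ge0.
have E : (B * A + A * B = 2 * (Num.sqrt A * Num.sqrt B) * (Num.sqrt A * Num.sqrt B))%R.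
  transitivity (2 * (Num.sqrt A ^+ 2 * Num.sqrt B ^+ 2))%R; last ring.
  rewrite !sqr_sqrtr//; ring.
move: H; rewrite E (_ : (_ * _ * 2 = 2 * (Num.sqrt A * Num.sqrt B))%R); last ring.
by rewrite ler_pM2l// mulr_gt0.
Qed.

Lemma enormD (x y : 'cV[R]_d) : (enorm (x + y) <= enorm x + enorm y)%R.
Proof.
rewrite -(@ler_pXn2r _ 2)// ?nnegrE ?addr_ge0 ?enorm_ge0//.
rewrite enorm_sqr sqrrD !enorm_sqr.
rewrite (eq_bigr (fun i => x i ord0 ^+ 2 + (x i ord0 * y i ord0) *+ 2 + y i ord0 ^+ 2)%R); last first.
  by move=> i _; rewrite mxE sqrrD.
rewrite big_split/= lerD2r big_split/= lerD2l sumrMnl ler_wMn2r//.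
exact: cauchy_schwarz_sum.
Qed.

Lemma enormZ (c : R) (x : 'cV[R]_d) : (enorm (c *: x) = `|c| * enorm x)%R.
Proof.
rewrite /enorm -sqrtr_sqr -sqrtrM ?sqr_ge0// mulr_sumr; congr Num.sqrt.
by apply: eq_bigr => i _; rewrite mxE exprMn.
Qed.

Lemma enorm_tri (x y z : 'cV[R]_d) : (enorm (x - z) <= enorm (x - y) + enorm (y - z))%R.
Proof. by rewrite (_ : x - z = (x - y) + (y - z))%R ?enormD// addrA subrK. Qed.

Lemma W1_le mu nu (pi : set (Rd R d * Rd R d) -> \bar R) : coupling mu nu pi ->
  W1 mu nu <= \int[pi]_p (enorm ((p.1 : 'cV[R]_d) - p.2))%:E.
Proof. by move=> h; apply: ereal_inf_lbound; exists pi. Qed.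

Lemma coupling_probability mu nu (pi : set (Rd R d * Rd R d) -> \bar R) :
  coupling mu nu pi -> exists Q : probability (Rd R d * Rd R d)%type R,
    (forall A, measurable A -> Q A = pi A) /\ coupling mu nu Q.
Proof.
move=> [/is_prob_probability[Q QE] h1 h2]; exists Q; split => //.
split; first exact: probability_is_prob.
- by move=> A mA; rewrite QE ?h1//; apply: measurableX.
- by move=> A mA; rewrite QE ?h2//; apply: measurableX.
Qed.

(** Bundled probabilities suffice as test couplings: every coupling agrees with one on measurable
    sets, and the cost integral sees no others. *)
Lemma W1_ge mu nu (c : \bar R) :
  (forall Q : probability (Rd R d * Rd R d)%type R, coupling mu nu Q ->
     c <= \int[Q]_p (enorm ((p.1 : 'cV[R]_d) - p.2))%:E) -> c <= W1 mu nu.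
Proof.
move=> h; apply: le_ereal_inf_tmp => _ [pi hpi <-].
have [Q [QE /h]] := coupling_probability hpi.
by rewrite (eq_set_integral _ _ QE).
Qed.

Lemma W1_ge0 mu nu : 0 <= W1 mu nu.
Proof.
by apply: W1_ge => Q _; apply: integral_ge0 => p _; rewrite lee_fin enorm_ge0.
Qed.

Lemma measurable_enormB dd (T : measurableType dd) (g h : T -> Rd R d) :
  measurable_fun setT g -> measurable_fun setT h ->
  measurable_fun setT (fun w => (enorm ((g w : 'cV[R]_d) - h w))%:E).
Proof.
move=> mg mh; apply/measurable_EFinP.
exact: (measurable_enorm (measurable_RdB mg mh)).
Qed.

Lemma W1_sym mu nu : W1 mu nu = W1 nu mu.
Proof.
suff h (m1 m2 : meas R d) : W1 m1 m2 <= W1 m2 m1 by apply/eqP; rewrite eq_le !h.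
apply: W1_ge => Q [Q1 Q2 Q3].
have [Q' [QE QI]] := pushforward_probability Q (@measurable_swap _ _ (Rd R d) (Rd R d)).
apply: (@le_trans _ _ (\int[Q']_p (enorm ((p.1 : 'cV[R]_d) - p.2))%:E)).
  apply: W1_le; split; first exact: probability_is_prob.
  - move=> A mA; rewrite QE -Q3//; congr (Q _).
    by apply/seteqP; split => [[a b]|[a b]] /=; tauto.
  - move=> A mA; rewrite QE -Q2//; congr (Q _).
    by apply/seteqP; split => [[a b]|[a b]] /=; tauto.
rewrite QI; last 2 first.
- by apply: measurable_enormB; [exact: measurable_fst|exact: measurable_snd].
- by move=> p; rewrite lee_fin enorm_ge0.
rewrite le_eqVlt; apply/orP; left; apply/eqP.
by apply: eq_integral => -[a b] _ /=; rewrite enorm_sym.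
Qed.
End W1_basic.

Lemma eq_indic (R : pzRingType) (T U : Type) (A : set T) (B : set U) (x : T) (y : U) :
  (A x <-> B y) -> \1_A x = \1_B y :> R.
Proof.
move=> AB; rewrite !indicE; congr (nat_of_bool _)%:R.
by apply/idP/idP; rewrite !inE => /AB.
Qed.

(** * Couplings with an empirical measure *)

Section mixture_coupling.
Variables (R : realType) (d : nat).
Local Open Scope ereal_scope.

(* Couplings with an empirical measure are built from weights [g i], the conditional law of the
   index [i] given [p]; this replaces the gluing lemma, which would need disintegration. *)
Lemma W1_empirical_le dd (Y : measurableType dd) (N : nat) (y : 'I_N -> Rd R d)
    (lam : meas R d) (pi : probability Y R) (z : Y -> Rd R d) (g : 'I_N -> Y -> R) :
  measurable_fun setT z ->
  (forall B, measurable B -> pi (z @^-1` B) = lam B) ->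
  (forall i, measurable_fun setT (g i)) ->
  (forall i p, 0 <= g i p)%R ->
  (forall p, \sum_(i < N) g i p = 1)%R ->
  (forall i, \int[pi]_p (g i p)%:E = (N%:R^-1)%:E) ->
  W1 (empirical y) lam <=
    \int[pi]_p (\sum_(i < N) g i p * enorm ((y i : 'cV[R]_d) - z p))%:E.
Proof.
move=> mz zlam mg g0 g1 gN.
have kE p : exists m : probability (Rd R d * Rd R d)%type R,
    (forall A, measurable A -> m A = \sum_(i < N) (g i p)%:E * \d_((y i, z p)) A) /\
    (forall h : (Rd R d * Rd R d)%type -> \bar R, measurable_fun setT h -> (forall y, 0 <= h y) ->
      \int[m]_y h y = \sum_(i < N) (g i p)%:E * h (y i, z p)).
  exact: finite_mixture_probability.
have [K KE] := choice kE.
pose k : Y -> giry (Rd R d * Rd R d)%type R := fun p => K p.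
have mpair i : measurable_fun setT (fun p => (y i, z p)).
  exact: measurable_fun_pair.
have mk : measurable_fun setT k.
  apply: measurable_giry_codensity => // B mB.
  rewrite (_ : (k ^~ B) = fun p => \sum_(i < N) (g i p)%:E * \d_((y i, z p)) B); last first.
    by apply/funext => p; rewrite /k /= (KE p).1.
  apply: emeasurable_sum => i; apply: emeasurable_funM; first exact/measurable_EFinP.
  apply/measurable_EFinP => /=.
  exact: (measurableT_comp ((measurable_indicP R B).1 mB) (mpair i)).
(* The coupling: draw p from [pi], then i with weights [g i p], and output (y i, z p). The first
   marginal is uniform on the y i since each [g i] has mean N^-1, the second is the law of z. *)
pose G := giry_bind (pi : giry Y R) mk.
have GI (h : (Rd R d * Rd R d)%type -> \bar R) : measurable_fun setT h ->
    (forall x, 0 <= h x) ->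
    \int[G]_q h q = \int[pi]_p \sum_(i < N) (g i p)%:E * h (y i, z p).
  move=> mh h0; rewrite -[LHS]/(giry_int G h) giry_int_bind//.
  by apply: eq_integral => p _; rewrite /giry_int (KE p).2.
have GA A : measurable A -> G A = \int[pi]_p \sum_(i < N) (g i p)%:E * (\1_A (y i, z p))%:E.
  move=> mA; rewrite -(GI (fun q => (\1_A q)%:E)); first by rewrite integral_indic// setIT.
    by apply/measurable_EFinP; exact: measurable_indic.
  by move=> q; rewrite lee_fin indicE.
apply: (@le_trans _ _ (\int[G]_q (enorm ((q.1 : 'cV[R]_d) - q.2))%:E)); last first.
  rewrite GI; last 2 first.
  - by apply: measurable_enormB; [exact: measurable_fst|exact: measurable_snd].
  - by move=> q; rewrite lee_fin enorm_ge0.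
  rewrite le_eqVlt; apply/orP; left; apply/eqP; apply: eq_integral => p _ /=.
  by rewrite -sumEFin; apply: eq_bigr => i _; rewrite EFinM.
apply: W1_le; split.
- split => //; first exact: measure_semi_sigma_additive.
  rewrite GA// (eq_integral (cst 1)) ?integral_cst ?mul1e//; first exact: probability_setT.
  move=> p _; under eq_bigr do rewrite indicT mule1.
  by rewrite sumEFin g1.
- move=> A mA; rewrite GA; last exact: measurableX.
  rewrite empiricalE.
  rewrite (eq_integral (fun p => \sum_(i < N) (\1_A (y i))%:E * (g i p)%:E)); last first.
    move=> p _; apply: eq_bigr => i _; rewrite muleC; congr (_%:E * _).
    by apply: eq_indic => /=; tauto.
  rewrite ge0_integral_sum//.
  + apply: eq_bigr => i _; rewrite ge0_integralZl//.
    * by rewrite gN muleC.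
    * exact/measurable_EFinP.
    * by move=> p _; rewrite lee_fin.
  + by move=> i; apply: emeasurable_funM => //; exact/measurable_EFinP.
  + by move=> i p _; rewrite mule_ge0// lee_fin// indicE.
- move=> B mB; rewrite GA; last exact: measurableX.
  rewrite -zlam// (eq_integral (fun p => (\1_(z @^-1` B) p)%:E)); last first.
    move=> p _; rewrite (eq_bigr (fun i => (g i p)%:E * (\1_(z @^-1` B) p)%:E)); last first.
      move=> i _; congr (_ * _%:E).
      by apply: eq_indic => /=; tauto.
    rewrite -ge0_sume_distrl; last by move=> i _; rewrite lee_fin.
    by rewrite sumEFin g1 mul1e.
  have mzB : measurable (z @^-1` B) by rewrite -[X in measurable X]setTI; exact: mz.
  by rewrite integral_indic// setIT.
Qed.

Lemma sum_inv_card (N : nat) : (0 < N)%N -> (\sum_(i < N) N%:R^-1 = 1 :> R)%R.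
Proof.
by move=> N0; rewrite sumr_const card_ord -[LHS]mulr_natr mulVf// pnatr_eq0 -lt0n.
Qed.

Lemma W1_empirical_dirac (N : nat) (x : 'I_N -> Rd R d) : (0 < N)%N ->
  W1 (empirical x) (@dirac _ (Rd R d) (0%R : 'cV[R]_d) R) <=
  (N%:R^-1 * \sum_(i < N) enorm (x i : 'cV[R]_d))%:E.
Proof.
move=> N0.
have := @W1_empirical_le _ (Rd R d) N x (@dirac _ (Rd R d) (0%R : 'cV[R]_d) R)
  (@dirac _ (Rd R d) (0%R : 'cV[R]_d) R) id (fun _ _ => N%:R^-1)%R.
move=> /(_ _ _ _ _ _ _)/le_trans; apply => //.
- by move=> _; exact: sum_inv_card.
- by move=> i; rewrite integral_dirac//= diracT mul1e.
- rewrite integral_dirac//= ?diracT ?mul1e.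
    by rewrite lee_fin mulr_sumr; apply: ler_sum => i _; rewrite subr0.
  apply/measurable_EFinP; apply: measurable_sum => i; apply: measurable_funM => //.
  by apply/measurable_EFinP; apply: measurable_enormB.
Qed.

Lemma coupling_integral1 (mu nu : meas R d) (Q : probability (Rd R d * Rd R d)%type R)
    (h : Rd R d -> \bar R) : coupling mu nu Q ->
  measurable_fun setT h -> (forall x, 0 <= h x) ->
  \int[Q]_p h p.1 = \int[mu]_x h x.
Proof.
move=> [_ Q1 _] mh h0.
have [Q' [QE QI]] := pushforward_probability Q (@measurable_fst _ _ (Rd R d) (Rd R d)).
rewrite -QI//; apply: eq_set_integral => A mA; rewrite QE -Q1//; congr (Q _).
by apply/seteqP; split => [[a b]|[a b]] /=; tauto.
Qed.

(** A triangle inequality whose first leg is explicit. For a coupling Q of nu and lam, the index is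
    drawn with the weights at the first component of Q, so that [W1_empirical_le] with z the second
    projection covers both legs at once. *)
Lemma W1_glue (N : nat) (y : 'I_N -> Rd R d) (nu lam : meas R d) (g : 'I_N -> Rd R d -> R) :
  is_prob nu ->
  (forall i, measurable_fun setT (g i)) ->
  (forall i p, 0 <= g i p)%R ->
  (forall p, \sum_(i < N) g i p = 1)%R ->
  (forall i, \int[nu]_p (g i p)%:E = (N%:R^-1)%:E) ->
  W1 (empirical y) lam <=
    \int[nu]_u (\sum_(i < N) g i u * enorm ((y i : 'cV[R]_d) - u))%:E + W1 nu lam.
Proof.
move=> /is_prob_probability[nu' nuE] mg g0 g1 gN.
set I := (X in _ <= X + _).
have I0 : 0 <= I.
  rewrite /I -(eq_set_integral _ _ nuE).
  by apply: integral_ge0 => u _; rewrite lee_fin sumr_ge0// => i _; rewrite mulr_ge0// enorm_ge0.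
have [Iy|Iy] := eqVneq I +oo.
  by rewrite Iy addye ?leey// gt_eqF// (lt_le_trans _ (W1_ge0 _ _)).
have fI : I \is a fin_num by rewrite ge0_fin_numE// lt_neqAle Iy leey.
rewrite addeC -leeBlDr//; apply: W1_ge => Q cQ; rewrite leeBlDr//.
have [_ Q2 Q3] := cQ.
have mgu (i : 'I_N) : measurable_fun setT (fun u : Rd R d => g i u * enorm ((y i : 'cV[R]_d) - u))%R.
  apply: measurable_funM => //; apply/measurable_EFinP.
  by apply: measurable_enormB => //; exact: measurable_id.
apply: le_trans.
  apply: (@W1_empirical_le _ _ N y lam Q snd (fun i p => g i p.1)) => //.
  - move=> B mB; rewrite -Q3//; congr (Q _).
    by apply/seteqP; split => [[a b]|[a b]] /=; tauto.
  - by move=> i; exact: (measurableT_comp (mg i) measurable_fst).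
  - move=> i; rewrite -(gN i).
    apply: (coupling_integral1 (h := fun u => (g i u)%:E) cQ); first exact/measurable_EFinP.
    by move=> u; rewrite lee_fin.
rewrite /I -(coupling_integral1 cQ); last 2 first.
- by apply/measurable_EFinP; exact: measurable_sum.
- by move=> u; rewrite lee_fin sumr_ge0// => i _; rewrite mulr_ge0// enorm_ge0.
rewrite -ge0_integralD//.
- apply: ge0_le_integral => //.
  + by move=> p _; rewrite lee_fin sumr_ge0// => i _; rewrite mulr_ge0// enorm_ge0.
  + apply/measurable_EFinP; apply: measurable_sum => i; apply: measurable_funM.
      exact: (measurableT_comp (mg i) measurable_fst).
    by apply/measurable_EFinP; apply: measurable_enormB => //; exact: measurable_snd.
  + apply: emeasurable_funD.
      by apply: measurable_enormB; [exact: measurable_fst|exact: measurable_snd].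
    apply/measurable_EFinP.
    apply: (measurableT_comp (f := fun u : Rd R d => (\sum_(i < N) g i u * enorm ((y i : 'cV[R]_d) - u))%R)).
      exact: measurable_sum.
    exact: measurable_fst.
  + move=> p _; rewrite -EFinD lee_fin addrC.
    apply: (@le_trans _ _ (\sum_(i < N) (g i p.1 * enorm ((y i : 'cV[R]_d) - p.1) +
        g i p.1 * enorm ((p.1 : 'cV[R]_d) - p.2)))%R); last first.
      by rewrite big_split/= -mulr_suml g1 mul1r.
    by apply: ler_sum => i _; rewrite -mulrDr ler_wpM2l//; exact: enorm_tri.
- by move=> p _; rewrite lee_fin enorm_ge0.
- by apply: measurable_enormB; [exact: measurable_fst|exact: measurable_snd].
- by move=> p _; rewrite lee_fin sumr_ge0// => i _; rewrite mulr_ge0// enorm_ge0.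
- apply/measurable_EFinP.
  apply: (measurableT_comp (f := fun u : Rd R d => (\sum_(i < N) g i u * enorm ((y i : 'cV[R]_d) - u))%R)).
    exact: measurable_sum.
  exact: measurable_fst.
Qed.

Lemma enorm_eq0 (x : 'cV[R]_d) : enorm x = 0%R -> x = 0%R.
Proof.
move=> /eqP; rewrite /enorm sqrtr_eq0 => h.
apply/matrixP => i j; rewrite ord1 !mxE; apply/eqP; rewrite -sqrf_eq0 eq_le sqr_ge0 andbT.
by apply: le_trans h; rewrite (bigD1 i)//= lerDl sumr_ge0// => k _; exact: sqr_ge0.
Qed.

(** The natural coupling sends x i to y i, but [W1_glue] wants weights that depend on the point
    only, while several indices may share a point. The mass at u is therefore split equally among
    the indices i with x i = u. *)
Lemma W1_empirical_lip (N : nat) (x y : 'I_N -> Rd R d) (lam : meas R d) : (0 < N)%N ->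
  W1 (empirical y) lam <=
    (N%:R^-1 * \sum_(i < N) enorm ((y i : 'cV[R]_d) - x i))%:E + W1 (empirical x) lam.
Proof.
move=> N0.
pose b i (u : Rd R d) : R := (enorm ((x i : 'cV[R]_d) - u) == 0%R)%:R.
pose S u : R := (\sum_j b j u)%R.
(* Off the atoms of [empirical x] the default N^-1 keeps the sum of the weights equal to 1. *)
pose g i u : R := if S u == 0%R then N%:R^-1%R else (b i u / S u)%R.
have NR0 : N%:R != 0%R :> R by rewrite pnatr_eq0 -lt0n.
have b0 i u : (0 <= b i u)%R by rewrite /b ler0n.
have S0 u : (0 <= S u)%R by apply: sumr_ge0.
have bE i k : b i (x k) != 0%R -> x i = x k.
  rewrite /b; have [e _|/eqP/negPf->] := pselect (enorm ((x i : 'cV[R]_d) - x k) = 0%R).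
    exact: subr0_eq (enorm_eq0 e).
  by rewrite /= eqxx.
have bC i k : b i (x k) = b k (x i) by rewrite /b enorm_sym.
have Sx k : S (x k) != 0%R.
  rewrite gt_eqF// /S (bigD1 k)//= ltr_pwDl ?sumr_ge0//.
  by rewrite /b subrr enorm0 eqxx.
have mb i : measurable_fun setT (b i).
  rewrite /b; apply: (@measurableT_comp _ _ _ _ _ _ (fun c : bool => c%:R : R)) => //.
  apply: measurable_fun_eqr => //; apply/measurable_EFinP.
  by apply: measurable_enormB => //; exact: measurable_id.
have mS : measurable_fun setT S by exact: measurable_sum.
have mg i : measurable_fun setT (g i).
  apply: measurable_fun_ifT => //; first exact: measurable_fun_eqr.
  apply: measurable_funM => //.
  under eq_fun do rewrite -powR_inv1//.
  by apply: (@measurableT_comp _ _ _ _ _ _ (fun a : R => a `^ (- 1))%R _ S).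
have g0 i u : (0 <= g i u)%R.
  by rewrite /g; case: ifP => _; rewrite ?invr_ge0// divr_ge0.
have [pe eI] := empirical_mixture x N0.
apply: le_trans (W1_glue (nu := empirical x) y lam pe mg g0 _ _) _.
- move=> u; have [Su|Su] := eqVneq (S u) 0%R.
    rewrite (eq_bigr (fun=> N%:R^-1%R)) ?sum_inv_card// => i _.
    by rewrite /g Su eqxx.
  rewrite (eq_bigr (fun i => b i u / S u)%R); last by move=> i _; rewrite /g (negbTE Su).
  by rewrite -mulr_suml mulfV.
- move=> i; rewrite (eI (fun u => (g i u)%:E)); last 2 first.
  + exact/measurable_EFinP.
  + by move=> u; rewrite lee_fin.
  under eq_bigr do rewrite -EFinM.
  rewrite sumEFin -mulr_sumr -[RHS]mule1 -EFinM; congr (_ * _)%:E.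
  rewrite (eq_bigr (fun k => b k (x i) / S (x i)))%R; last first.
    move=> k _; rewrite /g (negbTE (Sx k)) -(bC i k).
    have [->|/bE ->//] := eqVneq (b i (x k)) 0%R; first by rewrite !mul0r.
  by rewrite -mulr_suml; exact: mulfV (Sx i).
rewrite leeD2r// eI//; last 2 first.
- apply/measurable_EFinP; apply: measurable_sum => i; apply: measurable_funM => //.
  by apply/measurable_EFinP; apply: measurable_enormB => //; exact: measurable_id.
- by move=> u; rewrite lee_fin sumr_ge0// => i _; rewrite mulr_ge0// enorm_ge0.
under eq_bigr do rewrite -EFinM.
rewrite sumEFin lee_fin -mulr_sumr ler_wpM2l ?invr_ge0//.
rewrite exchange_big/=; apply: ler_sum => i _.
rewrite (eq_bigr (fun k => b k (x i) / S (x i) * enorm ((y i : 'cV[R]_d) - x i)))%R.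
  by rewrite -!mulr_suml [X in (X * _)%R](mulfV (Sx i)) mul1r.
move=> k _; rewrite /g (negbTE (Sx k)) -(bC i k).
have [->|/bE ->//] := eqVneq (b i (x k)) 0%R; first by rewrite !mul0r.
Qed.
End mixture_coupling.

(** * Measurability of the dynamics *)

Section W1_measurability.
Variables (R : realType) (d : nat).

Definition ratv (q : {ffun 'I_d -> rat}) : 'cV[R]_d := \col_j ratr (q j).

Lemma enorm_le_sum (x : 'cV[R]_d) : enorm x <= \sum_i `|x i ord0|.
Proof.
rewrite -(@ler_pXn2r _ 2)// ?nnegrE ?enorm_ge0// ?sumr_ge0//.
rewrite enorm_sqr expr2 mulr_suml; apply: ler_sum => i _.
rewrite -real_normK ?num_real// expr2 ler_wpM2l//.
by rewrite (bigD1 i)//= lerDl sumr_ge0.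
Qed.

Lemma ratv_dense (x : 'cV[R]_d) (e : R) : 0 < e -> exists q, enorm (x - ratv q) < e.
Proof.
move=> e0; have ed : 0 < e / d.+1%:R by rewrite divr_gt0.
have q_ i : exists q : rat, `|x i ord0 - ratr q| < e / d.+1%:R.
  have [q] : exists q : rat, ratr q \in `]x i ord0 - e / d.+1%:R, (x i ord0 : R)[.
    by apply: rat_in_itvoo; rewrite ltrBlDr ltrDl.
  rewrite in_itv/= => /andP[q1 q2]; exists q.
  by rewrite gtr0_norm ?subr_gt0// ltrBlDl -ltrBlDr.
have [q hq] := choice q_.
exists [ffun i => q i]; apply: le_lt_trans (enorm_le_sum _) _.
apply: (@le_lt_trans _ _ (\sum_(i < d) e / d.+1%:R)).
  by apply: ler_sum => i _; rewrite !mxE ffunE ltW.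
rewrite sumr_const card_ord -[X in X < _]mulr_natr -mulrA gtr_pMr// mulrC ltr_pdivrMr// mul1r ltr_nat.
by [].
Qed.

(** W_1 is an infimum over uncountably many couplings. By [W1_empirical_lip] the event that it lies
    below r is a countable union over rational configurations q: the mean distance to q plus the
    constant W_1(q, lam) is below r. *)
Lemma measurable_W1_empirical dd (T : measurableType dd) (N : nat)
    (X : 'I_N -> T -> Rd R d) (lam : meas R d) : (0 < N)%N ->
  (forall i, measurable_fun setT (X i)) ->
  measurable_fun setT (fun w => W1 (empirical (fun i => X i w)) lam).
Proof.
move=> N0 mX.
apply: (measurability (@ErealGenInftyO.G R)); first exact: ErealGenInftyO.measurableE.
move=> _ [_ [r ->] <-]; rewrite setTI.
pose av (w : T) (q : {ffun 'I_N -> {ffun 'I_d -> rat}}) : R :=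
  N%:R^-1 * \sum_(i < N) enorm ((X i w : 'cV[R]_d) - ratv (q i)).
have -> : (fun w => W1 (empirical (fun i => X i w)) lam) @^-1` `]-oo, r%:E[ =
    \bigcup_(q : {ffun 'I_N -> {ffun 'I_d -> rat}})
      [set w | ((av w q)%:E + W1 (empirical (fun i => ratv (q i) : Rd R d)) lam < r%:E)%E].
  apply/seteqP; split => [w|w [q _]] /=; rewrite in_itv/=; last first.
    by apply: le_lt_trans; exact: W1_empirical_lip.
  move=> Wr.
  have fW : W1 (empirical (fun i => X i w)) lam \is a fin_num.
    by rewrite ge0_fin_numE ?W1_ge0// (lt_le_trans Wr)// leey.
  pose c := fine (W1 (empirical (fun i => X i w)) lam).
  have cE : W1 (empirical (fun i => X i w)) lam = c%:E by rewrite fineK.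
  (* The distance to q enters twice, once in the union and once in comparing W_1 at q with c, so it
     has to be below half the gap. *)
  have cr : 0 < (r - c) / 2.
    by move: Wr; rewrite cE lte_fin => Wr; rewrite divr_gt0// subr_gt0.
  have [q hq] := choice (fun i => ratv_dense (X i w : 'cV[R]_d) cr).
  exists [ffun i => q i] => //=.
  have avw : av w [ffun i => q i] < (r - c) / 2.
    rewrite /av mulrC ltr_pdivrMr ?ltr0n//.
    apply: (@lt_le_trans _ _ (\sum_(i < N) (r - c) / 2)); last first.
      by rewrite sumr_const card_ord mulr_natr.
    apply: ltr_sum.
      by apply/hasP; exists (Ordinal N0); rewrite ?mem_index_enum.
    by move=> i _; rewrite ffunE.
  have := @W1_empirical_lip R d N (fun i => X i w) (fun i => ratv ([ffun i => q i] i) : Rd R d) lam N0.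
  rewrite cE => /(leeD2l (av w [ffun i => q i])%:E)/le_lt_trans; apply.
  have -> : N%:R^-1 * \sum_(i < N) enorm ((ratv ([ffun i0 => q i0] i) : 'cV[R]_d) - X i w) =
      av w [ffun i => q i].
    by rewrite /av; congr (_ * _); apply: eq_bigr => i _; rewrite enorm_sym.
  rewrite -!EFinD lte_fin.
  by move: avw; lra.
apply: countable_bigcupT_measurable => [|q]; first exact: countableP.
rewrite -[X in measurable X]setTI; apply: emeasurable_fun_infty_o => //.
apply: emeasurable_funD => //; apply/measurable_EFinP; apply: measurable_funM => //.
apply: measurable_sum => i; apply/measurable_EFinP.
by apply: (measurable_enormB (h := fun=> ratv (q i))).
Qed.
End W1_measurability.

Section f_measurability.
Variables (R : realType) (d m : nat).
Variable f : Rd R d -> meas R d -> Rd R m -> Rd R d.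
Hypothesis hf : f_measurable f.
Context dd (T : measurableType dd).

(** The sigma-algebra in [f_measurable] is generated by rectangles, and their middle factor by
    W_1-balls; so the random measure needs to be tested on balls only. *)
Lemma measurable_f_comp (X : T -> Rd R d) (mu : T -> meas R d) (z : T -> Rd R m) :
  measurable_fun setT X -> measurable_fun setT z -> (forall w, P1 (mu w)) ->
  (forall nu r, P1 nu -> measurable [set w | (W1 nu (mu w) < r%:E)%E]) ->
  measurable_fun setT (fun w => f (X w) (mu w) (z w)).
Proof.
move=> mX mz P1mu mW _ B mB; rewrite setTI.
have borel S : borel_P1 S -> measurable (mu @^-1` S).
  apply: (@smallest_sub _ _ _ [set S | measurable (mu @^-1` S)]).
    split => /=.
    - by rewrite preimage_set0.
    - move=> A mA; rewrite (_ : _ @^-1` _ = ~` (mu @^-1` A)); first exact: measurableC.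
      by apply/seteqP; split => [w []|w] //= h; split.
    - by move=> F mF; rewrite preimage_bigcup; exact: bigcupT_measurable.
  move=> _ [nu [r [P1nu r0 ->]]] /=.
  rewrite (_ : _ @^-1` _ = [set w | (W1 nu (mu w) < r%:E)%E]); first exact: mW.
  by apply/seteqP; split => [w []|w] //= h; split.
pose tri w := ((X w, mu w), z w).
have := hf mB; set S0 := (X in _ X -> _).
rewrite (_ : _ @^-1` _ = tri @^-1` S0); last first.
  by apply/seteqP; split => [w|w []] //= h; split => //=; exact: P1mu.
apply: (@smallest_sub _ _ _ [set S | measurable (tri @^-1` S)]).
  split => /=.
  - by rewrite preimage_set0.
  - move=> A mA; rewrite (_ : _ @^-1` _ = ~` (tri @^-1` A)); first exact: measurableC.
    by apply/seteqP; split => [w []|w] //= h; split => //=; exact: P1mu.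
  - by move=> F mF; rewrite preimage_bigcup; exact: bigcupT_measurable.
move=> _ [A [S [C [mA bS mC ->]]]] /=.
rewrite (_ : _ @^-1` _ = (X @^-1` A `&` mu @^-1` S) `&` z @^-1` C); last first.
  by apply/seteqP; split => [w [[]]|w [[]]].
apply: measurableI; last by rewrite -[X in measurable X]setTI; exact: mz.
apply: measurableI; last exact: borel.
by rewrite -[X in measurable X]setTI; exact: mX.
Qed.

Lemma measurable_f_empirical (N : nat) (X : T -> Rd R d) (Y : 'I_N -> T -> Rd R d)
    (z : T -> Rd R m) : (0 < N)%N ->
  measurable_fun setT X -> (forall i, measurable_fun setT (Y i)) -> measurable_fun setT z ->
  measurable_fun setT (fun w => f (X w) (empirical (fun i => Y i w)) (z w)).
Proof.
move=> N0 mX mY mz; apply: measurable_f_comp => //.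
  by move=> w; exact: P1_empirical.
move=> nu r _; under eq_set do rewrite W1_sym.
rewrite -[X in measurable X]setTI; apply: emeasurable_fun_infty_o => //.
exact: measurable_W1_empirical.
Qed.

Lemma measurable_f_cst (X : T -> Rd R d) (mu : meas R d) (z : T -> Rd R m) : P1 mu ->
  measurable_fun setT X -> measurable_fun setT z ->
  measurable_fun setT (fun w => f (X w) mu (z w)).
Proof.
move=> P1mu mX mz; apply: measurable_f_comp => // nu r _.
have [h|h] := pselect ((W1 nu mu < r%:E)%E).
  by rewrite (_ : [set _ | _] = setT)//; apply/seteqP; split.
by rewrite (_ : [set _ | _] = set0)//; apply/seteqP; split.
Qed.

Variables (A : 'M[R]_d) (delta : R).

Definition step (x : Rd R d) (mu : meas R d) (z : Rd R m) : Rd R d :=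
  (A *m (x : 'cV[R]_d) + delta *: f x mu z : 'cV[R]_d).

Lemma measurable_step_empirical (N : nat) (X : T -> Rd R d) (Y : 'I_N -> T -> Rd R d)
    (z : T -> Rd R m) : (0 < N)%N ->
  measurable_fun setT X -> (forall i, measurable_fun setT (Y i)) -> measurable_fun setT z ->
  measurable_fun setT (fun w => step (X w) (empirical (fun i => Y i w)) (z w)).
Proof.
move=> N0 mX mY mz; apply: measurable_RdD; first exact: measurable_Rd_mulmx.
by apply: measurable_RdZ; exact: measurable_f_empirical.
Qed.

Lemma measurable_step_cst (X : T -> Rd R d) (mu : meas R d) (z : T -> Rd R m) : P1 mu ->
  measurable_fun setT X -> measurable_fun setT z ->
  measurable_fun setT (fun w => step (X w) mu (z w)).
Proof.
move=> N0 mX mz; apply: measurable_RdD; first exact: measurable_Rd_mulmx.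
by apply: measurable_RdZ; exact: measurable_f_cst.
Qed.

(** The space T is arbitrary, because the lemma is also applied with the sigma-algebra of the past,
    for which only the noises of time index j < n are measurable. *)
Lemma measurable_particles (X0 : forall N : nat, 'I_N -> T -> Rd R d)
    (eps : nat -> nat -> T -> Rd R m) (N n : nat) : (0 < N)%N ->
  (forall i, measurable_fun setT (X0 N i)) ->
  (forall j (i : 'I_N), (j < n)%N -> measurable_fun setT (eps j i)) ->
  forall i, measurable_fun setT (particles A delta f X0 eps N n i).
Proof.
move=> N0 mX0; elim: n => [|n IH] meps i; first exact: mX0.
have mX := IH (fun j i jn => meps j i (ltnW jn)).
by apply: (measurable_step_empirical (Y := particles A delta f X0 eps N n)) => //; exact: meps.
Qed.
End f_measurability.

(** * Transport through a finite partition *)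

Section discrete_coupling.
Variables (R : realType) (F : finType).
Variables p q : F -> R.
Hypotheses (p0 : forall c, 0 <= p c) (q0 : forall c, 0 <= q c).
Hypothesis pq : \sum_c p c = \sum_c q c.

Let m c := Num.min (p c) (q c).
Let a c := p c - m c.
Let b c := q c - m c.
Let t := \sum_c a c.

(* The maximal coupling of [p] and [q]: the common part stays put, the excess is sent independently. *)
Definition disc_coupling (c' c : F) : R := (c' == c)%:R * m c + a c' * b c / t.

Let m0 c : 0 <= m c. Proof. by rewrite /m le_min p0 q0. Qed.
Let a0 c : 0 <= a c. Proof. by rewrite subr_ge0 /m ge_min lexx. Qed.
Let b0 c : 0 <= b c. Proof. by rewrite subr_ge0 /m ge_min lexx orbT. Qed.
Let t0 : 0 <= t. Proof. by apply: sumr_ge0. Qed.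
Let tb : \sum_c b c = t.
Proof. by rewrite /t /a /b !sumrB pq. Qed.

(** For p = q the excess t is 0 and [disc_coupling] divides by zero. Every quantity between 0 and t
    then vanishes too, so the marginals remain correct. *)
Let divt (u : R) : 0 <= u -> u <= t -> u * t / t = u.
Proof.
move=> u0 ut; have [tE|tn0] := eqVneq t 0; last by rewrite mulfK.
have -> : u = 0 by apply/eqP; rewrite eq_le u0 andbT -tE.
by rewrite !mul0r.
Qed.

Lemma disc_coupling_ge0 c' c : 0 <= disc_coupling c' c.
Proof. by rewrite /disc_coupling addr_ge0 ?mulr_ge0 ?invr_ge0. Qed.

Lemma disc_coupling_row c' : \sum_c disc_coupling c' c = p c'.
Proof.
rewrite /disc_coupling big_split/= (bigD1 c')//= eqxx mul1r big1 ?addr0; last first.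
  by move=> i /negPf ic; rewrite eq_sym ic mul0r.
rewrite -mulr_suml -mulr_sumr tb divt//; first by rewrite /a; ring.
by rewrite /t (bigD1 c')//= lerDl sumr_ge0.
Qed.

Lemma disc_coupling_col c : \sum_c' disc_coupling c' c = q c.
Proof.
rewrite /disc_coupling big_split/= (bigD1 c)//= eqxx mul1r big1 ?addr0; last first.
  by move=> i /negPf ->; rewrite mul0r.
rewrite -!mulr_suml -/t [t * b c]mulrC divt//.
  by rewrite /b; ring.
by rewrite -tb (bigD1 c)//= lerDl sumr_ge0.
Qed.

(** Only the excess moves, and a cost bounded by r c + r c' separates: its marginals a and b give
    the sum of r c (a c + b c), where a c + b c = |p c - q c|. *)
Lemma disc_coupling_cost (D : F -> F -> R) (r : F -> R) :
  (forall c, D c c = 0) -> (forall c c', D c c' <= r c + r c') ->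
  \sum_c' \sum_c disc_coupling c' c * D c' c <= \sum_c r c * `|p c - q c|.
Proof.
move=> D0 Dr.
have ab c : `|p c - q c| = a c + b c.
  rewrite /a /b /m; have [pqc|qpc] := leP (p c) (q c).
    by rewrite ler0_norm ?subr_le0//; ring.
  by rewrite gtr0_norm ?subr_gt0//; ring.
apply: (@le_trans _ _ (\sum_c' \sum_c (a c' * b c / t * r c' + a c' * b c / t * r c))).
  apply: ler_sum => c' _; apply: ler_sum => c _.
  rewrite /disc_coupling mulrDl; have [->|c'c] := eqVneq c' c.
    rewrite D0 !mulr0 addr0 -mulrDr mulr_ge0 ?mulr_ge0 ?invr_ge0//.
    by have := Dr c c; rewrite D0.
  by rewrite !mul0r add0r -mulrDr ler_wpM2l// ?mulr_ge0 ?invr_ge0.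
under eq_bigr do rewrite big_split/=.
rewrite big_split/= [X in _ + X]exchange_big/= -big_split/=.
apply: ler_sum => c _; rewrite ab mulrDr.
apply: lerD.
  rewrite -mulr_suml -mulr_suml -mulr_sumr tb divt//; first by rewrite mulrC.
  by rewrite /t (bigD1 c)//= lerDl sumr_ge0.
rewrite -!mulr_suml -/t [t * b c]mulrC divt//; first by rewrite mulrC.
by rewrite -tb (bigD1 c)//= lerDl sumr_ge0.
Qed.
End discrete_coupling.

Section cells.
Variables (R : realType) (d : nat) (F : finType).
Variables (cell : Rd R d -> F) (rep : F -> 'cV[R]_d).
Hypothesis mcell : forall c, measurable [set u | cell u = c].

Lemma measurable_cell_fun (h : F -> R) : measurable_fun setT (fun u => h (cell u)).
Proof.
rewrite (_ : (fun u => _) = fun u => \sum_c h c * \1_[set u | cell u = c] u).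
  by apply: measurable_sum => c; apply: measurable_funM => //; apply/measurable_indicP.
apply/funext => u; rewrite (bigD1 (cell u))//= indicE mem_set// mulr1 big1 ?addr0// => c cu.
by rewrite indicE memNset ?mulr0//= => /esym/eqP; exact/negP.
Qed.

Lemma integral_cell (P : probability (Rd R d) R) (h : F -> R) : (forall c, 0 <= h c) ->
  (\int[P]_u (h (cell u))%:E = (\sum_c h c * fine (P [set u | cell u = c]))%:E)%E.
Proof.
move=> h0.
rewrite (eq_integral (fun u => \sum_c (h c)%:E * (\1_[set u | cell u = c] u)%:E)%E); last first.
  move=> u _; rewrite (bigD1 (cell u))//= indicE mem_set// mule1 big1 ?adde0// => c cu.
  by rewrite indicE memNset ?mule0//= => /esym/eqP; exact/negP.
rewrite ge0_integral_sum//; last 2 first.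
- by move=> c; apply/measurable_EFinP; apply: measurable_funM.
- by move=> c u _; rewrite mule_ge0// lee_fin.
rewrite -sumEFin; apply: eq_bigr => c _.
rewrite ge0_integralZl//; last 2 first.
- by apply/measurable_EFinP; apply/measurable_indicP.
- by rewrite lee_fin.
by rewrite integral_indic// setIT EFinM fineK// fin_num_measure.
Qed.

Lemma cell_mass (P : probability (Rd R d) R) : \sum_c fine (P [set u | cell u = c]) = 1.
Proof.
have := integral_cell P (fun=> ler01).
under eq_bigr do rewrite mul1r.
rewrite integral_cst// mul1e => /esym.
by have := probability_setT P => /= -> [].
Qed.

Variables (N : nat) (y : 'I_N -> Rd R d).
Hypothesis N0 : (0 < N)%N.

Definition cell_freq (c : F) : R := N%:R^-1 * \sum_(i < N) (cell (y i) == c)%:R.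

Lemma cell_freq_ge0 c : 0 <= cell_freq c.
Proof. by rewrite mulr_ge0 ?invr_ge0// sumr_ge0. Qed.

Lemma cell_freq_sum (h : F -> R) :
  \sum_(i < N) h (cell (y i)) = \sum_c N%:R * cell_freq c * h c.
Proof.
have NN : N%:R != 0 :> R by rewrite pnatr_eq0 -lt0n.
under [RHS]eq_bigr do rewrite /cell_freq mulrA mulfV// mul1r mulr_suml.
rewrite exchange_big/=; apply: eq_bigr => i _.
rewrite (bigD1 (cell (y i)))//= eqxx mul1r big1 ?addr0// => c /negPf.
by rewrite eq_sym => ->; rewrite mul0r.
Qed.

Lemma cell_freq_total : \sum_c cell_freq c = 1.
Proof.
have := cell_freq_sum (fun=> 1); under [X in _ = X]eq_bigr do rewrite mulr1.
rewrite -mulr_sumr sumr_const card_ord -[1 *+ _]/(N%:R) => /eqP.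
rewrite -{1}(mulr1 N%:R) => /eqP /mulfI h; apply/esym/h.
by rewrite pnatr_eq0 -lt0n.
Qed.

(** For u in cell c, a cell c' is drawn with probability J c' c / q c, then an index uniformly among
    the N p c' sample points in c'. The path from y i to u passes through the representatives of the
    two cells, which gives the first three terms. *)
Lemma W1_cells (nu lam : meas R d) : is_prob nu ->
  (W1 (empirical y) lam <=
    (N%:R^-1 * \sum_(i < N) enorm ((y i : 'cV[R]_d) - rep (cell (y i))))%:E +
    \int[nu]_u (enorm ((u : 'cV[R]_d) - rep (cell u)))%:E +
    (\sum_c enorm (rep c) * `|cell_freq c - fine (nu [set u | cell u = c])|)%:E +
    W1 nu lam)%E.
Proof.
move=> pnu; have [P PE] := is_prob_probability pnu.
have qE c : fine (nu [set u | cell u = c]) = fine (P [set u | cell u = c]) by rewrite PE.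
under [X in (_ + X%:E + _)%E]eq_bigr do rewrite qE.
pose p := cell_freq; pose q c := fine (P [set u | cell u = c]).
have p0 : forall c, 0 <= p c := cell_freq_ge0.
have q0 c : 0 <= q c by rewrite fine_ge0.
have p1 : \sum_c p c = 1 := cell_freq_total.
have q1 : \sum_c q c = 1 := cell_mass P.
have pq : \sum_c p c = \sum_c q c by rewrite p1 q1.
pose J := disc_coupling p q.
have J0 : forall c' c, 0 <= J c' c := disc_coupling_ge0 p0 q0.
have Jr : forall c', \sum_c J c' c = p c' := disc_coupling_row pq.
have Jc : forall c, \sum_c' J c' c = q c := disc_coupling_col pq.
have Jp0 c' c : p c' = 0 -> J c' c = 0.
  move=> pc; apply/eqP; rewrite eq_le J0 andbT -pc -Jr (bigD1 c)//= lerDl.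
  exact: sumr_ge0.
have Jq0 c' c : q c = 0 -> J c' c = 0.
  move=> qc; apply/eqP; rewrite eq_le J0 andbT -qc -Jc (bigD1 c')//= lerDl.
  exact: sumr_ge0.
have NN : N%:R != 0 :> R by rewrite pnatr_eq0 -lt0n.
have NN0 : 0 <= N%:R^-1 :> R by rewrite invr_ge0.
have pn0 i : p (cell (y i)) != 0.
  rewrite gt_eqF// /p /cell_freq mulr_gt0 ?invr_gt0 ?ltr0n//.
  by rewrite (bigD1 i)//= eqxx ltr_pwDl ?sumr_ge0.
(* A cell with q c = 0 carries no mass of nu; the default N^-1 keeps the weights summing to 1
   there. *)
pose G i c : R := if q c == 0 then N%:R^-1 else J (cell (y i)) c / (N%:R * p (cell (y i)) * q c).
have G0 i c : 0 <= G i c by rewrite /G; case: ifP => // _; apply: divr_ge0 => //; apply: mulr_ge0 => //; apply: mulr_ge0.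
have G1 c : \sum_(i < N) G i c = 1.
  have [qc|qc] := eqVneq (q c) 0.
    rewrite (eq_bigr (fun=> N%:R^-1)) ?sum_inv_card// => i _.
    by rewrite /G qc eqxx.
  rewrite (eq_bigr (fun i => J (cell (y i)) c / (N%:R * p (cell (y i)) * q c))); last first.
    by move=> i _; rewrite /G (negbTE qc).
  rewrite (cell_freq_sum (fun c' => J c' c / (N%:R * p c' * q c))).
  rewrite (eq_bigr (fun c' => J c' c / q c)); last first.
    move=> c' _; have [pc|pc] := eqVneq (p c') 0; first by rewrite Jp0// !mul0r mulr0.
    rewrite -/(p c'); move: (p c') (J c' c) pc => x u x0; field.
    by rewrite qc x0 NN.
  by rewrite -mulr_suml Jc mulfV.
have Gq i c : G i c * q c = J (cell (y i)) c / (N%:R * p (cell (y i))).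
  rewrite /G; have [qc|qc] := eqVneq (q c) 0; first by rewrite qc mulr0 Jq0// mul0r.
  move: (J _ _) (p _) (pn0 i) => u x x0; field.
  by rewrite qc x0 NN.
have Gr i : \sum_c G i c * q c = N%:R^-1.
  under eq_bigr do rewrite Gq.
  by rewrite -mulr_suml Jr invfM mulrCA mulfV// mulr1.
have mrep : measurable_fun setT (fun u => rep (cell u) : Rd R d).
  by apply: measurable_Rd => i; exact: (measurable_cell_fun (fun c => rep c i ord0)).
have mGi i : measurable_fun setT (fun u => G i (cell u)) := measurable_cell_fun (G i).
apply: le_trans (@W1_glue R d N y nu lam (fun i u => G i (cell u)) pnu mGi _ _ _) _ => //.
  by move=> i; rewrite -(eq_set_integral _ _ PE) integral_cell//; congr (_%:E).
apply: leeD => //.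
rewrite -!(eq_set_integral _ _ PE).
pose D c' c := enorm (rep c' - rep c).
apply: (@le_trans _ _ (\int[P]_u ((\sum_(i < N) G i (cell u) * enorm ((y i : 'cV[R]_d) - rep (cell (y i))))%:E +
   (enorm ((u : 'cV[R]_d) - rep (cell u)))%:E + (\sum_(i < N) G i (cell u) * D (cell (y i)) (cell u))%:E))%E).
  apply: le_integral_nm => u.
    by rewrite lee_fin sumr_ge0// => i _; rewrite mulr_ge0// enorm_ge0.
  rewrite -!EFinD lee_fin addrAC -big_split/=.
  rewrite -[X in _ <= _ + X]mul1r -(G1 (cell u)) mulr_suml -big_split/=.
  apply: ler_sum => i _; rewrite -!mulrDr ler_wpM2l// /D.
  apply: le_trans (enorm_tri _ (rep (cell u)) _) _; rewrite [X in _ <= _ + X]enorm_sym lerD2r.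
  exact: enorm_tri.
have mE1 : measurable_fun setT (fun u => (\sum_(i < N) G i (cell u) * enorm ((y i : 'cV[R]_d) - rep (cell (y i))))%:E).
  by apply/measurable_EFinP; exact: (measurable_cell_fun (fun c => \sum_(i < N) G i c * _)).
have mE2 : measurable_fun setT (fun u : Rd R d => (enorm ((u : 'cV[R]_d) - rep (cell u)))%:E).
  exact: measurable_enormB.
have mE3 : measurable_fun setT (fun u => (\sum_(i < N) G i (cell u) * D (cell (y i)) (cell u))%:E).
  by apply/measurable_EFinP; exact: (measurable_cell_fun (fun c => \sum_(i < N) G i c * D (cell (y i)) c)).
have D0 c c' : 0 <= D c c' by exact: enorm_ge0.
have s1 c : 0 <= \sum_(i < N) G i c * enorm ((y i : 'cV[R]_d) - rep (cell (y i))).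
  by rewrite sumr_ge0// => i _; rewrite mulr_ge0// enorm_ge0.
have s3 c : 0 <= \sum_(i < N) G i c * D (cell (y i)) c.
  by rewrite sumr_ge0// => i _; rewrite mulr_ge0.
rewrite ge0_integralD//=; last 3 first.
- by move=> u _; rewrite adde_ge0// lee_fin// enorm_ge0.
- exact: emeasurable_funD.
- by move=> u _; rewrite lee_fin.
rewrite ge0_integralD//=; last 2 first.
- by move=> u _; rewrite lee_fin.
- by move=> u _; rewrite lee_fin enorm_ge0.
apply: leeD; first apply: leeD => //.
  rewrite (integral_cell P s1) lee_fin.
  rewrite (eq_bigr (fun c => \sum_(i < N) G i c * q c *
      enorm ((y i : 'cV[R]_d) - rep (cell (y i))))); last first.
    by move=> c _; rewrite mulr_suml; apply: eq_bigr => i _; rewrite mulrAC.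
  rewrite exchange_big/= mulr_sumr; apply: ler_sum => i _.
  by rewrite -mulr_suml Gr.
rewrite (integral_cell P s3) lee_fin.
rewrite (eq_bigr (fun c => \sum_(i < N) J (cell (y i)) c / (N%:R * p (cell (y i))) *
    D (cell (y i)) c)); last first.
  by move=> c _; rewrite mulr_suml; apply: eq_bigr => i _; rewrite mulrAC Gq.
rewrite exchange_big/=.
rewrite (cell_freq_sum (fun c' => \sum_c J c' c / (N%:R * p c') * D c' c)).
apply: (@le_trans _ _ (\sum_c' \sum_c J c' c * D c' c)).
  apply: ler_sum => c' _; rewrite mulr_sumr; apply: ler_sum => c _.
  have [pc|pc] := eqVneq (p c') 0; first by rewrite Jp0// !mul0r mulr0.
  rewrite -/(p c') le_eqVlt; apply/orP; left; apply/eqP.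
  move: (p c') (J c' c) pc => x u x0; field.
  by rewrite x0 NN.
apply: (disc_coupling_cost pq (r := fun c => enorm (rep c))).
  by move=> c; rewrite /D subrr enorm0.
by move=> c c'; rewrite /D -(enormN (rep c')); exact: enormD.
Qed.
End cells.

(** * Moments of cell deviations *)

Section independent_family.
Context dd (T : measurableType dd) (R : realType) (P : probability T R).
Variables (d N : nat) (zeta : 'I_N -> T -> Rd R d).
Hypothesis mzeta : forall i, measurable_fun setT (zeta i).
Hypothesis indep : forall B : 'I_N -> set (Rd R d), (forall i, measurable (B i)) ->
  P (\bigcap_(i in [set: 'I_N]) (zeta i @^-1` B i)) = (\prod_(i < N) P (zeta i @^-1` B i))%E.

(** A pi-system for the variables other than zeta i. Families over all indices, with B i = setT,
    have the very shape to which [indep] applies. *)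
Definition others (i : 'I_N) : set (set T) := [set S | exists B : 'I_N -> set (Rd R d),
  [/\ forall j, measurable (B j), B i = setT &
      S = \bigcap_(j in [set: 'I_N]) (zeta j @^-1` B j)]].

Definition single (i : 'I_N) : set (set T) := [set S | exists2 B : set (Rd R d),
  measurable B & S = zeta i @^-1` B].

Let mpre i B : measurable B -> measurable (zeta i @^-1` B).
Proof. by move=> mB; rewrite -[X in measurable X]setTI; exact: mzeta. Qed.

Lemma others_measurable i : others i `<=` measurable.
Proof.
move=> _ [B [mB _ ->]]; apply: fin_bigcap_measurable => // j _; exact: mpre.
Qed.

Lemma single_measurable i : single i `<=` measurable.
Proof. by move=> _ [B mB ->]; exact: mpre. Qed.

Lemma measurable_others (i j : 'I_N) : j != i ->
  measurable_fun setT (zeta j : g_sigma_algebraType (others i) -> Rd R d).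
Proof.
move=> ji _ B mB; rewrite setTI; apply: sub_sigma_algebra.
exists (fun k => if k == j then B else setT); split.
- by move=> k; case: ifP.
- by rewrite eq_sym (negbTE ji).
- apply/seteqP; split => [w Bw k _|w /(_ j I)]; last by rewrite eqxx.
  by case: eqP => // ->.
Qed.

Lemma measurable_single (i : 'I_N) :
  measurable_fun setT (zeta i : g_sigma_algebraType (single i) -> Rd R d).
Proof. by move=> _ B mB; rewrite setTI; apply: sub_sigma_algebra; exists B. Qed.

(** [decoupling_integral] for the pi-systems [others i] and [single i]: once w is frozen, the factor
    [a w] leaves the inner integral. *)
Lemma indep_mul (i : 'I_N) (a : g_sigma_algebraType (others i) -> R) (b : Rd R d -> R) :
  measurable_fun setT a -> measurable_fun setT b ->
  (forall w, 0 <= a w) -> (forall x, 0 <= b x) ->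
  (\int[P]_w (a w * b (zeta i w))%:E = (\int[P]_w (a w)%:E) * (\int[P]_w (b (zeta i w))%:E))%E.
Proof.
move=> ma mb a0 b0.
have mbz : measurable_fun setT (fun w : g_sigma_algebraType (single i) => b (zeta i w)).
  exact: (measurableT_comp mb (measurable_single (i:=i))).
have mbzT : measurable_fun setT (fun w : T => b (zeta i w)).
  exact: (measurableT_comp mb (mzeta i)).
have maT : measurable_fun setT (a : T -> R).
  exact: (measurableT_comp ma (measurable_id_sigma (others_measurable (i:=i)))).
have := @decoupling_integral _ T R P (others i) (single i)
  (others_measurable (i:=i)) (single_measurable (i:=i)) _ _ _ _ _
  (fun wv => (a wv.1 * b (zeta i wv.2))%:E).
move=> ->.
- rewrite (eq_integral (fun w : T => (a w)%:E * \int[P]_w (b (zeta i w))%:E)%E); last first.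
    move=> w _; rewrite -ge0_integralZl//.
    - exact/measurable_EFinP.
    - by move=> v _; rewrite lee_fin.
    - by rewrite lee_fin.
  rewrite ge0_integralZr//.
  - exact/measurable_EFinP.
  - by move=> w _; rewrite lee_fin.
  by apply: integral_ge0 => w _; rewrite lee_fin.
- move=> _ _ [B [mB Bi ->]] [C [mC Ci ->]].
  exists (fun j => B j `&` C j); split.
  + by move=> j; exact: measurableI.
  + by rewrite Bi Ci setTI.
  + apply/seteqP; split => [w [h1 h2] j _|w h].
      by split; [exact: h1|exact: h2].
    by split => j _; have [] := h j I.
- by move=> _ _ [B mB ->] [C mC ->]; exists (B `&` C) => //; exact: measurableI.
- exists (fun=> setT); split => //.
  by apply/seteqP; split => // w _ j _.
- by exists setT => //; rewrite preimage_setT.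
- move=> _ _ [B [mB Bi ->]] [C mC ->].
  pose B' j := if j == i then C else B j.
  have -> : \bigcap_(j in [set: 'I_N]) zeta j @^-1` B j `&` zeta i @^-1` C =
      \bigcap_(j in [set: 'I_N]) zeta j @^-1` B' j.
    apply/seteqP; split => [w [h1 h2] j _|w h].
      by rewrite /B'; case: eqP => [->//|_]; exact: h1.
    split => [j _|]; last by have := h i I; rewrite /B' eqxx.
    have := h j I; rewrite /B'; case: eqP => // ->.
    by rewrite Bi preimage_setT.
  rewrite !indep//; last by move=> j; rewrite /B'; case: ifP.
  rewrite (bigD1 i)//= [in RHS](bigD1 i)//= Bi preimage_setT probability_setT mul1e muleC.
  rewrite {2}/B' eqxx; congr (_ * _)%E.
  by apply: eq_bigr => j /negPf ji; rewrite /B' ji.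
- apply/measurable_EFinP; apply: measurable_funM.
    exact: (measurableT_comp ma measurable_fst).
  exact: (measurableT_comp mbz measurable_snd).
- by move=> wv; rewrite lee_fin mulr_ge0.
Qed.
End independent_family.

(** * Growth of an integer moment when one sample is added *)

Section discrete_step.
Variables (R : realType) (F : finType) (q : F -> R) (S : F -> R).
Hypotheses (q0 : forall c, 0 <= q c) (q1 : \sum_c q c = 1).

Let v c0 := \sum_c ((c0 == c)%:R - q c) ^+ 2.

Let v0 c0 : 0 <= v c0. Proof. by apply: sumr_ge0 => c _; exact: sqr_ge0. Qed.

Let qle1 c : q c <= 1.
Proof. by rewrite -q1 (bigD1 c)//= lerDl sumr_ge0. Qed.

Let v2 c0 : v c0 <= 2.
Proof.
apply: (@le_trans _ _ (\sum_c ((c0 == c)%:R + q c))); last first.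
  rewrite big_split/= q1 (bigD1 c0)//= eqxx big1 => [|c /negPf]; first by rewrite addr0.
  by rewrite eq_sym => ->.
apply: ler_sum => c _; have := q0 c; have := qle1 c.
by case: eqP => _ /=; nra.
Qed.

Let SY c0 := \sum_c S c * ((c0 == c)%:R - q c).

Let SYE c0 : SY c0 = S c0 - \sum_c S c * q c.
Proof.
rewrite /SY; under eq_bigr do rewrite mulrBr.
rewrite sumrB; congr (_ - _); rewrite (bigD1 c0)//= eqxx mulr1 big1 ?addr0// => c /negPf.
by rewrite eq_sym => ->; rewrite mulr0.
Qed.

(** The first-order coefficient k + 1 times the bound 2 on the squared length of one increment, plus
    the Taylor remainder. *)
Definition growth_const (k : nat) : R := 2 * k.+1%:R + taylor_const R k.

Lemma growth_const_ge0 k : 0 <= growth_const k.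
Proof. by rewrite /growth_const addr_ge0 ?mulr_ge0// taylor_const_ge0. Qed.

(** With Q = n + |S|^2 and Y the increment, the new value is Q + 2 <S, Y> + |Y|^2. The linear term
    has mean zero under q, |Y|^2 is at most 2 and Cauchy-Schwarz controls <S, Y>^2, so the moment
    grows by O(Q^k) only, which is O(Q^(k+1) / n) because Q >= n. *)
Lemma discrete_step (n : R) (k : nat) : 1 <= n ->
  \sum_c0 q c0 * (n + \sum_c (S c + ((c0 == c)%:R - q c)) ^+ 2) ^+ k.+1 <=
  (1 + growth_const k / n) * (n + \sum_c S c ^+ 2) ^+ k.+1.
Proof.
move=> n1; set S2 := \sum_c S c ^+ 2; pose Q := n + S2.
have S20 : 0 <= S2 by apply: sumr_ge0 => c _; exact: sqr_ge0.
have Q1 : 1 <= Q by rewrite /Q; lra.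
have tE c0 : n + \sum_c (S c + ((c0 == c)%:R - q c)) ^+ 2 = Q + (2 * SY c0 + v c0).
  rewrite /Q -!addrA; congr (_ + _); rewrite /S2 /SY /v mulr_sumr -!big_split/=.
  by apply: eq_bigr => c _; ring.
have cs c0 : SY c0 ^+ 2 <= 2 * S2.
  have h (x : F -> R) (y : F -> R) : (\sum_c x c * y c) ^+ 2 <= (\sum_c x c ^+ 2) * (\sum_c y c ^+ 2).
    have := cauchy_schwarz_sum x y; have := cauchy_schwarz_sum (fun c => - x c) y.
    under eq_bigr do rewrite mulNr.
    under [X in _ <= Num.sqrt X * _ -> _]eq_bigr do rewrite sqrrN.
    rewrite sumrN; set A := \sum_c x c ^+ 2; set B := \sum_c y c ^+ 2; set X := \sum_c _.
    have A0 : 0 <= A by apply: sumr_ge0 => c _; exact: sqr_ge0.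
    have B0 : 0 <= B by apply: sumr_ge0 => c _; exact: sqr_ge0.
    move=> h1 h2; rewrite -(sqr_sqrtr A0) -(sqr_sqrtr B0) -exprMn -real_normK ?num_real//.
    rewrite lerXn2r ?nnegrE ?mulr_ge0 ?sqrtr_ge0//.
    by rewrite ler_norml h2 andbT lerNl.
  apply: le_trans (h _ _) _; rewrite mulrC ler_wpM2r//; exact: v2.
apply: (@le_trans _ _ (\sum_c0 q c0 * (Q ^+ k.+1 + k.+1%:R * Q ^+ k * (2 * SY c0 + v c0) +
   taylor_const R k * Q ^+ k))).
  (* The perturbation t = 2 SY + v satisfies t^2 <= 8 SY^2 + 2 v^2 <= 16 S2 + 8, below the 64 Q that
     [exprD_taylor] allows. *)
  apply: ler_sum => c0 _; rewrite tE ler_wpM2l//; apply: exprD_taylor => //.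
    have := cs c0; have := v2 c0; have := v0 c0; rewrite /Q.
    move: (SY c0) (v c0) => s u u0 u2 su.
    have : (2 * s + u) ^+ 2 <= 8 * s ^+ 2 + 2 * u ^+ 2.
      have := sqr_ge0 (2 * s - u); rewrite !expr2; lra.
    have : u ^+ 2 <= 4 by rewrite expr2; nra.
    by lra.
  rewrite -tE addr_ge0 ?sumr_ge0//; first lra.
  by move=> c _; exact: sqr_ge0.
have Qk0 : 0 <= Q ^+ k by rewrite exprn_ge0//; lra.
rewrite (eq_bigr (fun c0 => (Q ^+ k.+1 + taylor_const R k * Q ^+ k) * q c0 +
   (k.+1%:R * Q ^+ k) * (2 * (q c0 * SY c0) + q c0 * v c0))); last first.
  by move=> c0 _; ring.
rewrite big_split/= -!mulr_sumr q1 mulr1 big_split/= -mulr_sumr.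
have -> : \sum_c q c * SY c = 0.
  under eq_bigr do rewrite SYE mulrBr.
  rewrite sumrB -mulr_suml q1 mul1r.
  by under eq_bigr do rewrite mulrC; rewrite subrr.
rewrite mulr0 add0r.
have qv : \sum_c q c * v c <= 2.
  apply: (@le_trans _ _ (\sum_c q c * 2)); first by apply: ler_sum => c _; rewrite ler_wpM2l.
  by rewrite -mulr_suml q1 mul1r.
rewrite mulrDl mul1r -addrA lerD2l.
apply: (@le_trans _ _ (growth_const k * Q ^+ k)).
  have h : k.+1%:R * Q ^+ k * \sum_c q c * v c <= k.+1%:R * Q ^+ k * 2.
    by rewrite ler_wpM2l// mulr_ge0.
  by rewrite /growth_const; lra.
rewrite -mulrA ler_wpM2l ?growth_const_ge0// exprS mulrA ler_peMl//.
by rewrite mulrC ler_pdivlMr ?mul1r; rewrite /Q; lra.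
Qed.
End discrete_step.

Section cell_deviation.
Context dd (T : measurableType dd) (R : realType) (P : probability T R).
Variables (d N : nat) (zeta : 'I_N -> T -> Rd R d).
Hypothesis mzeta : forall i, measurable_fun setT (zeta i).
Hypothesis indep : forall B : 'I_N -> set (Rd R d), (forall i, measurable (B i)) ->
  P (\bigcap_(i in [set: 'I_N]) (zeta i @^-1` B i)) = (\prod_(i < N) P (zeta i @^-1` B i))%E.
Variables (F : finType) (cell : Rd R d -> F).
Hypothesis mcell : forall c, measurable [set u | cell u = c].
Hypothesis N0 : (0 < N)%N.

Definition cell_prob (i : 'I_N) (c : F) : R := fine (P [set w | cell (zeta i w) = c]).

Let mzc i c : measurable [set w | cell (zeta i w) = c].
Proof. by rewrite -[X in measurable X]setTI; exact: mzeta (mcell c). Qed.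

Lemma cell_prob_ge0 i c : 0 <= cell_prob i c.
Proof. by rewrite fine_ge0. Qed.

Lemma cell_prob_sum i : \sum_c cell_prob i c = 1.
Proof.
have [Q [QE _]] := pushforward_probability P (mzeta i).
rewrite -[RHS](cell_mass mcell Q); apply: eq_bigr => c _.
by rewrite /cell_prob QE.
Qed.

Definition deviation (n : nat) (c : F) (w : T) : R :=
  \sum_(i < N | (i < n)%N) ((cell (zeta i w) == c)%:R - cell_prob i c).

(* Integer moments of [energy] grow by a factor [1 + O(1/N)] per sample, as the increments of
   [deviation] are centered and the [N] added to the square absorbs the second-order terms. *)
Definition energy (n : nat) (w : T) : R := N%:R + \sum_c deviation n c w ^+ 2.

Let NR1 : 1 <= N%:R :> R. Proof. by rewrite ler1n. Qed.

Lemma energy_ge n w : N%:R <= energy n w.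
Proof. by rewrite /energy lerDl sumr_ge0// => c _; exact: sqr_ge0. Qed.

Lemma measurable_deviation dd' (T' : measurableType dd') (z : 'I_N -> T' -> Rd R d) (n : nat) c :
  (forall i : 'I_N, (i < n)%N -> measurable_fun setT (z i)) ->
  measurable_fun setT (fun w => \sum_(i < N | (i < n)%N) ((cell (z i w) == c)%:R - cell_prob i c)).
Proof.
move=> mz; under eq_fun do rewrite big_mkcond.
apply: measurable_sum => i; case: (boolP (i < n)%N) => // /mz mzi.
apply: measurable_funB => //.
exact: (measurableT_comp (measurable_cell_fun mcell (fun c' => (c' == c)%:R)) mzi).
Qed.

Lemma measurable_energy_others (i : 'I_N) (t : F -> R) k :
  measurable_fun setT (fun w : g_sigma_algebraType (others zeta i) =>
    (N%:R + \sum_c (deviation i c w + t c) ^+ 2) ^+ k : R).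
Proof.
apply: measurable_funX; apply: measurable_funD => //.
apply: measurable_sum => c; apply: measurable_funX; apply: measurable_funD => //.
apply: measurable_deviation => j ji; apply: measurable_others.
by rewrite neq_ltn ji.
Qed.

Lemma measurable_energy n k : measurable_fun setT (fun w : T => energy n w ^+ k).
Proof.
apply: measurable_funX; apply: measurable_funD => //.
by apply: measurable_sum => c; apply: measurable_funX; exact: measurable_deviation.
Qed.

(** The integrand is split according to the cell c0 of sample i. The indicator of this cell is
    independent of the deviations of the earlier samples, so it may be replaced with its
    probability; [discrete_step] then applies pointwise. *)
Lemma integral_energy_step (i : 'I_N) (k : nat) :
  (\int[P]_w (energy i.+1 w ^+ k.+1)%:E <=
   (1 + growth_const R k / N%:R)%:E * \int[P]_w (energy i w ^+ k.+1)%:E)%E.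
Proof.
pose t c0 c : R := (c0 == c)%:R - cell_prob i c.
pose a c0 (w : T) : R := (N%:R + \sum_c (deviation i c w + t c0 c) ^+ 2) ^+ k.+1.
pose b c0 (x : Rd R d) : R := (cell x == c0)%:R.
have a0 c0 w : 0 <= a c0 w.
  by rewrite exprn_ge0// addr_ge0// sumr_ge0// => c _; exact: sqr_ge0.
have mb c0 : measurable_fun setT (b c0) := measurable_cell_fun mcell (fun c => (c == c0)%:R).
have ma c0 : measurable_fun setT (a c0 : g_sigma_algebraType (others zeta i) -> R).
  exact: measurable_energy_others.
have maT c0 : measurable_fun setT (a c0 : T -> R).
  exact: (measurableT_comp (ma c0) (measurable_id_sigma (others_measurable mzeta (i:=i)))).
have mbT c0 : measurable_fun setT (fun w => b c0 (zeta i w)).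
  exact: (measurableT_comp (mb c0) (mzeta i)).
have devS c w : deviation i.+1 c w = deviation i c w + t (cell (zeta i w)) c.
  rewrite /deviation (bigD1 i)//= addrC; congr (_ + _); apply: eq_bigl => j.
  by rewrite ltnS ltn_neqAle andbC.
have -> : (\int[P]_w (energy i.+1 w ^+ k.+1)%:E =
    \int[P]_w \sum_c0 (a c0 w * b c0 (zeta i w))%:E)%E.
  apply: eq_integral => w _; rewrite sumEFin; congr (_%:E).
  rewrite (bigD1 (cell (zeta i w)))//= /b eqxx mulr1 big1 ?addr0; last first.
    by move=> c /negPf; rewrite eq_sym => ->; rewrite mulr0.
  rewrite /energy /a; congr (_ ^+ _); congr (_ + _); apply: eq_bigr => c _.
  by rewrite devS.
rewrite ge0_integral_sum//; last 2 first.
- by move=> c; apply/measurable_EFinP; exact: measurable_funM.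
- by move=> c w _; rewrite lee_fin mulr_ge0// /b.
have bq c0 : (\int[P]_w (b c0 (zeta i w))%:E = (cell_prob i c0)%:E)%E.
  rewrite (eq_integral (fun w => (\1_[set w | cell (zeta i w) = c0] w)%:E)); last first.
    move=> w _; rewrite /b indicE; congr (nat_of_bool _)%:R%:E.
    by apply/eqP/idP; rewrite inE.
  by rewrite integral_indic// setIT /cell_prob fineK// fin_num_measure.
rewrite (eq_bigr (fun c0 => \int[P]_w (cell_prob i c0 * a c0 w)%:E)%E); last first.
  move=> c0 _; rewrite (indep_mul mzeta indep (ma c0) (mb c0) (a0 c0)); last by move=> x; rewrite /b.
  rewrite bq muleC -ge0_integralZl//.
  - exact/measurable_EFinP.
  - by move=> w _; rewrite lee_fin.
  - by rewrite lee_fin cell_prob_ge0.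
rewrite -ge0_integral_sum//; last 2 first.
- by move=> c; apply/measurable_EFinP; exact: measurable_funM.
- by move=> c w _; rewrite lee_fin mulr_ge0// cell_prob_ge0.
have e0 w : 0 <= energy i w ^+ k.+1.
  by rewrite exprn_ge0// (le_trans _ (energy_ge _ _)).
have g0 : 0 <= 1 + growth_const R k / N%:R.
  by rewrite addr_ge0// divr_ge0// growth_const_ge0.
rewrite -ge0_integralZl//; last 2 first.
- apply/measurable_EFinP; exact: measurable_energy.
- by move=> w _; rewrite lee_fin.
apply: le_integral_nm => w; rewrite sumEFin.
  by rewrite lee_fin sumr_ge0// => c _; rewrite mulr_ge0// cell_prob_ge0.
rewrite -EFinM lee_fin.
exact: (discrete_step (fun c => deviation i c w) (cell_prob_ge0 i) (cell_prob_sum i) k NR1).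
Qed.

Lemma integral_energy (k : nat) :
  (\int[P]_w (energy N w ^+ k.+1)%:E <= (expR (growth_const R k) * N%:R ^+ k.+1)%:E)%E.
Proof.
have g0 : 0 <= 1 + growth_const R k / N%:R.
  by rewrite addr_ge0// divr_ge0// growth_const_ge0.
have H n : (n <= N)%N -> (\int[P]_w (energy n w ^+ k.+1)%:E <=
    ((1 + growth_const R k / N%:R) ^+ n * N%:R ^+ k.+1)%:E)%E.
  elim: n => [_|n IH nN].
    rewrite expr0 mul1r (eq_integral (fun=> (N%:R ^+ k.+1)%:E)); last first.
      move=> w _; rewrite /energy big1 ?addr0// => c _.
      by rewrite /deviation big_pred0 ?expr0n.
    by rewrite integral_cst_probability.
  apply: le_trans (integral_energy_step (Ordinal nN) k) _.
  rewrite exprS -mulrA EFinM lee_wpmul2l ?lee_fin//.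
  exact: IH (ltnW nN).
apply: le_trans (H N (leqnn N)) _.
rewrite lee_fin ler_wpM2r ?exprn_ge0//.
exact: expr_one_plus_le (growth_const_ge0 R k).
Qed.

(** With V the sum of squared deviations, Cauchy-Schwarz over the cells bounds the l1 norm by
    sqrt(#|F| V). Then (V / N)^(p/2) is dominated by 1 + (1 + V / N)^(k+1), an integer moment of
    [energy], at the price of a constant depending on k only. *)
Lemma integral_deviation (p : R) (k : nat) : 0 <= p -> p / 2 <= k.+1%:R ->
  (\int[P]_w ((\sum_c `|deviation N c w|) `^ p)%:E <=
   ((#|F|%:R * N%:R) `^ (p / 2) * (1 + expR (growth_const R k)))%:E)%E.
Proof.
move=> p0 pk.
pose V w : R := \sum_c deviation N c w ^+ 2.
have V0 w : 0 <= V w by apply: sumr_ge0 => c _; exact: sqr_ge0.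
have pw w : (\sum_c `|deviation N c w|) `^ p <= (#|F|%:R * N%:R) `^ (p / 2) *
    (1 + N%:R ^- k.+1 * energy N w ^+ k.+1).
  have s0 : 0 <= \sum_c `|deviation N c w| by apply: sumr_ge0.
  have sV : (\sum_c `|deviation N c w|) ^+ 2 <= #|F|%:R * V w.
    have := cauchy_schwarz_sum (fun=> 1) (fun c => `|deviation N c w|).
    under eq_bigr do rewrite mul1r.
    under [X in _ <= Num.sqrt X * _ -> _]eq_bigr do rewrite expr1n.
    under [X in _ <= _ * Num.sqrt X -> _]eq_bigr do rewrite real_normK ?num_real//.
    rewrite sumr_const -[X in Num.sqrt X * _]/(#|F|%:R) -/(V w) => h.
    have <- : (Num.sqrt #|F|%:R * Num.sqrt (V w)) ^+ 2 = #|F|%:R * V w.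
      by rewrite exprMn !sqr_sqrtr.
    by rewrite lerXn2r ?nnegrE ?mulr_ge0 ?sqrtr_ge0.
  have -> : (\sum_c `|deviation N c w|) `^ p = ((\sum_c `|deviation N c w|) ^+ 2) `^ (p / 2).
    by rewrite -powR_mulrn// -powRrM; congr (_ `^ _); field.
  apply: (@le_trans _ _ ((#|F|%:R * N%:R) `^ (p / 2) * (V w / N%:R) `^ (p / 2))).
    rewrite -powRM ?mulr_ge0 ?divr_ge0//; apply: powR_le; rewrite ?divr_ge0 ?sqr_ge0//.
    by rewrite -mulrA [N%:R * _]mulrC divfK// pnatr_eq0 -lt0n.
  rewrite ler_wpM2l ?powR_ge0//.
  have VN0 : 0 <= V w / N%:R by rewrite divr_ge0.
  have E : N%:R ^- k.+1 * energy N w ^+ k.+1 = (1 + V w / N%:R) ^+ k.+1.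
    rewrite -exprVn -exprMn /energy mulrDr mulVf ?pnatr_eq0 -?lt0n//.
    by rewrite [_ * \sum_c _]mulrC.
  rewrite E; have [le1|gt1] := leP (V w / N%:R) 1.
    apply: (@le_trans _ _ 1); last by rewrite lerDl exprn_ge0// addr_ge0.
    by have := @powR_le R _ _ (p / 2) _ VN0 le1; rewrite powR1; apply; rewrite divr_ge0.
  apply: (@le_trans _ _ ((V w / N%:R) `^ k.+1%:R)); first by rewrite ler_powR// ltW.
  rewrite powR_mulrn//; apply: (@le_trans _ _ ((1 + V w / N%:R) ^+ k.+1)); last by rewrite lerDr.
  by rewrite lerXn2r ?nnegrE ?addr_ge0// lerDr.
apply: (@le_trans _ _ (\int[P]_w ((#|F|%:R * N%:R) `^ (p / 2) *
    (1 + N%:R ^- k.+1 * energy N w ^+ k.+1))%:E)%E).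
  by apply: le_integral_nm => w; rewrite lee_fin ?powR_ge0.
have me := measurable_energy N k.+1.
have e0 w : 0 <= energy N w ^+ k.+1.
  by rewrite exprn_ge0// (le_trans _ (energy_ge _ _)).
have n0 : 0 <= N%:R ^- k.+1 :> R by rewrite invr_ge0 exprn_ge0.
under eq_integral do rewrite EFinM EFinD EFinM.
rewrite ge0_integralZl//; last 2 first.
- by apply: emeasurable_funD => //; apply/measurable_EFinP; exact: measurable_funM.
- by move=> w _; rewrite adde_ge0// mule_ge0// lee_fin.
rewrite ge0_integralD//; last 2 first.
- by move=> w _; rewrite mule_ge0// lee_fin.
- by apply/measurable_EFinP; exact: measurable_funM.
rewrite integral_cst_probability ge0_integralZl//; last 2 first.
- exact/measurable_EFinP.
- by move=> w _; rewrite lee_fin.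
rewrite EFinM lee_wpmul2l ?lee_fin ?powR_ge0// EFinD leeD2l//.
apply: (@le_trans _ _ ((N%:R ^- k.+1)%:E * (expR (growth_const R k) * N%:R ^+ k.+1)%:E)%E).
  by rewrite lee_wpmul2l ?lee_fin//; exact: integral_energy.
rewrite -EFinM lee_fin mulrCA mulVf ?mulr1// expf_neq0// pnatr_eq0 -lt0n//.
Qed.
End cell_deviation.

(** * A Rosenthal inequality for nonnegative variables *)

Section rosenthal.
Context dd (T : measurableType dd) (R : realType) (P : probability T R).
Variables (d N : nat) (zeta : 'I_N -> T -> Rd R d).
Hypothesis mzeta : forall i, measurable_fun setT (zeta i).
Hypothesis indep : forall B : 'I_N -> set (Rd R d), (forall i, measurable (B i)) ->
  P (\bigcap_(i in [set: 'I_N]) (zeta i @^-1` B i)) = (\prod_(i < N) P (zeta i @^-1` B i))%E.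
Hypothesis N0 : (0 < N)%N.
Variables (b : Rd R d -> R) (p : R).
Hypotheses (mb : measurable_fun setT b) (b0 : forall x, 0 <= b x) (p1 : 1 <= p).

Let X i w := b (zeta i w).
Let Z w := \sum_(i < N) X i w.

(** With K = 2^p: the absorption turns the factor K / 2 into K, and Young's inequality with weight K
    contributes K^(p-1). *)
Definition rosenthal_const : R := 2 `^ p * (2 `^ p) `^ (p - 1).

Let mX i : measurable_fun setT (X i).
Proof. exact: (measurableT_comp mb (mzeta i)). Qed.

Let mXp i r : measurable_fun setT (fun w => (X i w `^ r)%:E).
Proof.
apply/measurable_EFinP.
by apply: (@measurableT_comp _ _ _ _ _ _ (fun a : R => a `^ r) _ (X i)).
Qed.

Let mZ : measurable_fun setT Z. Proof. exact: measurable_sum. Qed.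

Let mZp r : measurable_fun setT (fun w => (Z w `^ r)%:E).
Proof.
apply/measurable_EFinP.
by apply: (@measurableT_comp _ _ _ _ _ _ (fun a : R => a `^ r) _ Z).
Qed.

Let X0 i w : 0 <= X i w. Proof. exact: b0. Qed.
Let Z0 w : 0 <= Z w. Proof. by apply: sumr_ge0. Qed.

(** Let I be the p-th moment of Z and Zo i the sum without X i. Independence factors the mean of Zo
    i^(p-1) X i, whence I <= K/2 (M + m E Z^(p-1)). Young's inequality bounds m E Z^(p-1) by a
    constant plus I / K, and the resulting I / 2 is absorbed. *)
Lemma rosenthal (M : R) (m : R) :
  (\sum_(i < N) \int[P]_w (X i w `^ p)%:E <= M%:E)%E ->
  (\sum_(i < N) \int[P]_w (X i w)%:E <= m%:E)%E ->
  (\int[P]_w (Z w `^ p)%:E <= (rosenthal_const * (M + m `^ p))%:E)%E.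
Proof.
move=> hM hm.
have p0 : 0 < p := lt_le_trans ltr01 p1.
have p10 : 0 <= p - 1 by rewrite subr_ge0.
have m0 : 0 <= m.
  rewrite -lee_fin; apply: le_trans hm; apply: sume_ge0 => i _.
  by apply: integral_ge0 => w _; rewrite lee_fin.
have M0 : 0 <= M.
  rewrite -lee_fin; apply: le_trans hM; apply: sume_ge0 => i _.
  by apply: integral_ge0 => w _; rewrite lee_fin powR_ge0.
pose I := (\int[P]_w (Z w `^ p)%:E)%E.
have I0 : (0 <= I)%E by apply: integral_ge0 => w _; rewrite lee_fin powR_ge0.
(* Absorption requires I to be finite; for this the convexity bound, with a constant growing with N,
   is enough. *)
have fI : I \is a fin_num.
  rewrite ge0_fin_numE//.
  apply: (@le_lt_trans _ _ (\int[P]_w (\sum_(i < N) (N%:R `^ p * N%:R^-1)%:E * (X i w `^ p)%:E))%E).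
    apply: le_integral_nm => w; first by rewrite lee_fin powR_ge0.
    rewrite -ge0_sume_distrr; last by move=> i _; rewrite lee_fin powR_ge0.
    rewrite sumEFin -EFinM lee_fin -mulrA.
    have -> : Z w `^ p = N%:R `^ p * (N%:R^-1 * Z w) `^ p.
      rewrite -powRM ?mulr_ge0 ?invr_ge0//; congr (_ `^ _).
      by rewrite mulrA mulfV ?mul1r// pnatr_eq0 -lt0n.
    by rewrite ler_wpM2l ?powR_ge0//; exact: powR_mean.
  rewrite ge0_integral_sum//; last 2 first.
  - by move=> i; exact: emeasurable_funM.
  - by move=> i w _; rewrite mule_ge0// lee_fin ?powR_ge0// mulr_ge0 ?powR_ge0// invr_ge0.
  rewrite (eq_bigr (fun i => (N%:R `^ p * N%:R^-1)%:E * \int[P]_w (X i w `^ p)%:E)%E); last first.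
    by move=> i _; rewrite ge0_integralZl//; move=> w _; rewrite lee_fin powR_ge0.
  rewrite -ge0_sume_distrr; last first.
    by move=> i _; apply: integral_ge0 => w _; rewrite lee_fin powR_ge0.
  apply: (@le_lt_trans _ _ ((N%:R `^ p * N%:R^-1)%:E * M%:E)%E); last by rewrite -EFinM ltry.
  by rewrite lee_wpmul2l// lee_fin mulr_ge0 ?powR_ge0// invr_ge0.
pose Zo i w := \sum_(j < N | j != i) X j w.
have Zo0 i w : 0 <= Zo i w by apply: sumr_ge0.
have mZo i r : measurable_fun setT
    (fun w : g_sigma_algebraType (others zeta i) => Zo i w `^ r).
  apply: (measurableT_comp (f := fun a : R => a `^ r)
    (g := Zo i : g_sigma_algebraType (others zeta i) -> R)) => //.
  rewrite /Zo; under eq_fun do rewrite big_mkcond.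
  apply: measurable_sum => j; case: (boolP (j != i)) => // ji.
  apply: (measurableT_comp (f := b) (g := zeta j : g_sigma_algebraType (others zeta i) -> Rd R d)) => //.
  exact: measurable_others ji.
have mZoT i r : measurable_fun setT (fun w : T => (Zo i w `^ r)%:E).
  apply/measurable_EFinP.
  exact: (measurableT_comp (mZo i r) (measurable_id_sigma (others_measurable mzeta (i:=i)))).
set K := 2 `^ p.
have K0 : 0 < K by apply: powR_gt0.
have KE : 2 `^ (p - 1) = K / 2.
  by rewrite powRB ?powRr1// pnatr_eq0 implybT.
(* Z^p = sum_i X_i Z^(p-1), and Z^(p-1) is dominated by X_i^(p-1) plus a term independent of X_i *)
have pw w : Z w `^ p <= K / 2 * \sum_(i < N) (X i w `^ p + Zo i w `^ (p - 1) * X i w).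
  rewrite -(mulr_powRB1 (Z0 w) p0) {1}/Z mulr_suml mulr_sumr; apply: ler_sum => i _.
  rewrite -(mulr_powRB1 (X0 i w) p0) [Zo i w `^ _ * _]mulrC -mulrDr mulrCA ler_wpM2l//.
  rewrite -KE; have -> : Z w = X i w + Zo i w by rewrite /Z (bigD1 i).
  exact: powR_sum2.
have IZo i : (\int[P]_w (Zo i w `^ (p - 1) * X i w)%:E <=
    \int[P]_w (X i w)%:E * \int[P]_w (Z w `^ (p - 1))%:E)%E.
  rewrite (indep_mul mzeta indep (mZo i (p - 1)) mb)//; last by move=> w; rewrite powR_ge0.
  rewrite muleC; apply: lee_wpmul2l; first by apply: integral_ge0 => w _; rewrite lee_fin.
  apply: le_integral_nm => w; first by rewrite lee_fin powR_ge0.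
  by rewrite lee_fin; apply: powR_le => //; rewrite /Z (bigD1 i)//= lerDr.
have step1 : (I <= (K / 2)%:E * (M%:E + m%:E * \int[P]_w (Z w `^ (p - 1))%:E))%E.
  apply: (@le_trans _ _ (\int[P]_w ((K / 2)%:E * \sum_(i < N) ((X i w `^ p)%:E + (Zo i w `^ (p - 1) * X i w)%:E)))%E).
    apply: le_integral_nm => w; first by rewrite lee_fin powR_ge0.
    by under eq_bigr do rewrite -EFinD; rewrite sumEFin -EFinM lee_fin.
  have mt i : measurable_fun setT (fun w => (Zo i w `^ (p - 1) * X i w)%:E).
    apply/measurable_EFinP; apply: measurable_funM; last exact: mX.
    by apply/measurable_EFinP; exact: mZoT.
  have t0 i w : (0 <= (X i w `^ p)%:E + (Zo i w `^ (p - 1) * X i w)%:E)%E.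
    by rewrite -EFinD lee_fin addr_ge0 ?powR_ge0// mulr_ge0// powR_ge0.
  rewrite ge0_integralZl//; last 3 first.
  - by apply: emeasurable_sum => i; exact: emeasurable_funD.
  - by move=> w _; apply: sume_ge0.
  - by rewrite lee_fin divr_ge0// ltW.
  rewrite lee_wpmul2l ?lee_fin ?divr_ge0 ?(ltW K0)//.
  rewrite ge0_integral_sum//; last by move=> i; exact: emeasurable_funD.
  rewrite (eq_bigr (fun i => \int[P]_w (X i w `^ p)%:E + \int[P]_w (Zo i w `^ (p - 1) * X i w)%:E)%E); last first.
    move=> i _; rewrite ge0_integralD//.
    - by move=> w _; rewrite lee_fin powR_ge0.
    - by move=> w _; rewrite lee_fin mulr_ge0// powR_ge0.
  rewrite big_split/=; apply: leeD => //.
  apply: (@le_trans _ _ (\sum_(i < N) \int[P]_w (X i w)%:E * \int[P]_w (Z w `^ (p - 1))%:E)%E).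
    by apply: lee_sum => i _; exact: IZo.
  rewrite -ge0_sume_distrl; last by move=> i _; apply: integral_ge0 => w _; rewrite lee_fin.
  apply: lee_wpmul2r; last by [].
  by apply: integral_ge0 => w _; rewrite lee_fin powR_ge0.
have step2 : (m%:E * \int[P]_w (Z w `^ (p - 1))%:E <= (K `^ (p - 1) * m `^ p)%:E + K^-1%:E * I)%E.
  rewrite -ge0_integralZl//; last by move=> w _; rewrite lee_fin powR_ge0.
  apply: (@le_trans _ _ (\int[P]_w ((K `^ (p - 1) * m `^ p)%:E + K^-1%:E * (Z w `^ p)%:E))%E).
    apply: le_integral_nm => w; first by rewrite -EFinM lee_fin mulr_ge0// powR_ge0.
    by rewrite -!EFinM -EFinD lee_fin mul_powR_young.
  rewrite ge0_integralD//; last 3 first.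
  - by move=> w _; rewrite lee_fin mulr_ge0// powR_ge0.
  - by move=> w _; rewrite -EFinM lee_fin mulr_ge0 ?powR_ge0// invr_ge0 ltW.
  - exact: emeasurable_funM.
  rewrite integral_cst_probability ge0_integralZl//.
    by move=> w _; rewrite lee_fin powR_ge0.
  by rewrite lee_fin invr_ge0 ltW.
have IE : I = (fine I)%:E by rewrite fineK.
have : (fine I <= K / 2 * (M + (K `^ (p - 1) * m `^ p + K^-1 * fine I)))%R.
  rewrite -lee_fin -IE; apply: le_trans step1 _.
  rewrite [X in (_ <= X)%E]EFinM lee_wpmul2l ?lee_fin ?divr_ge0 ?(ltW K0)//.
  rewrite [X in (_ <= X)%E]EFinD leeD2l//.
  by rewrite [X in (_ <= X)%E]EFinD [(K^-1 * _)%:E]EFinM -IE.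
have -> : K / 2 * (M + (K `^ (p - 1) * m `^ p + K^-1 * fine I)) =
   K / 2 * M + K / 2 * (K `^ (p - 1) * m `^ p) + fine I / 2.
  by field; exact: lt0r_neq0.
move=> h; rewrite -/I IE lee_fin.
have L1 : 1 <= K `^ (p - 1).
  by apply: powR_ge1 => //; apply: powR_ge1; rewrite ?ler1n// ltW.
apply: (@le_trans _ _ (K * M + K * (K `^ (p - 1) * m `^ p))).
  apply: le_trans (le_half_absorb h) _.
  by rewrite le_eqVlt; apply/orP; left; apply/eqP; field.
rewrite /rosenthal_const -/K mulrDr mulrA lerD2r -mulrA ler_wpM2l ?(ltW K0)//.
by rewrite ler_peMl.
Qed.
End rosenthal.

(** * Sampling error on a grid *)

Lemma integral_affine2 dd (T : measurableType dd) (R : realType) (P : probability T R)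
    (b c1 c2 : R) (F G : T -> \bar R) : 0 <= b -> 0 <= c1 -> 0 <= c2 ->
  measurable_fun setT F -> measurable_fun setT G ->
  (forall w, 0 <= F w)%E -> (forall w, 0 <= G w)%E ->
  (\int[P]_w (b%:E + c1%:E * F w + c2%:E * G w) =
   b%:E + c1%:E * \int[P]_w F w + c2%:E * \int[P]_w G w)%E.
Proof.
move=> b0 c10 c20 mF mG F0 G0.
rewrite ge0_integralD//; last 4 first.
- by move=> w _; rewrite adde_ge0// mule_ge0.
- by apply: emeasurable_funD => //; exact: emeasurable_funM.
- by move=> w _; rewrite mule_ge0.
- exact: emeasurable_funM.
rewrite ge0_integralD//; last 2 first.
- by move=> w _; rewrite mule_ge0.
- exact: emeasurable_funM.
by rewrite integral_cst_probability !ge0_integralZl.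
Qed.

Section grid.
Variables (R : realType) (d M : nat).

(* Cubes of side [s] filling [[-M s, M s)]^d; [None] is the outside, represented by the origin. *)
Definition grid := option {ffun 'I_d -> 'I_(2 * M)}.

Definition grid_rep (s : R) (c : grid) : 'cV[R]_d :=
  if c is Some g then \col_j (((g j : nat)%:R - M%:R) * s) else 0.

Definition in_box (s : R) (u : 'cV[R]_d) (g : {ffun 'I_d -> 'I_(2 * M)}) : bool :=
  [forall j, (((g j : nat)%:R - M%:R) * s <= u j ord0) &&
             (u j ord0 < ((g j : nat)%:R - M%:R + 1) * s)].

Definition grid_cell (s : R) (u : Rd R d) : grid := [pick g | in_box s u g].

Definition tail (r : R) (u : Rd R d) : R := if r <= enorm (u : 'cV[R]_d) then enorm (u : 'cV[R]_d) else 0.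

Lemma tail_ge0 r u : 0 <= tail r u.
Proof. by rewrite /tail; case: ifP => // _; exact: enorm_ge0. Qed.

Lemma tail_le r u : tail r u <= enorm (u : 'cV[R]_d).
Proof. by rewrite /tail; case: ifP => // _; exact: enorm_ge0. Qed.

Lemma coord_le_enorm (u : 'cV[R]_d) j : `|u j ord0| <= enorm u.
Proof.
rewrite -(@ler_pXn2r _ 2)// ?nnegrE ?enorm_ge0//.
rewrite enorm_sqr real_normK ?num_real// (bigD1 j)//= lerDl sumr_ge0// => i _.
exact: sqr_ge0.
Qed.

Lemma in_box_uniq s u g g' : 0 < s -> in_box s u g -> in_box s u g' -> g = g'.
Proof.
move=> s0 /forallP h /forallP h'; apply/ffunP => j; apply/val_inj => /=.
have /andP[h1 h2] := h j; have /andP[h3 h4] := h' j.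
have := le_lt_trans h1 h4; have := le_lt_trans h3 h2.
rewrite !(ltr_pM2r s0) => h5 h6.
have a1 : (g j : nat)%:R < (g' j : nat)%:R + 1 :> R by lra.
have a2 : (g' j : nat)%:R < (g j : nat)%:R + 1 :> R by lra.
move: a1 a2; rewrite !natr1 !ltr_nat !ltnS => a1 a2.
by apply/eqP; rewrite eqn_leq a1 a2.
Qed.

Lemma grid_cell_Some s u g : 0 < s -> (grid_cell s u = Some g) <-> in_box s u g.
Proof.
move=> s0; rewrite /grid_cell; case: pickP => [g' g'b|h].
  by split => [[<-]//|gb]; rewrite (in_box_uniq s0 gb g'b).
by split => //; rewrite h.
Qed.

Lemma grid_cell_None s u : (grid_cell s u = None) <-> (forall g, ~~ in_box s u g).
Proof.
rewrite /grid_cell; case: pickP => [g' g'b|h]; last by split => // _ g; rewrite h.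
by split => // /(_ g'); rewrite g'b.
Qed.

Lemma grid_cell_None_far s u : 0 < s -> grid_cell s u = None ->
  M%:R * s <= enorm (u : 'cV[R]_d).
Proof.
move=> s0 /grid_cell_None h; rewrite leNgt; apply/negP => us.
have us' j : - M%:R < (u : 'cV[R]_d) j ord0 / s < M%:R.
  rewrite ltr_pdivlMr// ltr_pdivrMr// mulNr -ltr_norml.
  exact: le_lt_trans (coord_le_enorm _ _) us.
pose k j := Num.truncn ((u : 'cV[R]_d) j ord0 / s + M%:R).
have kP j : (k j)%:R <= (u : 'cV[R]_d) j ord0 / s + M%:R < (k j).+1%:R.
  apply: truncn_itv; have /andP[] := us' j; lra.
have k2 j : (k j < 2 * M)%N.
  rewrite -(ltr_nat R) natrM; have /andP[_] := us' j; have /andP[] := kP j; lra.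
have /negP := h [ffun j => Ordinal (k2 j)]; apply; apply/forallP => j; rewrite !ffunE/=.
have /andP[k1 k3] := kP j; rewrite -ler_pdivlMr// -ltr_pdivrMr//.
by move: k3; rewrite -natr1 => k3; apply/andP; split; lra.
Qed.

Lemma enorm_sub_grid_rep s u : 0 < s ->
  enorm ((u : 'cV[R]_d) - grid_rep s (grid_cell s u)) <= d%:R * s + tail (M%:R * s) u.
Proof.
move=> s0; case E : (grid_cell s u) => [g|] /=.
  have /forallP gb := (grid_cell_Some u g s0).1 E.
  apply: (@le_trans _ _ (d%:R * s)); last by rewrite lerDl tail_ge0.
  apply: le_trans (enorm_le_sum _) _.
  apply: (@le_trans _ _ (\sum_(j < d) s)); last by rewrite sumr_const card_ord mulr_natl.
  apply: ler_sum => j _; rewrite !mxE.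
  have /andP[h1 h2] := gb j; rewrite ger0_norm ?subr_ge0//.
  by rewrite lerBlDl; apply: ltW; apply: lt_le_trans h2 _; rewrite mulrDl mul1r.
rewrite subr0 /tail (grid_cell_None_far s0 E) lerDr mulr_ge0// ltW//.
Qed.

Lemma enorm_grid_rep s c : 0 < s -> enorm (grid_rep s c) <= d%:R * M%:R * s.
Proof.
move=> s0; case: c => [g|] /=; last by rewrite enorm0 !mulr_ge0// ltW.
apply: le_trans (enorm_le_sum _) _.
apply: (@le_trans _ _ (\sum_(j < d) (M%:R * s))); last first.
  by rewrite sumr_const card_ord -[X in X <= _]mulr_natl mulrA.
apply: ler_sum => j _; rewrite !mxE normrM (gtr0_norm s0) ler_wpM2r ?(ltW s0)//.
have g0 : 0 <= (g j : nat)%:R :> R by [].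
have g2 : (g j : nat)%:R <= 2 * M%:R :> R by rewrite -natrM ler_nat ltnW// ltn_ord.
by rewrite ler_norml; apply/andP; split; lra.
Qed.

Lemma card_grid : #|{: grid}|%:R = (2 * M%:R) ^+ d + 1 :> R.
Proof. by rewrite card_option card_ffun !card_ord -natr1 natrX natrM. Qed.

Section grid_measurability.
Context dd (T : measurableType dd).

Lemma measurable_in_box (s : T -> R) (u : T -> Rd R d) g :
  measurable_fun setT s -> measurable_fun setT u ->
  measurable [set w | in_box (s w) (u w) g].
Proof.
move=> ms mu.
have -> : [set w | in_box (s w) (u w) g] = \bigcap_(j : 'I_d)
    ([set w | (((g j : nat)%:R - M%:R) * s w <= (u w : 'cV[R]_d) j ord0)] `&`
     [set w | ((u w : 'cV[R]_d) j ord0 < ((g j : nat)%:R - M%:R + 1) * s w)]).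
  apply/seteqP; split => [w /forallP h j _|w h]; first by have /andP[] := h j.
  by apply/forallP => j; have [] := h j I => /= -> ->.
apply: fin_bigcap_measurable => // j _; apply: measurableI.
  rewrite -[X in measurable X]setTI.
  apply: (measurable_fun_ler _ _ measurableT (Y := [set true])) => //.
    exact: measurable_funM.
  exact: measurable_Rd_coord.
rewrite -[X in measurable X]setTI.
apply: (measurable_fun_ltr _ _ measurableT (Y := [set true])) => //.
  exact: measurable_Rd_coord.
exact: measurable_funM.
Qed.

Lemma measurable_grid_cell (s : T -> R) (u : T -> Rd R d) c : (forall w, 0 < s w) ->
  measurable_fun setT s -> measurable_fun setT u ->
  measurable [set w | grid_cell (s w) (u w) = c].
Proof.
move=> s0 ms mu; case: c => [g|].
  rewrite (_ : [set _ | _] = [set w | in_box (s w) (u w) g]); first exact: measurable_in_box.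
  by apply/seteqP; split => w /=; rewrite grid_cell_Some.
rewrite (_ : [set _ | _] = \bigcap_(g : {ffun 'I_d -> 'I_(2 * M)}) ~` [set w | in_box (s w) (u w) g]).
  by apply: fin_bigcap_measurable => // g _; apply: measurableC; exact: measurable_in_box.
apply/seteqP; split => w /=.
  by move=> /grid_cell_None h g _ /=; exact/negP.
by move=> h; apply/grid_cell_None => g; apply/negP; exact: h.
Qed.

Lemma measurable_tail (r : T -> R) (u : T -> Rd R d) :
  measurable_fun setT r -> measurable_fun setT u ->
  measurable_fun setT (fun w => tail (r w) (u w)).
Proof.
move=> mr mu; rewrite /tail; apply: measurable_fun_ifT => //.
- by apply: measurable_fun_ler => //; exact: measurable_enorm.
- exact: measurable_enorm.
Qed.
End grid_measurability.

(** Sample and target are both rounded to the grid, hence 2 d s. The other terms are the empirical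
    tail, the mean tail and the mismatch of cell masses, weighted by d M s, which bounds the norm of
    every [grid_rep]. *)
Definition cell_error (N : nat) (s : R) (x : 'I_N -> Rd R d) (tm : R) (q : grid -> R) : R :=
  2 * d%:R * s + N%:R^-1 * \sum_(i < N) tail (M%:R * s) (x i) + tm +
  d%:R * M%:R * s * \sum_c `|cell_freq (grid_cell s) x c - q c|.

Lemma W1_grid (N : nat) (s : R) (x : 'I_N -> Rd R d) (nu lam : meas R d) (tm : R) :
  (0 < N)%N -> 0 < s -> is_prob nu ->
  (\int[nu]_u (tail (M%:R * s) u)%:E <= tm%:E)%E ->
  (W1 (empirical x) lam <=
   (cell_error s x tm (fun c => fine (nu [set u | grid_cell s u = c])))%:E + W1 nu lam)%E.
Proof.
move=> N0 s0 pnu htm.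
have mcell c : measurable [set u : Rd R d | grid_cell s u = c].
  by apply: (measurable_grid_cell (s := fun=> s)) => //; exact: measurable_id.
have mt : measurable_fun setT (tail (M%:R * s)).
  by apply: (measurable_tail (r := fun=> M%:R * s)) => //; exact: measurable_id.
apply: le_trans (W1_cells (grid_rep s) mcell x N0 lam pnu) _.
rewrite leeD2r// /cell_error.
have [P PE] := is_prob_probability pnu.
have h2 : (\int[nu]_u (enorm ((u : 'cV[R]_d) - grid_rep s (grid_cell s u)))%:E <=
    (d%:R * s + tm)%:E)%E.
  rewrite -(eq_set_integral _ _ PE).
  apply: (@le_trans _ _ (\int[P]_u ((d%:R * s)%:E + (tail (M%:R * s) u)%:E))%E).
    apply: le_integral_nm => u; first by rewrite lee_fin enorm_ge0.
    by rewrite -EFinD lee_fin enorm_sub_grid_rep.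
  rewrite ge0_integralD//; last 3 first.
  - by move=> u _; rewrite lee_fin mulr_ge0// ltW.
  - by move=> u _; rewrite lee_fin tail_ge0.
  - exact/measurable_EFinP.
  rewrite integral_cst_probability EFinD leeD2l//.
  by rewrite (eq_set_integral _ _ PE).
have h1 : N%:R^-1 * \sum_(i < N) enorm ((x i : 'cV[R]_d) - grid_rep s (grid_cell s (x i))) <=
    d%:R * s + N%:R^-1 * \sum_(i < N) tail (M%:R * s) (x i).
  apply: (@le_trans _ _ (N%:R^-1 * \sum_(i < N) (d%:R * s + tail (M%:R * s) (x i)))).
    by rewrite ler_wpM2l ?invr_ge0//; apply: ler_sum => i _; exact: enorm_sub_grid_rep.
  rewrite big_split/= mulrDr lerD2r sumr_const card_ord -[X in _ * X]mulr_natl mulKf//.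
  by rewrite pnatr_eq0 -lt0n.
have h3 q : \sum_c enorm (grid_rep s c) * `|cell_freq (grid_cell s) x c - q c| <=
    d%:R * M%:R * s * \sum_c `|cell_freq (grid_cell s) x c - q c|.
  by rewrite mulr_sumr; apply: ler_sum => c _; rewrite ler_wpM2r// enorm_grid_rep.
pose q c := fine (nu [set u | grid_cell s u = c]).
apply: (@le_trans _ _ ((d%:R * s + N%:R^-1 * \sum_(i < N) tail (M%:R * s) (x i))%:E +
   (d%:R * s + tm)%:E + (d%:R * M%:R * s * \sum_c `|cell_freq (grid_cell s) x c - q c|)%:E)%E).
  by apply: leeD; [apply: leeD|]; rewrite ?lee_fin.
rewrite -!EFinD lee_fin le_eqVlt; apply/orP; left; apply/eqP; ring.
Qed.
End grid.

Section independent_sampling.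
Variables (R : realType) (d : nat) (alpha : R).
Hypothesis alpha0 : 0 < alpha.
Let p := 1 + alpha.
Let p0 : 0 < p. Proof. by have := alpha0; rewrite /p; lra. Qed.
Let p1 : 1 <= p. Proof. by have := alpha0; rewrite /p; lra. Qed.

Lemma tail_le_moment r u : 0 < r -> tail (d := d) r u <= r `^ (- alpha) * enorm (u : 'cV[R]_d) `^ p.
Proof.
move=> r0; rewrite /tail; case: ifP => [ru|_]; last by rewrite mulr_ge0 ?powR_ge0.
have u0 : 0 < enorm (u : 'cV[R]_d) by exact: lt_le_trans ru.
rewrite /p powRS ?(ltW u0)// mulrCA ler_peMr ?(ltW u0)// powRN.
rewrite mulrC ler_pdivlMr ?powR_gt0// mul1r; apply: powR_le => //; exact: ltW.
Qed.

Definition moment_order : nat := Num.truncn p.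

Lemma moment_order_ge : p / 2 <= moment_order.+1%:R.
Proof.
have /andP[_ /ltW] := truncn_itv (ltW p0); apply: le_trans.
by rewrite ler_pdivrMr//; have := p0; lra.
Qed.

(** The prefactor comes from splitting the four terms of [cell_error] by two rounds of [powR_sum2].
    The summands are, in order: rounding, empirical tail, mean tail, cell frequencies. *)
Definition sampling_const : R := 2 `^ p * 2 `^ p *
  ((2 * d%:R) `^ p + rosenthal_const p * 2 + 1 +
   (2 * d%:R) `^ p * ((2 * 4 ^+ d) `^ (p / 2) * (1 + expR (growth_const R moment_order)))).

Context dd (T : measurableType dd) (P : probability T R).
Variables (N M : nat) (zeta : 'I_N -> T -> Rd R d) (rho x : R).
Hypothesis mzeta : forall i, measurable_fun setT (zeta i).
Hypothesis indep : forall B : 'I_N -> set (Rd R d), (forall i, measurable (B i)) ->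
  P (\bigcap_(i in [set: 'I_N]) (zeta i @^-1` B i)) = (\prod_(i < N) P (zeta i @^-1` B i))%E.
Hypotheses (N0 : (0 < N)%N) (rho0 : 0 < rho) (x1 : 1 <= x) (xN : x ^+ (d + 2) = N%:R).
Hypotheses (xM : x <= M%:R) (Mx : M%:R <= 2 * x).
Hypothesis moment : (\sum_(i < N) \int[P]_w (enorm (zeta i w : 'cV[R]_d) `^ p)%:E <=
  (N%:R * rho `^ p)%:E)%E.

Let s := rho * x `^ (- (alpha / p)).
Let q (c : grid d M) : R := N%:R^-1 * \sum_(i < N) cell_prob P zeta (grid_cell M s) i c.
Let tm : R := N%:R^-1 * \sum_(i < N) fine (\int[P]_w (tail (M%:R * s) (zeta i w))%:E).

Let x0 : 0 < x. Proof. exact: lt_le_trans ltr01 x1. Qed.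
Let s0 : 0 < s. Proof. by rewrite mulr_gt0// powR_gt0. Qed.
Let r := M%:R * s.
Let r0 : 0 < r. Proof. by rewrite mulr_gt0// (lt_le_trans x0). Qed.
Let NR0 : 0 < N%:R :> R. Proof. by rewrite ltr0n. Qed.

Let sp : s `^ p = rho `^ p * x `^ (- alpha).
Proof.
rewrite /s powRM ?(ltW rho0) ?powR_ge0//; congr (_ * _).
by rewrite -powRrM mulNr divfK// lt0r_neq0.
Qed.

Let xp (a b : R) : x `^ a * x `^ b = x `^ (a + b).
Proof. by rewrite powRD// (gt_eqF x0) implybT. Qed.

Let mt : measurable_fun setT (tail (d := d) r).
Proof. by apply: (measurable_tail (r := fun=> r)) => //; exact: measurable_id. Qed.

Let mtz i : measurable_fun setT (fun w => tail r (zeta i w)).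
Proof. exact: (measurableT_comp mt (mzeta i)). Qed.

Let tailp u : tail (d := d) r u `^ p <= enorm (u : 'cV[R]_d) `^ p.
Proof. by apply: powR_le; [exact: ltW p0|exact: tail_ge0|exact: tail_le]. Qed.

Let me i : measurable_fun setT (fun w => (enorm (zeta i w : 'cV[R]_d) `^ p)%:E).
Proof.
apply/measurable_EFinP.
apply: (measurableT_comp (f := fun a : R => a `^ p) (g := fun w => enorm (zeta i w : 'cV[R]_d))) => //.
exact: measurable_enorm.
Qed.

Let sum_tailp : (\sum_(i < N) \int[P]_w (tail r (zeta i w) `^ p)%:E <= (N%:R * rho `^ p)%:E)%E.
Proof.
apply: le_trans moment; apply: lee_sum => i _; apply: le_integral_nm => w.
  by rewrite lee_fin powR_ge0.
by rewrite lee_fin.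
Qed.

(** As M >= x, the radius r is at least rho x^(1 - alpha/p) = rho x^(1/p); this is what makes the
    truncated first moment no larger than the side s. *)
Let ra : r `^ (- alpha) * rho `^ p <= rho * x `^ (- (alpha / p)).
Proof.
have rx : rho * x `^ (1 / p) <= r.
  rewrite /r /s mulrCA ler_pM2l//.
  apply: (@le_trans _ _ (x * x `^ (- (alpha / p)))); last by rewrite ler_wpM2r ?powR_ge0.
  rewrite -{2}(powRr1 (ltW x0)) xp; apply: ler_powR => //.
  rewrite le_eqVlt; apply/orP; left; apply/eqP.
  by rewrite /p; field; exact: lt0r_neq0 p0.
have h : r `^ (- alpha) <= (rho * x `^ (1 / p)) `^ (- alpha).
  rewrite !powRN lef_pV2 ?posrE ?powR_gt0//; last by rewrite mulr_gt0// powR_gt0.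
  apply: powR_le => //; first exact: ltW.
  by rewrite mulr_ge0 ?powR_ge0// ltW.
apply: (@le_trans _ _ ((rho * x `^ (1 / p)) `^ (- alpha) * rho `^ p)).
  by rewrite ler_wpM2r ?powR_ge0.
rewrite powRM ?(ltW rho0) ?powR_ge0// -powRrM mulrAC -powRD; last first.
  by rewrite (gt_eqF rho0) implybT.
rewrite (_ : - alpha + p = 1); last by rewrite /p; ring.
rewrite powRr1 ?(ltW rho0)//.
by rewrite (_ : 1 / p * - alpha = - (alpha / p))//; ring.
Qed.

Let sum_tail : (\sum_(i < N) \int[P]_w (tail r (zeta i w))%:E <=
  (N%:R * (rho * x `^ (- (alpha / p))))%:E)%E.
Proof.
apply: (@le_trans _ _ ((r `^ (- alpha))%:E * (N%:R * rho `^ p)%:E)%E); last first.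
  by rewrite -EFinM lee_fin mulrCA ler_pM2l.
apply: le_trans (lee_wpmul2l _ moment); last by rewrite lee_fin powR_ge0.
rewrite ge0_sume_distrr; last first.
  by move=> i _; apply: integral_ge0 => w _; rewrite lee_fin powR_ge0.
apply: lee_sum => i _.
rewrite -ge0_integralZl//; last 2 first.
- by move=> w _; rewrite lee_fin powR_ge0.
- by rewrite lee_fin powR_ge0.
apply: le_integral_nm => w; first by rewrite lee_fin tail_ge0.
by rewrite -EFinM lee_fin tail_le_moment.
Qed.

Let tm0 : 0 <= tm.
Proof.
rewrite mulr_ge0 ?invr_ge0// sumr_ge0// => i _; rewrite fine_ge0//.
by apply: integral_ge0 => w _; rewrite lee_fin tail_ge0.
Qed.

Let tm_le : tm <= rho * x `^ (- (alpha / p)).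
Proof.
rewrite /tm mulrC ler_pdivrMr// [X in _ <= X]mulrC -lee_fin; apply: le_trans sum_tail.
rewrite -sumEFin; apply: lee_sum => i _; rewrite fineK// ge0_fin_numE; last first.
  by apply: integral_ge0 => w _; rewrite lee_fin tail_ge0.
apply: le_lt_trans (ltry (N%:R * (rho * x `^ (- (alpha / p))))).
apply: le_trans sum_tail; rewrite (bigD1 i)//= leeDl//; apply: sume_ge0 => j _.
by apply: integral_ge0 => w _; rewrite lee_fin tail_ge0.
Qed.

Let tmp : tm `^ p <= rho `^ p * x `^ (- alpha).
Proof. by rewrite -sp; apply: powR_le; [exact: ltW p0|exact: tm0|exact: tm_le]. Qed.

Let Z w := \sum_(i < N) tail r (zeta i w).
Let D w := \sum_c `|deviation P zeta (grid_cell M s) N c w|.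

Let mcell (c : grid d M) : measurable [set u : Rd R d | grid_cell M s u = c].
Proof. by apply: (measurable_grid_cell (s := fun=> s)) => //; exact: measurable_id. Qed.

(** Rosenthal's bound has two terms. (N s)^p has exactly the required size; the moment term N rho^p
    is at most N^p rho^p x^(-alpha), since x^alpha <= N^alpha. *)
Let Zp : (\int[P]_w (Z w `^ p)%:E <=
   (N%:R `^ p * (rosenthal_const p * 2 * (rho `^ p * x `^ (- alpha))))%:E)%E.
Proof.
have K0 : 0 <= rosenthal_const p by rewrite /rosenthal_const mulr_ge0 ?powR_ge0.
apply: le_trans (rosenthal mzeta indep N0 mt (tail_ge0 r) p1 sum_tailp sum_tail) _.
rewrite lee_fin [X in _ <= X](_ : _ = rosenthal_const p *
  (N%:R `^ p * (rho `^ p * x `^ (- alpha)) + N%:R `^ p * (rho `^ p * x `^ (- alpha)))); last first.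
  by ring.
rewrite ler_wpM2l// powRM ?(ltW NR0) ?(ltW s0)// -/s sp.
rewrite lerD2r mulrCA [X in X <= _]mulrC ler_wpM2l ?powR_ge0//.
rewrite /p powRS ?(ltW NR0)// -mulrA ler_peMr ?(ltW NR0)//.
rewrite -xN -powR_mulrn ?(ltW x0)// -powRrM xp; apply: powR_ge1 => //.
rewrite natrD mulrDl addrAC -addrA addr_ge0 ?mulr_ge0 ?(ltW alpha0)//; have := alpha0; lra.
Qed.

(** The left side equals (d M s)^p (#cells / N)^(p/2). With #cells <= 2 (4 x)^d and N = x^(d+2) the
    second factor is of order x^(-p), which cancels M^p <= (2 x)^p and leaves s^p. *)
Let grid_factor : (d%:R * M%:R * s / N%:R) `^ p * (#|{: grid d M}|%:R * N%:R) `^ (p / 2) <=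
  (2 * d%:R) `^ p * (2 * 4 ^+ d) `^ (p / 2) * (rho `^ p * x `^ (- alpha)).
Proof.
clearbody s.
have p2 : 0 <= p / 2 by rewrite divr_ge0// (ltW p0).
have F0 : 0 <= #|{: grid d M}|%:R :> R by [].
have -> : (d%:R * M%:R * s / N%:R) `^ p * (#|{: grid d M}|%:R * N%:R) `^ (p / 2) =
    (d%:R * M%:R * s) `^ p * (#|{: grid d M}|%:R / N%:R) `^ (p / 2).
  have -> : (d%:R * M%:R * s / N%:R) `^ p = (d%:R * M%:R * s) `^ p * N%:R^-1 `^ p.
    by apply: powRM; [apply: mulr_ge0 => //; exact: ltW|rewrite invr_ge0].
  rewrite -mulrA; congr (_ * _).
  have -> : N%:R^-1 `^ p = (N%:R^-1 ^+ 2) `^ (p / 2) :> R.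
    by rewrite -powR_mulrn ?invr_ge0 ?(ltW NR0)// -powRrM; congr (_ `^ _); field.
  rewrite -powRM ?mulr_ge0 ?sqr_ge0 ?(ltW NR0)//; congr (_ `^ _).
  by field; exact: lt0r_neq0.
have h1 : (d%:R * M%:R * s) `^ p <= (2 * d%:R) `^ p * (x `^ p * s `^ p).
  rewrite -powRM ?(ltW x0) ?(ltW s0)// -powRM ?mulr_ge0 ?(ltW x0) ?(ltW s0)//.
  apply: powR_le; rewrite ?(ltW p0) ?mulr_ge0 ?(ltW s0)//.
  rewrite mulrA ler_wpM2r ?(ltW s0)// -mulrA mulrCA ler_wpM2l//.
have h2 : (#|{: grid d M}|%:R / N%:R) `^ (p / 2) <= (2 * 4 ^+ d) `^ (p / 2) * x `^ (- p).
  have -> : x `^ (- p) = (x ^- 2) `^ (p / 2).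
    by rewrite -powR_invn ?(ltW x0)// -powRrM; congr (_ `^ _); field.
  rewrite -powRM ?mulr_ge0 ?invr_ge0 ?exprn_ge0 ?(ltW x0)//.
  apply: powR_le; [by []|by rewrite divr_ge0|].
  rewrite ler_pdivrMr// -xN exprD card_grid.
  have -> : 2 * 4 ^+ d * x ^- 2 * (x ^+ d * x ^+ 2) = (4 * x) ^+ d + (4 * x) ^+ d.
    rewrite exprMn; move: (4 ^+ d) (x ^+ d) => u v; field; exact: lt0r_neq0.
  apply: lerD.
    by rewrite lerXn2r ?nnegrE ?mulr_ge0 ?(ltW x0)//; have := Mx; lra.
  by rewrite exprn_ege1//; have := x1; lra.
apply: le_trans (ler_pM _ _ h1 h2) _; rewrite ?powR_ge0//.
rewrite -sp le_eqVlt; apply/orP; left; apply/eqP.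
rewrite [X in _ = X](_ : _ = (x `^ p * x `^ (- p)) *
  ((2 * d%:R) `^ p * (2 * 4 ^+ d) `^ (p / 2) * s `^ p)).
  by ring.
by rewrite xp subrr powRr0 mul1r.
Qed.

Let freqE w : \sum_c `|cell_freq (grid_cell M s) (fun i => zeta i w) c - q c| = N%:R^-1 * D w.
Proof.
rewrite /D mulr_sumr; apply: eq_bigr => c _.
rewrite /cell_freq /q -mulrBr normrM ger0_norm ?invr_ge0//; congr (_ * `|_|).
by rewrite /deviation -sumrB; apply: eq_bigl => i; rewrite ltn_ord.
Qed.

Let mpow (f : T -> R) : measurable_fun setT f -> measurable_fun setT (fun w => (f w `^ p)%:E).
Proof.
move=> mf; apply/measurable_EFinP.
by apply: (measurableT_comp (f := fun a : R => a `^ p) (g := f)).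
Qed.

Lemma measurable_cell_error_frozen : measurable_fun setT D.
Proof. by apply: measurable_sum => c; apply: measurableT_comp => //; exact: measurable_deviation. Qed.

Lemma integral_cell_error :
  (\int[P]_w (cell_error s (fun i => zeta i w) tm q `^ p)%:E <=
   (sampling_const * (rho `^ p * x `^ (- alpha)))%:E)%E.
Proof.
clearbody s; have s0' := ltW s0; have NV0 : 0 <= N%:R^-1 :> R by rewrite invr_ge0 ltW.
have Z0 w : 0 <= Z w by apply: sumr_ge0 => i _; exact: tail_ge0.
have D0 w : 0 <= D w by apply: sumr_ge0.
set W := d%:R * M%:R * s / N%:R.
have W0 : 0 <= W by apply: mulr_ge0 => //; apply: mulr_ge0.
set B := 2 * d%:R * s.
have B0 : 0 <= B by rewrite /B !mulr_ge0.
have mZ : measurable_fun setT Z by exact: measurable_sum.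
have mD := measurable_cell_error_frozen.
have pp0 := ltW p0.
have pw w : cell_error s (fun i => zeta i w) tm q `^ p <=
    2 `^ p * 2 `^ p * (B `^ p + tm `^ p) + (2 `^ p * 2 `^ p * N%:R^-1 `^ p) * Z w `^ p +
    (2 `^ p * 2 `^ p * W `^ p) * D w `^ p.
  rewrite /cell_error freqE.
  have -> : B + N%:R^-1 * \sum_(i < N) tail (M%:R * s) (zeta i w) + tm +
      d%:R * M%:R * s * (N%:R^-1 * D w) = (B + tm) + (N%:R^-1 * Z w + W * D w).
    by rewrite /W /Z; ring.
  have tm0' := tm0; have ZN0 : 0 <= N%:R^-1 * Z w by rewrite mulr_ge0.
  have WD0 : 0 <= W * D w by rewrite mulr_ge0.
  clearbody tm.
  apply: le_trans (powR_sum2 pp0 _ _) _; rewrite ?addr_ge0//.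
  apply: (@le_trans _ _ (2 `^ p * (2 `^ p * (B `^ p + tm `^ p) +
      2 `^ p * ((N%:R^-1 * Z w) `^ p + (W * D w) `^ p)))).
    by rewrite ler_wpM2l ?powR_ge0// lerD// powR_sum2// ?mulr_ge0.
  rewrite (powRM p NV0 (Z0 w)) (powRM p W0 (D0 w)) le_eqVlt; apply/orP; left; apply/eqP; ring.
apply: (@le_trans _ _ (\int[P]_w ((2 `^ p * 2 `^ p * (B `^ p + tm `^ p))%:E +
   (2 `^ p * 2 `^ p * N%:R^-1 `^ p)%:E * (Z w `^ p)%:E +
   (2 `^ p * 2 `^ p * W `^ p)%:E * (D w `^ p)%:E))%E).
  apply: le_integral_nm => w; first by rewrite lee_fin powR_ge0.
  by rewrite -!EFinM -!EFinD lee_fin.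
have c1 : 0 <= 2 `^ p * 2 `^ p * (B `^ p + tm `^ p) by rewrite !mulr_ge0 ?addr_ge0 ?powR_ge0.
have c2 : 0 <= 2 `^ p * 2 `^ p * N%:R^-1 `^ p by rewrite !mulr_ge0 ?powR_ge0.
have c3 : 0 <= 2 `^ p * 2 `^ p * W `^ p by rewrite !mulr_ge0 ?powR_ge0.
have mZp := mpow mZ; have mDp := mpow mD.
have z0 w : (0 <= (Z w `^ p)%:E)%E by rewrite lee_fin powR_ge0.
have d0 w : (0 <= (D w `^ p)%:E)%E by rewrite lee_fin powR_ge0.
rewrite (integral_affine2 P c1 c2 c3 mZp mDp z0 d0).
set y := rho `^ p * x `^ (- alpha).
have y0 : 0 <= y by rewrite mulr_ge0 ?powR_ge0.
have e2 := lee_wpmul2l (x := (2 `^ p * 2 `^ p * N%:R^-1 `^ p)%:E) c2 Zp.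
have e3 : (\int[P]_w (D w `^ p)%:E <= ((#|{: grid d M}|%:R * N%:R) `^ (p / 2) *
    (1 + expR (growth_const R moment_order)))%:E)%E.
  exact: (integral_deviation mzeta indep mcell N0 pp0 moment_order_ge).
have {}e3 := lee_wpmul2l (x := (2 `^ p * 2 `^ p * W `^ p)%:E) c3 e3.
apply: le_trans (leeD (leeD (lexx _) e2) e3) _.
rewrite -!EFinM -!EFinD lee_fin /sampling_const -/y.
set K := 2 `^ p * 2 `^ p; have K0 : 0 <= K by rewrite mulr_ge0 ?powR_ge0.
have hB : B `^ p = (2 * d%:R) `^ p * y by rewrite /B powRM// sp.
have hN : N%:R^-1 `^ p * N%:R `^ p = 1 :> R.
  by rewrite -powRM// ?(ltW NR0)// mulVf ?powR1// lt0r_neq0.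
set Kp := rosenthal_const p; set G := 1 + _; set F := (_ * _) `^ (p / 2).
have G0 : 0 <= G by rewrite /G addr_ge0// expR_ge0.
have hW : W `^ p * (F * G) <= (2 * d%:R) `^ p * ((2 * 4 ^+ d) `^ (p / 2) * G) * y.
  have h := ler_wpM2r G0 grid_factor.
  rewrite mulrA; apply: le_trans h _.
  by rewrite le_eqVlt; apply/orP; left; apply/eqP; rewrite -/y; ring.
have htm : tm `^ p <= y by exact: tmp.
rewrite (_ : _ + _ + _ = K * (B `^ p + tm `^ p + (N%:R^-1 `^ p * N%:R `^ p) * (Kp * 2 * y) +
  W `^ p * (F * G))); last by ring.
rewrite -(mulrA K) ler_wpM2l// hN hB.
rewrite [X in _ <= X](_ : _ = (2 * d%:R) `^ p * y + y + 1 * (Kp * 2 * y) +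
  (2 * d%:R) `^ p * ((2 * 4 ^+ d) `^ (p / 2) * G) * y); last by ring.
by rewrite lerD// lerD2r lerD2l.
Qed.
End independent_sampling.

(** * The nonlinear evolution *)

Section opnorm.
Variables (R : realType) (d : nat).

(** [opnorm] is a supremum in R, so a bound for the set is needed first; the sum of all |A i j|
    serves. The rest is normalisation of x. *)
Lemma enorm_mulmx (A : 'M[R]_d) (x : 'cV[R]_d) : enorm (A *m x) <= opnorm A * enorm x.
Proof.
have b : ubound [set enorm (A *m x) | x in [set x : 'cV[R]_d | enorm x <= 1]]
    (\sum_i \sum_j `|A i j|).
  move=> _ [y y1 <-]; apply: le_trans (enorm_le_sum _) _; apply: ler_sum => i _.
  rewrite mxE; apply: le_trans (ler_norm_sum _ _ _) _; apply: ler_sum => j _.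
  rewrite normrM ler_piMr//; apply: le_trans y1.
  rewrite -(@ler_pXn2r _ 2)// ?nnegrE ?enorm_ge0//.
  rewrite enorm_sqr real_normK ?num_real// (bigD1 j)//= lerDl sumr_ge0// => k _.
  exact: sqr_ge0.
have [x0|x0] := eqVneq (enorm x) 0.
  by rewrite (enorm_eq0 x0) mulmx0 enorm0 mulr0.
have xp : 0 < enorm x by rewrite lt_neqAle eq_sym x0 enorm_ge0.
rewrite -ler_pdivrMr//; apply: ub_le_sup; first by exists (\sum_i \sum_j `|A i j|).
exists ((enorm x)^-1 *: x) => /=.
  by rewrite enormZ ger0_norm ?invr_ge0 ?enorm_ge0// mulVf.
by rewrite -scalemxAr enormZ ger0_norm ?invr_ge0 ?enorm_ge0// mulrC.
Qed.
End opnorm.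

(** * Integrated Lipschitz bounds for f *)

Section lipschitz.
Variables (R : realType) (d m : nat).
Variable f : Rd R d -> meas R d -> Rd R m -> Rd R d.
Hypothesis hf : f_measurable f.
Variable theta : probability (Rd R m) R.

(** The denominator v in [Dlip] can be infinite, or 0 for distinct pairs whose measures differ on
    non-measurable sets only; its inverse is then +oo. A real u > 0 above v avoids the extended
    quotient. *)
Lemma Dlip_ge x1 mu1 x2 mu2 z (u : R) : P1 mu1 -> P1 mu2 -> (x1, mu1) <> (x2, mu2) ->
  0 < u -> ((enorm ((x1 : 'cV[R]_d) - x2))%:E + W1 mu1 mu2 <= u%:E)%E ->
  ((enorm ((f x1 mu1 z : 'cV[R]_d) - f x2 mu2 z) / u)%:E <= Dlip f z)%E.
Proof.
move=> P1mu1 P1mu2 ne u0 vu.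
set v := (_ + _)%E in vu.
apply: (@le_trans _ _ ((enorm ((f x1 mu1 z : 'cV[R]_d) - f x2 mu2 z))%:E * v^-1)%E); last first.
  by apply: ereal_sup_ubound; exists x1, mu1, x2, mu2.
rewrite EFinM lee_wpmul2l ?lee_fin ?enorm_ge0//.
have v0 : (0 <= v)%E by rewrite adde_ge0 ?lee_fin ?enorm_ge0// W1_ge0.
move: v v0 vu => [r| |]//=; rewrite !lee_fin => r0 ru; rewrite inver.
case: eqVneq => [_|rN0]; first by rewrite leey.
by rewrite lee_fin lef_pV2// posrE// lt_neqAle eq_sym rN0.
Qed.

Lemma lipschitz_integral (r S : R) x1 mu1 x2 mu2 (w : R) : 0 < r ->
  (\int[theta]_z poweR (Dlip f z) r = S%:E)%E ->
  P1 mu1 -> P1 mu2 -> 0 <= w ->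
  ((enorm ((x1 : 'cV[R]_d) - x2))%:E + W1 mu1 mu2 <= w%:E)%E ->
  (\int[theta]_z (enorm ((f x1 mu1 z : 'cV[R]_d) - f x2 mu2 z) `^ r)%:E <= (S * w `^ r)%:E)%E.
Proof.
move=> r0 DS P1mu1 P1mu2 w0 vw.
have S0 : 0 <= S by rewrite -lee_fin -DS; apply: integral_ge0 => z _; exact: poweR_ge0.
pose D z := enorm ((f x1 mu1 z : 'cV[R]_d) - f x2 mu2 z).
have D0 z : 0 <= D z by exact: enorm_ge0.
have mD : measurable_fun setT D.
  by apply: measurable_enorm; apply: measurable_RdB; apply: measurable_f_cst => //; exact: measurable_id.
have H (u : R) : 0 < u -> w <= u -> (\int[theta]_z (D z `^ r)%:E <= (S * u `^ r)%:E)%E.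
  move=> u0 wu.
  have [e|ne] := pselect ((x1, mu1) = (x2, mu2)).
    have D00 z : D z = 0 by rewrite /D; move: e => [-> ->]; rewrite subrr enorm0.
    under eq_integral do rewrite D00 powR0 ?gt_eqF//.
    by rewrite integral0 lee_fin mulr_ge0 ?powR_ge0.
  have E z : (D z `^ r)%:E = ((u `^ r)%:E * ((D z / u) `^ r)%:E)%E.
    by rewrite -EFinM -powRM ?divr_ge0 ?(ltW u0)// mulrC divfK// gt_eqF.
  under eq_integral do rewrite E.
  rewrite ge0_integralZl//; last 3 first.
  - apply/measurable_EFinP.
    apply: (measurableT_comp (f := fun a : R => a `^ r) (g := fun z => D z / u)) => //.
    exact: measurable_funM.
  - by move=> z _; rewrite lee_fin powR_ge0.
  - by rewrite lee_fin powR_ge0.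
  rewrite EFinM muleC -DS; apply: lee_wpmul2r; first by rewrite lee_fin powR_ge0.
  apply: le_integral_nm => z; first by rewrite lee_fin powR_ge0.
  have Dz : ((D z / u)%:E <= Dlip f z)%E.
    by apply: Dlip_ge => //; apply: le_trans vw _; rewrite lee_fin.
  have Du0 : (0 <= (D z / u)%:E)%E by rewrite lee_fin divr_ge0 ?(ltW u0).
  rewrite -poweR_EFin; apply: gt0_ler_poweR => //; rewrite ?in_itv/= ?leey ?andbT ?(ltW r0)//.
  exact: le_trans Dz.
have [wp|] := ltP 0 w; first exact: H.
move=> w0'; have {w0'}w00 : w = 0 by apply/eqP; rewrite eq_le w0 w0'.
rewrite w00 powR0 ?gt_eqF// mulr0; apply/lee_addgt0Pr => t t0; rewrite add0e.
have S1 : 0 < S + 1 by lra.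
(* For w = 0 the bound is a limit of those for u > 0: the choice u^r = t / (S + 1) makes S u^r <=
   t. *)
apply: le_trans (H ((t / (S + 1)) `^ r^-1) _ _) _.
- by rewrite powR_gt0// divr_gt0.
- by rewrite w00 powR_ge0.
rewrite -powRrM mulVf ?gt_eqF// powRr1 ?divr_ge0 ?(ltW t0) ?(ltW S1)//.
rewrite lee_fin mulrA ler_pdivrMr// mulrC ler_pM2l//; lra.
Qed.
End lipschitz.

Section coupling_aux.
Variables (R : realType) (d : nat).

Lemma coupling_integral2 (mu nu : meas R d) (Q : probability (Rd R d * Rd R d)%type R)
    (h : Rd R d -> \bar R) : coupling mu nu Q ->
  measurable_fun setT h -> (forall x, 0 <= h x)%E ->
  (\int[Q]_p h p.2 = \int[nu]_x h x)%E.
Proof.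
move=> [_ _ Q2] mh h0.
have [Q' [QE QI]] := pushforward_probability Q (@measurable_snd _ _ (Rd R d) (Rd R d)).
rewrite -QI//; apply: eq_set_integral => A mA; rewrite QE -Q2//; congr (Q _).
by apply/seteqP; split => [[a b]|[a b]] /=; tauto.
Qed.
End coupling_aux.

Section dirac_mass.
Variables (R : realType) (d : nat).

Lemma empirical_dirac (x : Rd R d) :
  empirical (fun _ : 'I_1 => x) = @dirac _ (Rd R d) x R.
Proof. by apply/funext => B; rewrite /empirical big_ord1 invr1 mul1e. Qed.

Lemma P1_dirac (x : Rd R d) : P1 (@dirac _ (Rd R d) x R).
Proof. by rewrite -empirical_dirac; exact: P1_empirical. Qed.

Lemma W1_dirac (mu : meas R d) : is_prob mu ->
  (W1 mu (@dirac _ (Rd R d) (0%R : 'cV[R]_d) R) <= \int[mu]_x (enorm (x : 'cV[R]_d))%:E)%E.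
Proof.
move=> /is_prob_probability[nu nuE].
have m0 : measurable_fun setT (fun x : Rd R d => (x, (0%R : 'cV[R]_d) : Rd R d)).
  by apply: measurable_fun_pair => //; exact: measurable_id.
have [Q [QE QI]] := pushforward_probability nu m0.
apply: (@le_trans _ _ (\int[Q]_p (enorm ((p.1 : 'cV[R]_d) - p.2))%:E)%E).
  apply: W1_le; split; first exact: probability_is_prob.
  - move=> B mB; rewrite QE -nuE//; congr (nu _).
    by apply/seteqP; split => [x []|x].
  - move=> B mB; rewrite QE diracE.
    have [B0|B0] := boolP ((0%R : 'cV[R]_d) \in B).
      rewrite (_ : _ @^-1` _ = setT) ?probability_setT//.
      by apply/seteqP; split => // x _; split => //=; rewrite inE in B0.
    rewrite (_ : _ @^-1` _ = set0) ?measure0//.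
    by apply/seteqP; split => // x [_ /=]; rewrite -[X in X -> _]in_setE (negPf B0).
rewrite QI; last 2 first.
- by apply: measurable_enormB; [exact: measurable_fst|exact: measurable_snd].
- by move=> p; rewrite lee_fin enorm_ge0.
rewrite /= (eq_set_integral _ _ nuE) le_eqVlt; apply/orP; left; apply/eqP.
by congr (integral _ _ _); apply/funext => x; rewrite subr0.
Qed.
End dirac_mass.

Section nonlinear.
Variables (R : realType) (d m : nat).
Variable f : Rd R d -> meas R d -> Rd R m -> Rd R d.
Hypothesis hf : f_measurable f.
Variables (theta : probability (Rd R m) R) (A : 'M[R]_d) (delta a sigma : R).
Hypothesis a0 : 0 <= a.
Hypothesis hA : forall x : 'cV[R]_d, enorm (A *m x) <= a * enorm x.
Hypothesis delta0 : 0 <= delta.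
Hypothesis hsigma : (\int[theta]_z poweR (Dlip f z) 1 = sigma%:E)%E.

Local Notation Psi := (Psi A delta f (theta : meas R m)).
Local Notation step := (step f A delta).

Let sigma0 : 0 <= sigma.
Proof. by rewrite -lee_fin -hsigma; apply: integral_ge0 => z _; exact: poweR_ge0. Qed.

Lemma measurable_step (mu : meas R d) : P1 mu ->
  measurable_fun setT (fun p : Rd R d * Rd R m => step p.1 mu p.2).
Proof. by move=> P1mu; apply: measurable_step_cst. Qed.

Lemma enorm_step (x y : Rd R d) mu nu z :
  enorm ((step x mu z : 'cV[R]_d) - step y nu z) <=
  a * enorm ((x : 'cV[R]_d) - y) + delta * enorm ((f x mu z : 'cV[R]_d) - f y nu z).
Proof.
have -> : (step x mu z : 'cV[R]_d) - step y nu z =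
    A *m ((x : 'cV[R]_d) - y) + delta *: ((f x mu z : 'cV[R]_d) - f y nu z).
  by rewrite /step mulmxBr scalerBr opprD addrACA.
apply: le_trans (enormD _ _) _; apply: lerD; first exact: hA.
by rewrite enormZ ger0_norm.
Qed.

Lemma integral_step (x y : Rd R d) mu nu (w : R) : P1 mu -> P1 nu -> 0 <= w ->
  ((enorm ((x : 'cV[R]_d) - y))%:E + W1 mu nu <= w%:E)%E ->
  (\int[theta]_z (enorm ((step x mu z : 'cV[R]_d) - step y nu z))%:E <=
   (a * enorm ((x : 'cV[R]_d) - y) + delta * sigma * w)%:E)%E.
Proof.
move=> P1mu P1nu w0 hw.
have := lipschitz_integral hf ltr01 hsigma P1mu P1nu w0 hw.
rewrite powRr1//; under eq_integral do rewrite powRr1 ?enorm_ge0//.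
set D := fun z => (enorm ((f x mu z : 'cV[R]_d) - f y nu z))%:E => h.
have mD : measurable_fun setT D by apply: measurable_enormB; exact: measurable_f_cst.
apply: (@le_trans _ _ (\int[theta]_z ((a * enorm ((x : 'cV[R]_d) - y))%:E + delta%:E * D z))%E).
  apply: le_integral_nm => z; first by rewrite lee_fin enorm_ge0.
  by rewrite -EFinM -EFinD lee_fin enorm_step.
rewrite ge0_integralD//; last 3 first.
- by move=> z _; rewrite lee_fin mulr_ge0 ?enorm_ge0.
- by move=> z _; rewrite -EFinM lee_fin mulr_ge0 ?enorm_ge0.
- exact: emeasurable_funM.
rewrite integral_cst_probability ge0_integralZl//.
  by rewrite EFinD leeD2l// -mulrA EFinM lee_wpmul2l.
by move=> z _; rewrite lee_fin enorm_ge0.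
Qed.

Lemma step_section (mu : meas R d) (x : Rd R d) (B : set (Rd R d)) :
  xsection ((fun p : Rd R d * Rd R m => step p.1 mu p.2) @^-1` B) x = [set z | B (step x mu z)].
Proof. by apply/seteqP; split => z; rewrite /xsection /= inE. Qed.

Lemma measurable_Psi_fun (mu : meas R d) (B : set (Rd R d)) : P1 mu -> measurable B ->
  measurable_fun setT (fun x => theta [set z | B (step x mu z)]).
Proof.
move=> P1mu mB; under eq_fun do rewrite -step_section.
apply: measurable_fun_xsection; rewrite -[X in measurable X]setTI.
exact: measurable_step.
Qed.

Lemma Psi_probability (mu : meas R d) : P1 mu ->
  exists Q : probability (Rd R d) R, (forall B, measurable B -> Q B = Psi mu B) /\
  forall h : Rd R d -> \bar R, measurable_fun setT h -> (forall x, 0 <= h x)%E ->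
    (\int[Q]_y h y = \int[mu]_x \int[theta]_z h (step x mu z))%E.
Proof.
move=> P1mu; have [nu nuE] := is_prob_probability P1mu.1.
have ms := measurable_step P1mu.
have [Q [QE QI]] := pushforward_probability (nu \x theta)%E ms.
exists Q; split => [B mB|h mh h0].
  transitivity (\int[nu]_x theta [set z | B (step x mu z)])%E; last exact: eq_set_integral.
  by rewrite QE; apply: eq_integral => x _; rewrite /= step_section.
rewrite QI// fubini_tonelli1//; last exact: (measurableT_comp mh ms).
by rewrite /fubini_F (eq_set_integral _ _ nuE).
Qed.

Lemma is_prob_eq dd (T : measurableType dd) (Q : probability T R) (mu : set T -> \bar R) :
  (forall B, measurable B -> Q B = mu B) -> is_prob mu.
Proof.
move=> h; split; rewrite -?h ?measure0 ?probability_setT//.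
  by move=> B mB; rewrite -h.
move=> F mF tF mUF; rewrite -h//.
under eq_fun do under eq_bigr do rewrite -h//.
exact: measure_semi_sigma_additive.
Qed.

(** Synchronous coupling: any coupling Q of mu and nu is driven by one common noise. Its cost c
    becomes at most a c + delta sigma (c + W_1), where W_1 stems from the measure argument of f and
    is at most c; hence the factor 2. *)
Lemma W1_Psi mu nu : P1 mu -> P1 nu -> 0 < a ->
  (W1 (Psi mu) (Psi nu) <= (a + 2 * delta * sigma)%:E * W1 mu nu)%E.
Proof.
move=> P1mu P1nu a_gt0.
set q := a + _; have q0 : 0 < q by rewrite ltr_wpDr// !mulr_ge0.
(* Dividing by q turns the claim into a lower bound for [W1 mu nu], which can be checked on each
   coupling. *)
suff h : ((q^-1)%:E * W1 (Psi mu) (Psi nu) <= W1 mu nu)%E.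
  have := lee_wpmul2l (x := q%:E) _ h; rewrite muleA -EFinM divff ?gt_eqF// mul1e; apply.
  by rewrite lee_fin ltW.
apply: W1_ge => Q cQ.
suff {}h : (W1 (Psi mu) (Psi nu) <= q%:E * \int[Q]_p (enorm ((p.1 : 'cV[R]_d) - p.2))%:E)%E.
  have := lee_wpmul2l (x := (q^-1)%:E) _ h; rewrite muleA -EFinM mulVf ?gt_eqF// mul1e; apply.
  by rewrite lee_fin invr_ge0 ltW.
have c0 : (0 <= \int[Q]_p (enorm ((p.1 : 'cV[R]_d) - p.2))%:E)%E.
  by apply: integral_ge0 => p _; rewrite lee_fin enorm_ge0.
have Wc := W1_le cQ; have W0 := W1_ge0 mu nu.
have mc : measurable_fun setT (fun p : Rd R d * Rd R d => (enorm ((p.1 : 'cV[R]_d) - p.2))%:E).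
  by apply: measurable_enormB; [exact: measurable_fst|exact: measurable_snd].
set c := integral _ _ _ in c0 Wc *.
have [cy|cfin] := eqVneq c +oo%E; first by rewrite cy gt0_muley ?lte_fin// leey.
have cE : c = (fine c)%:E by rewrite fineK// ge0_fin_numE// ltey.
have WE : W1 mu nu = (fine (W1 mu nu))%:E.
  by rewrite fineK// ge0_fin_numE// (le_lt_trans Wc)// ltey.
set w := fine (W1 mu nu) in WE.
have w0 : 0 <= w by rewrite fine_ge0.
pose g (p : (Rd R d * Rd R d) * Rd R m) := (step p.1.1 mu p.2, step p.1.2 nu p.2).
have mx : measurable_fun setT (fun p : (Rd R d * Rd R d) * Rd R m => (p.1.1, p.2)).
  apply: measurable_fun_pair; last exact: measurable_snd.
  exact: (measurableT_comp measurable_fst measurable_fst).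
have my : measurable_fun setT (fun p : (Rd R d * Rd R d) * Rd R m => (p.1.2, p.2)).
  apply: measurable_fun_pair; last exact: measurable_snd.
  exact: (measurableT_comp measurable_snd measurable_fst).
have mg1 := measurableT_comp (measurable_step P1mu) mx.
have mg2 := measurableT_comp (measurable_step P1nu) my.
have mg : measurable_fun setT g by exact: measurable_fun_pair.
have [S [SE SI]] := pushforward_probability (Q \x theta)%E mg.
have [_ cQ1 cQ2] := cQ.
apply: (@le_trans _ _ (\int[S]_p (enorm ((p.1 : 'cV[R]_d) - p.2))%:E)%E).
  apply: W1_le; split; first exact: probability_is_prob.
  - move=> B mB; transitivity (\int[Q]_p theta [set z | B (step p.1 mu z)])%E.
      rewrite SE; apply: eq_integral => p _ /=; congr (theta _).
      by apply/seteqP; split => z; rewrite /xsection /= inE => //; case.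
    by rewrite (coupling_integral1 (h := fun x => theta [set z | B (step x mu z)]) cQ)//; exact: measurable_Psi_fun.
  - move=> B mB; transitivity (\int[Q]_p theta [set z | B (step p.2 nu z)])%E.
      rewrite SE; apply: eq_integral => p _ /=; congr (theta _).
      by apply/seteqP; split => z; rewrite /xsection /= inE => //; case.
    by rewrite (coupling_integral2 (h := fun x => theta [set z | B (step x nu z)]) cQ)//; exact: measurable_Psi_fun.
rewrite SI//; last by move=> p; rewrite lee_fin enorm_ge0.
have mgc : measurable_fun setT (fun p => (enorm (((g p).1 : 'cV[R]_d) - (g p).2))%:E).
  exact: (measurableT_comp mc mg).
rewrite fubini_tonelli1//; last by move=> p; rewrite lee_fin enorm_ge0.
apply: (@le_trans _ _ (\int[Q]_p ((a + delta * sigma)%:E * (enorm ((p.1 : 'cV[R]_d) - p.2))%:E +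
   (delta * sigma * w)%:E))%E).
  apply: le_integral_nm => p; first by apply: integral_ge0 => z _; rewrite lee_fin enorm_ge0.
  have e0 : 0 <= enorm ((p.1 : 'cV[R]_d) - p.2) by exact: enorm_ge0.
  apply: le_trans (integral_step (w := enorm ((p.1 : 'cV[R]_d) - p.2) + w) P1mu P1nu _ _) _.
  - by rewrite addr_ge0.
  - by rewrite WE -EFinD.
  by rewrite -EFinM -EFinD lee_fin le_eqVlt; apply/orP; left; apply/eqP; ring.
have ads : 0 <= a + delta * sigma by rewrite addr_ge0 ?mulr_ge0.
rewrite ge0_integralD//; last 3 first.
- by move=> p _; rewrite -EFinM lee_fin mulr_ge0 ?enorm_ge0.
- exact: emeasurable_funM.
- by move=> p _; rewrite lee_fin !mulr_ge0.
rewrite integral_cst_probability ge0_integralZl//; last by move=> p _; rewrite lee_fin enorm_ge0.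
rewrite -/c cE -!EFinM -EFinD lee_fin.
have wc : w <= fine c by rewrite -lee_fin -cE -WE.
apply: le_trans (lerD (lexx _) (ler_wpM2l (mulr_ge0 delta0 sigma0) wc)) _.
by rewrite le_eqVlt; apply/orP; left; apply/eqP; rewrite /q; ring.
Qed.

Variable D1i : R.
Hypothesis hD1 : (\int[theta]_z D1 f z = D1i%:E)%E.

(** The update is compared with the one from the origin under the Dirac mass there, whose norm is
    delta times D_1. *)
Lemma P1_Psi mu : P1 mu -> P1 (Psi mu).
Proof.
move=> P1mu; have [Q [QE QI]] := Psi_probability P1mu.
split; first exact: is_prob_eq QE.
rewrite -(eq_set_integral _ _ QE) QI; last 2 first.
- by apply/measurable_EFinP; apply: measurable_enorm; exact: measurable_id.
- by move=> x; rewrite lee_fin enorm_ge0.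
have [nu nuE] := is_prob_probability P1mu.1.
have Wm := W1_dirac P1mu.1.
have m1 : (\int[mu]_x (enorm (x : 'cV[R]_d))%:E < +oo)%E := P1mu.2.
set W := W1 _ _ in Wm.
have WE : W = (fine W)%:E by rewrite fineK// ge0_fin_numE ?W1_ge0// (le_lt_trans Wm).
set w := fine W in WE.
have w0 : 0 <= w by rewrite fine_ge0 ?W1_ge0.
have dl : 0 <= delta * sigma by rewrite mulr_ge0.
have D10 : 0 <= D1i by rewrite -lee_fin -hD1; apply: integral_ge0 => z _; rewrite lee_fin enorm_ge0.
pose e (x : Rd R d) := (enorm (x : 'cV[R]_d))%:E.
have me : measurable_fun setT e.
  by apply/measurable_EFinP; apply: measurable_enorm; exact: measurable_id.
rewrite -(eq_set_integral _ _ nuE).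
apply: (@le_lt_trans _ _ (\int[nu]_x ((a + delta * sigma)%:E * e x + (delta * sigma * w + delta * D1i)%:E))%E).
  apply: le_integral_nm => x; first by apply: integral_ge0 => z _; rewrite lee_fin enorm_ge0.
  pose y0 : Rd R d := (0 : 'cV[R]_d).
  pose d0 : meas R d := @dirac _ (Rd R d) y0 R.
  have mf : measurable_fun setT (fun z => (enorm (f y0 d0 z : 'cV[R]_d))%:E).
    by apply/measurable_EFinP; apply: measurable_enorm; apply: measurable_f_cst => //; exact: P1_dirac.
  have mst : measurable_fun setT (fun z => (enorm ((step x mu z : 'cV[R]_d) - step y0 d0 z))%:E).
    by apply: measurable_enormB; apply: measurable_step_cst => //; exact: P1_dirac.
  have := integral_step (x := x) (y := y0) (mu := mu) (nu := d0)
     (w := enorm (x : 'cV[R]_d) + w) P1mu (P1_dirac y0).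
  rewrite subr0 addr_ge0 ?enorm_ge0// => /(_ isT).
  rewrite -/W WE -EFinD lexx => /(_ isT) h.
  apply: (@le_trans _ _ (\int[theta]_z ((enorm ((step x mu z : 'cV[R]_d) - step y0 d0 z))%:E +
     delta%:E * (enorm (f y0 d0 z : 'cV[R]_d))%:E))%E).
    apply: le_integral_nm => z; first by rewrite lee_fin enorm_ge0.
    rewrite -EFinM -EFinD lee_fin.
    have -> : delta * enorm (f y0 d0 z : 'cV[R]_d) = enorm (step y0 d0 z : 'cV[R]_d).
      by rewrite /step mulmx0 add0r enormZ ger0_norm.
    have := enormD ((step x mu z : 'cV[R]_d) - step y0 d0 z) (step y0 d0 z : 'cV[R]_d).
    by rewrite subrK.
  rewrite ge0_integralD//; last 3 first.
  - by move=> z _; rewrite lee_fin enorm_ge0.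
  - by move=> z _; rewrite -EFinM lee_fin mulr_ge0 ?enorm_ge0.
  - exact: emeasurable_funM.
  rewrite ge0_integralZl//; last by move=> z _; rewrite lee_fin enorm_ge0.
  have := hD1; rewrite /D1 -/y0 -/d0 => ->.
  apply: le_trans (leeD h (lexx _)) _.
  by rewrite -!EFinM -!EFinD lee_fin le_eqVlt; apply/orP; left; apply/eqP; ring.
have ads : 0 <= a + delta * sigma by rewrite addr_ge0.
rewrite ge0_integralD//; last 3 first.
- by move=> p _; rewrite -EFinM lee_fin mulr_ge0 ?enorm_ge0.
- exact: emeasurable_funM.
- by move=> p _; rewrite lee_fin addr_ge0// mulr_ge0.
rewrite integral_cst_probability ge0_integralZl//; last by move=> p _; rewrite lee_fin enorm_ge0.
rewrite (eq_set_integral _ _ nuE) lte_add_pinfty ?ltry// lte_mul_pinfty//.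
Qed.
End nonlinear.

(** * One step of the particle system *)

Section one_step.
Variables (R : realType) (d m : nat).
Variable f : Rd R d -> meas R d -> Rd R m -> Rd R d.
Hypothesis hf : f_measurable f.
Variables (theta : probability (Rd R m) R) (A : 'M[R]_d) (delta a alpha S1 D1p : R).
Hypothesis a0 : 0 < a.
Hypothesis hA : forall x : 'cV[R]_d, enorm (A *m x) <= a * enorm x.
Hypothesis delta0 : 0 <= delta.
Hypothesis alpha0 : 0 < alpha.
Let p := 1 + alpha.
Hypothesis hS1 : (\int[theta]_z poweR (Dlip f z) p = S1%:E)%E.
Hypothesis hD1p : (\int[theta]_z poweR (D1 f z) p = D1p%:E)%E.

Local Notation Psi := (Psi A delta f (theta : meas R m)).
Local Notation step := (step f A delta).
Local Notation emp := (@empirical R d _).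

Let p0 : 0 < p. Proof. by have := alpha0; rewrite /p; lra. Qed.
Let p1 : 1 <= p. Proof. by have := alpha0; rewrite /p; lra. Qed.
Let pa : p - 1 = alpha. Proof. by rewrite /p; ring. Qed.
Let S10 : 0 <= S1.
Proof. by rewrite -lee_fin -hS1; apply: integral_ge0 => z _; exact: poweR_ge0. Qed.
Let D1p0 : 0 <= D1p.
Proof. by rewrite -lee_fin -hD1p; apply: integral_ge0 => z _; exact: poweR_ge0. Qed.

(* [drift_factor < 1] is exactly the hypothesis [delta^(1+alpha) < a(alpha)]. *)
Definition drift_factor : R := 4 `^ alpha * (a `^ p + 2 * (delta `^ p * S1)).
Definition drift_const : R := 4 `^ alpha * (delta `^ p * D1p).

Let lam0 : 0 <= drift_factor.
Proof. by rewrite !mulr_ge0 ?addr_ge0 ?mulr_ge0 ?powR_ge0. Qed.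
Let B0 : 0 <= drift_const.
Proof. by rewrite !mulr_ge0 ?powR_ge0. Qed.

Let four : 4 `^ alpha = 2 `^ alpha * 2 `^ alpha :> R.
Proof. by rewrite -powRM//; congr (_ `^ _); ring. Qed.

Lemma measurable_enorm_pow dd (T : measurableType dd) (h : T -> Rd R d) :
  measurable_fun setT h -> measurable_fun setT (fun w => (enorm (h w : 'cV[R]_d) `^ p)%:E).
Proof.
move=> mh; apply/measurable_EFinP.
apply: (measurableT_comp (f := fun b : R => b `^ p) (g := fun w => enorm (h w : 'cV[R]_d))) => //.
exact: measurable_enorm.
Qed.

(** f is compared with its value at the origin and the Dirac mass there. Drift, f at the origin, own
    position and empirical mean each pass through two midpoint convexity bounds costing 2^alpha:
    this is the 4^alpha in a(alpha). *)
Lemma step_moment (N : nat) (x : 'I_N -> Rd R d) (i : 'I_N) : (0 < N)%N ->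
  (\int[theta]_z (enorm (step (x i) (emp x) z : 'cV[R]_d) `^ p)%:E <=
   (4 `^ alpha * (a `^ p * enorm (x i : 'cV[R]_d) `^ p + delta `^ p * S1 *
     (enorm (x i : 'cV[R]_d) `^ p + N%:R^-1 * \sum_(j < N) enorm (x j : 'cV[R]_d) `^ p)) +
    drift_const)%:E)%E.
Proof.
move=> N0.
pose y0 : Rd R d := (0 : 'cV[R]_d).
pose d0 : meas R d := @dirac _ (Rd R d) y0 R.
have P1d : P1 d0 by exact: P1_dirac.
have P1e : P1 (emp x) by exact: P1_empirical.
pose u := enorm (x i : 'cV[R]_d); have u0 : 0 <= u by exact: enorm_ge0.
pose av := N%:R^-1 * \sum_(j < N) enorm (x j : 'cV[R]_d).
have av0 : 0 <= av by rewrite mulr_ge0 ?invr_ge0// sumr_ge0// => j _; exact: enorm_ge0.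
pose avp := N%:R^-1 * \sum_(j < N) enorm (x j : 'cV[R]_d) `^ p.
have avav : av `^ p <= avp by apply: powR_mean => // j; exact: enorm_ge0.
pose c z := enorm (f y0 d0 z : 'cV[R]_d).
pose D z := enorm ((f (x i) (emp x) z : 'cV[R]_d) - f y0 d0 z).
have c0 z : 0 <= c z by exact: enorm_ge0.
have D0 z : 0 <= D z by exact: enorm_ge0.
have mc : measurable_fun setT (fun z => (c z `^ p)%:E).
  by apply: measurable_enorm_pow; exact: measurable_f_cst.
have mD : measurable_fun setT (fun z => (D z `^ p)%:E).
  by apply: measurable_enorm_pow; apply: measurable_RdB; exact: measurable_f_cst.
have hD : (\int[theta]_z (D z `^ p)%:E <= (S1 * (u + av) `^ p)%:E)%E.
  apply: (lipschitz_integral hf) => //; first by rewrite addr_ge0.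
  by rewrite subr0 EFinD leeD2l//; exact: W1_empirical_dirac.
have hc : (\int[theta]_z (c z `^ p)%:E = D1p%:E)%E.
  by rewrite -hD1p; apply: eq_integral => z _; rewrite /D1 poweR_EFin.
have pw z : enorm (step (x i) (emp x) z : 'cV[R]_d) `^ p <=
    4 `^ alpha * (a `^ p * u `^ p) + 4 `^ alpha * delta `^ p * c z `^ p +
    2 `^ alpha * delta `^ p * D z `^ p.
  apply: (@le_trans _ _ (((a * u + delta * c z) + delta * D z) `^ p)).
    apply: powR_le; [exact: ltW|exact: enorm_ge0|].
    rewrite /step; apply: le_trans (enormD _ _) _.
    rewrite enormZ ger0_norm// -(addrA (a * u)); apply: lerD; first exact: hA.
    rewrite -mulrDr ler_wpM2l//.
    by have := enormD (f y0 d0 z : 'cV[R]_d) ((f (x i) (emp x) z : 'cV[R]_d) - f y0 d0 z); rewrite addrC subrK.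
  have au0 : 0 <= a * u by rewrite mulr_ge0// ltW.
  have dc0 : 0 <= delta * c z by rewrite mulr_ge0.
  have dD0 : 0 <= delta * D z by rewrite mulr_ge0.
  apply: le_trans (powR_mean2 p1 (addr_ge0 au0 dc0) dD0) _.
  have h2 := powR_mean2 p1 au0 dc0; rewrite pa in h2 *.
  have := ler_wpM2l (powR_ge0 2 alpha) h2.
  rewrite four (powRM p (ltW a0) u0) (powRM p delta0 (c0 z)) (powRM p delta0 (D0 z)) mulrDr => h.
  rewrite [X in X <= _]mulrDr; apply: le_trans (lerD h (lexx _)) _.
  by rewrite le_eqVlt; apply/orP; left; apply/eqP; ring.
apply: (@le_trans _ _ (\int[theta]_z ((4 `^ alpha * (a `^ p * u `^ p))%:E +
    (4 `^ alpha * delta `^ p)%:E * (c z `^ p)%:E + (2 `^ alpha * delta `^ p)%:E * (D z `^ p)%:E))%E).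
  apply: le_integral_nm => z; first by rewrite lee_fin powR_ge0.
  by rewrite -!EFinM -!EFinD lee_fin.
have k1 : 0 <= 4 `^ alpha * (a `^ p * u `^ p) by rewrite !mulr_ge0 ?powR_ge0.
have k2 : 0 <= 4 `^ alpha * delta `^ p by rewrite mulr_ge0 ?powR_ge0.
have k3 : 0 <= 2 `^ alpha * delta `^ p by rewrite mulr_ge0 ?powR_ge0.
have cp z : (0 <= (c z `^ p)%:E)%E by rewrite lee_fin powR_ge0.
have Dp z : (0 <= (D z `^ p)%:E)%E by rewrite lee_fin powR_ge0.
rewrite (integral_affine2 theta k1 k2 k3 mc mD cp Dp) hc.
have e3 := lee_wpmul2l (x := (2 `^ alpha * delta `^ p)%:E) k3 hD.
apply: le_trans (leeD (lexx _) e3) _.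
rewrite -!EFinM -!EFinD lee_fin -/u -/avp.
have h : (u + av) `^ p <= 2 `^ alpha * (u `^ p + avp).
  rewrite -pa; apply: le_trans (powR_mean2 p1 u0 av0) _.
  by rewrite ler_wpM2l ?powR_ge0// lerD2l.
have k4 : 0 <= 2 `^ alpha * delta `^ p * S1 by rewrite mulr_ge0.
have := ler_wpM2l k4 h; rewrite /drift_const four => h'.
set K1 := 2 `^ alpha * 2 `^ alpha * (a `^ p * u `^ p) + 2 `^ alpha * 2 `^ alpha * delta `^ p * D1p.
apply: (@le_trans _ _ (K1 + 2 `^ alpha * delta `^ p * S1 * (u + av) `^ p)).
  by rewrite lerD2l -!mulrA.
apply: le_trans (lerD (lexx K1) h') _.
by rewrite le_eqVlt; apply/orP; left; apply/eqP; rewrite /K1; ring.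
Qed.

(** Summed over i, the interaction average reproduces the sum of the p-th powers and adds to the
    term of the particle itself; hence the 2 in [drift_factor]. *)
Lemma sum_step_moment (N : nat) (x : 'I_N -> Rd R d) : (0 < N)%N ->
  (\sum_(i < N) \int[theta]_z (enorm (step (x i) (emp x) z : 'cV[R]_d) `^ p)%:E <=
   (drift_factor * \sum_(i < N) enorm (x i : 'cV[R]_d) `^ p + N%:R * drift_const)%:E)%E.
Proof.
move=> N0; apply: (le_trans (lee_sum _ (fun i _ => step_moment x i N0))).
rewrite sumEFin lee_fin big_split/= [X in _ + X <= _]sumr_const card_ord.
rewrite -[X in _ + X <= _]mulr_natl.
rewrite lerD2r.
rewrite -mulr_sumr.
rewrite /drift_factor -mulrA ler_wpM2l ?powR_ge0// big_split/= -mulr_sumr -mulr_sumr big_split/=.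
set Sx := \sum_(i < N) _.
have -> : \sum_(i < N) N%:R^-1 * Sx = Sx.
  by rewrite sumr_const card_ord -[LHS]mulr_natl mulrA divff ?mul1r// pnatr_eq0 -lt0n.
by rewrite le_eqVlt; apply/orP; left; apply/eqP; ring.
Qed.

(** A conditional expectation given the configuration, written as an explicit integral over the
    noise; [cond_cell] does the same for cell masses. *)
Definition cond_tail (T : Type) (N M : nat) (s : T -> R) (X : 'I_N -> T -> Rd R d) (w : T) : R := N%:R^-1 * \sum_(i < N)
  fine (\int[theta]_z (tail (M%:R * s w) (step (X i w) (emp (fun j => X j w)) z))%:E)%E.

Definition cond_cell (T : Type) (N M : nat) (s : T -> R) (X : 'I_N -> T -> Rd R d) (w : T) (c : grid d M) : R := N%:R^-1 * \sum_(i < N)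
  fine (theta [set z | grid_cell M (s w) (step (X i w) (emp (fun j => X j w)) z) = c]).

Section configuration.
Context dd (T : measurableType dd) (N M : nat) (s : T -> R) (X : 'I_N -> T -> Rd R d).
Hypotheses (N0 : (0 < N)%N) (s0 : forall w, 0 < s w) (ms : measurable_fun setT s).
Hypothesis mX : forall i, measurable_fun setT (X i).

Let mst i : measurable_fun setT
  (fun q : T * Rd R m => step (X i q.1) (emp (fun j => X j q.1)) q.2).
Proof.
apply: (measurable_step_empirical hf _ _ (X := fun q : T * Rd R m => X i q.1) (Y := fun j q => X j q.1)) => //.
- exact: (measurableT_comp (mX i) measurable_fst).
- by move=> j; exact: (measurableT_comp (mX j) measurable_fst).
Qed.

Let ms1 : measurable_fun setT (fun q : T * Rd R m => s q.1).
Proof. exact: (measurableT_comp ms measurable_fst). Qed.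

Lemma measurable_cond_tail : measurable_fun setT (cond_tail M s X).
Proof.
apply: measurable_funM => //; apply: measurable_sum => i.
apply: (measurableT_comp (f := fine)) => //.
apply: (@measurable_fun_fubini_tonelli_F _ _ _ _ _ theta (fun q : T * Rd R m =>
  (tail (M%:R * s q.1) (step (X i q.1) (emp (fun j => X j q.1)) q.2))%:E)).
- apply/measurable_EFinP; apply: (measurable_tail (r := fun q : T * Rd R m => M%:R * s q.1)) => //.
  exact: measurable_funM.
- by move=> q; rewrite lee_fin tail_ge0.
Qed.

Lemma measurable_cond_cell c : measurable_fun setT (cond_cell (M := M) s X ^~ c).
Proof.
apply: measurable_funM => //; apply: measurable_sum => i.
apply: (measurableT_comp (f := fine)) => //.
have mg := measurable_grid_cell c (s := fun q : T * Rd R m => s q.1) (fun q => s0 q.1) ms1 (mst i).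
have := measurable_fun_xsection theta mg; congr (measurable_fun _ _).
apply/funext => w; congr (theta _).
by apply/seteqP; split => z; rewrite /xsection /= inE.
Qed.
End configuration.

Lemma measurable_cell_error dd (T : measurableType dd) (N M : nat) (s tm : T -> R)
    (y : 'I_N -> T -> Rd R d) (q : T -> grid d M -> R) :
  (forall w, 0 < s w) -> measurable_fun setT s -> measurable_fun setT tm ->
  (forall i, measurable_fun setT (y i)) -> (forall c, measurable_fun setT (q ^~ c)) ->
  measurable_fun setT (fun w => cell_error (s w) (fun i => y i w) (tm w) (q w)).
Proof.
move=> s0 ms mtm my mq; rewrite /cell_error.
apply: measurable_funD.
  apply: measurable_funD => //; apply: measurable_funD; first exact: measurable_funM.
  apply: measurable_funM => //; apply: measurable_sum => i.
  by apply: measurable_tail => //; exact: measurable_funM.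
apply: measurable_funM; first exact: measurable_funM.
apply: measurable_sum => c; apply: measurableT_comp => //; apply: measurable_funB => //.
apply: measurable_funM => //; apply: measurable_sum => i.
have mc := measurable_grid_cell c s0 ms (my i).
rewrite (_ : (fun _ => _) = \1_[set w | grid_cell M (s w) (y i w) = c]); first exact: measurable_indic.
apply/funext => w; rewrite indicE; congr (_%:R); congr nat_of_bool.
by apply/eqP/idP => [e|]; [rewrite inE|rewrite inE].
Qed.

Lemma cell_error_ge0 (N M : nat) (s tm : R) (y : 'I_N -> Rd R d) (q : grid d M -> R) :
  0 <= s -> 0 <= tm -> 0 <= cell_error s y tm q.
Proof.
move=> s0 tm0; rewrite /cell_error !addr_ge0 ?mulr_ge0 ?invr_ge0 ?sumr_ge0// => i _.
exact: tail_ge0.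
Qed.

Variable sigma : R.
Hypothesis hsigma : (\int[theta]_z poweR (Dlip f z) 1 = sigma%:E)%E.
Context dd (T : measurableType dd) (P : probability T R).
Variables (GA : set (set T)) (N M : nat) (x : R).
Variables (X : 'I_N -> T -> Rd R d) (e : 'I_N -> T -> Rd R m).
Hypotheses (mGA : GA `<=` measurable) (IGA : setI_closed GA) (TGA : GA setT).
Hypothesis mX : forall i, measurable_fun setT (X i : g_sigma_algebraType GA -> Rd R d).
Hypothesis me : forall i, measurable_fun setT (e i).
Hypothesis indep_e : forall G (C : 'I_N -> set (Rd R m)), GA G -> (forall i, measurable (C i)) ->
  P (G `&` \bigcap_(i in [set: 'I_N]) (e i @^-1` C i)) = (P G * \prod_(i < N) theta (C i))%E.
Hypotheses (N0 : (0 < N)%N) (x1 : 1 <= x) (xN : x ^+ (d + 2) = N%:R).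
Hypotheses (xM : x <= M%:R) (Mx : M%:R <= 2 * x).

Definition innovation_sets : set (set T) := [set G | exists C : 'I_N -> set (Rd R m),
  (forall i, measurable (C i)) /\ G = \bigcap_(i in [set: 'I_N]) (e i @^-1` C i)].

Let mGB : innovation_sets `<=` measurable.
Proof.
move=> _ [C [mC ->]]; apply: fin_bigcap_measurable => // i _.
by rewrite -[X in measurable X]setTI; exact: me.
Qed.

Let IGB : setI_closed innovation_sets.
Proof.
move=> _ _ [C [mC ->]] [C' [mC' ->]]; exists (fun i => C i `&` C' i); split.
  by move=> i; exact: measurableI.
by rewrite -bigcapI; apply: eq_bigcapr.
Qed.

Let TGB : innovation_sets setT.
Proof. by exists (fun=> setT); split => //; apply/esym/seteqP; split. Qed.

Let P_innovation (C : 'I_N -> set (Rd R m)) : (forall i, measurable (C i)) ->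
  P (\bigcap_(i in [set: 'I_N]) (e i @^-1` C i)) = (\prod_(i < N) theta (C i))%E.
Proof. by move=> mC; rewrite -[X in P X]setTI indep_e// probability_setT mul1e. Qed.

Let indepAB G H : GA G -> innovation_sets H -> P (G `&` H) = (P G * P H)%E.
Proof. by move=> GG [C [mC ->]]; rewrite indep_e// P_innovation. Qed.

Let law_e i (C : set (Rd R m)) : measurable C -> P (e i @^-1` C) = theta C.
Proof.
move=> mC; pose C' j := if j == i then C else setT.
have mC' j : measurable (C' j) by rewrite /C'; case: ifP.
have := P_innovation mC'; rewrite (bigD1 i)//= big1 ?mule1 => [|j ji]; last first.
  by rewrite /C' (negPf ji) probability_setT.
rewrite /C' eqxx => <-; congr (P _); apply/seteqP; split => [w h j _ /=|w /(_ i I)]; last by rewrite /= eqxx.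
by case: eqP => // ->.
Qed.

Let integral_e i (h : Rd R m -> \bar R) : measurable_fun setT h -> (forall z, 0 <= h z)%E ->
  (\int[P]_v h (e i v) = \int[theta]_z h z)%E.
Proof.
move=> mh h0; have [Q [QE QI]] := pushforward_probability P (me i).
by rewrite -QI//; apply: eq_set_integral => C mC; rewrite QE law_e.
Qed.

Let X_ w := fun j => X j w.
(** The configuration is read at w and the noise at v, so that [decoupling_integral] can freeze w.
    The actual next particles are [zeta w i w]. *)
Let zeta w i (v : T) : Rd R d := step (X i w) (emp (X_ w)) (e i v).

(* The scale [rho w] of the grid depends on the configuration through its conditional moment bound. *)
Let rho w := (1 + drift_const + drift_factor * (N%:R^-1 * \sum_(i < N) enorm (X i w : 'cV[R]_d) `^ p)) `^ p^-1.
Let s w := rho w * x `^ (- (alpha / p)).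

Let avg0 w : 0 <= N%:R^-1 * \sum_(i < N) enorm (X i w : 'cV[R]_d) `^ p.
Proof. by rewrite mulr_ge0 ?invr_ge0// sumr_ge0// => i _; exact: powR_ge0. Qed.

Let rho0 w : 0 < rho w.
Proof. by rewrite powR_gt0// -addrA ltr_wpDr// addr_ge0// mulr_ge0. Qed.

Let x0 : 0 < x. Proof. exact: lt_le_trans ltr01 x1. Qed.

Let s0 w : 0 < s w.
Proof. by rewrite mulr_gt0// powR_gt0. Qed.

Let rhop w : rho w `^ p = 1 + drift_const +
  drift_factor * (N%:R^-1 * \sum_(i < N) enorm (X i w : 'cV[R]_d) `^ p).
Proof.
rewrite -powRrM mulVf ?gt_eqF// powRr1//.
by rewrite !addr_ge0// mulr_ge0.
Qed.

Let Err w : R :=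
  cell_error (s w) (fun i => zeta w i w) (cond_tail M s X w) (cond_cell (M := M) s X w).

Let P1e w : P1 (emp (X_ w)). Proof. exact: P1_empirical. Qed.

Let mzeta_z w i : measurable_fun setT (step (X i w) (emp (X_ w))).
Proof. by apply: (measurable_step_cst hf _ _ (X := fun=> X i w)) => //; exact: measurable_id. Qed.

Let mzeta w i : measurable_fun setT (zeta w i).
Proof. exact: (measurableT_comp (mzeta_z w i) (me i)). Qed.

Let mtail_z w i : measurable_fun setT (fun z => (tail (M%:R * s w) (step (X i w) (emp (X_ w)) z))%:E).
Proof.
apply/measurable_EFinP.
by apply: (measurable_tail (r := fun=> M%:R * s w)).
Qed.

Let tail_fin w i : (\int[theta]_z (tail (M%:R * s w) (step (X i w) (emp (X_ w)) z))%:E)%E \is a fin_num.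
Proof.
rewrite ge0_fin_numE; last by apply: integral_ge0 => z _; rewrite lee_fin tail_ge0.
apply: (@le_lt_trans _ _ (\int[theta]_z (1%:E + (enorm (step (X i w) (emp (X_ w)) z : 'cV[R]_d) `^ p)%:E))%E).
  apply: le_integral_nm => z; first by rewrite lee_fin tail_ge0.
  rewrite -EFinD lee_fin; apply: le_trans (tail_le _ _) _.
  exact: (le_one_plus_powR (enorm_ge0 _) p1).
rewrite ge0_integralD//; last 2 first.
- by move=> z _; rewrite lee_fin powR_ge0.
- exact: measurable_enorm_pow.
rewrite integral_cst_probability lte_add_pinfty ?ltry//.
exact: (le_lt_trans (step_moment (X_ w) i N0) (ltry _)).
Qed.

Let tail_mean w : (\int[Psi (emp (X_ w))]_u (tail (M%:R * s w) u)%:E = (cond_tail M s X w)%:E)%E.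
Proof.
have [Q [QE QI]] := Psi_probability hf theta A delta (P1e w).
have mt : measurable_fun setT (fun u : Rd R d => (tail (M%:R * s w) u)%:E).
  apply/measurable_EFinP.
  by apply: (measurable_tail (r := fun=> M%:R * s w)) => //; exact: measurable_id.
rewrite -(eq_set_integral _ _ QE) QI//; last by move=> u; rewrite lee_fin tail_ge0.
rewrite (empirical_mixture (X_ w) N0).2; last 2 first.
- apply: (@measurable_fun_fubini_tonelli_F _ _ _ _ _ theta (fun q : Rd R d * Rd R m =>
    (tail (M%:R * s w) (step q.1 (emp (X_ w)) q.2))%:E)).
    exact: (measurableT_comp mt (measurable_step hf A delta (P1e w))).
  by move=> q; rewrite lee_fin tail_ge0.
- by move=> y; apply: integral_ge0 => z _; rewrite lee_fin tail_ge0.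
rewrite /cond_tail mulr_sumr -sumEFin; apply: eq_bigr => i _.
by rewrite EFinM fineK.
Qed.

Let mcell_z w i c : measurable [set z | grid_cell M (s w) (step (X i w) (emp (X_ w)) z) = c].
Proof. by apply: (measurable_grid_cell c (s := fun=> s w)). Qed.

Let cell_mean w c : fine (Psi (emp (X_ w)) [set u | grid_cell M (s w) u = c]) = cond_cell s X w c.
Proof.
have mc : measurable [set u : Rd R d | grid_cell M (s w) u = c].
  by apply: (measurable_grid_cell c (s := fun=> s w)) => //; exact: measurable_id.
rewrite /Psi (empirical_mixture (X_ w) N0).2//; last exact: measurable_Psi_fun.
rewrite /cond_cell mulr_sumr -[RHS]/(fine (_%:E)) -sumEFin; congr fine; apply: eq_bigr => i _.
by rewrite EFinM fineK// fin_num_measure.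
Qed.

(** The intermediate law is Psi of the empirical measure, the average of the conditional laws of the
    particles; [tail_mean] and [cell_mean] express its tail and cell masses through the
    configuration, and [W1_Psi] handles the remaining distance. *)
Let Err_W1 w mu : P1 mu -> (W1 (emp (fun i => zeta w i w)) (Psi mu) <=
  (Err w)%:E + (a + 2 * delta * sigma)%:E * W1 (emp (X_ w)) mu)%E.
Proof.
move=> P1mu; have [Q [QE QI]] := Psi_probability hf theta A delta (P1e w).
have := W1_grid (fun i => zeta w i w) (Psi mu) N0 (s0 w) (is_prob_eq QE) _.
move=> /(_ M (cond_tail M s X w)); rewrite tail_mean => /(_ (lexx _)).
under [X in cell_error _ _ _ X]eq_fun do rewrite cell_mean.
move=> h; apply: le_trans h _; rewrite leeD2l//.
exact: (W1_Psi hf (ltW a0) hA delta0 hsigma (P1e w) P1mu a0).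
Qed.

Let mXT i : measurable_fun setT (X i).
Proof. exact: (measurableT_comp (mX i) (measurable_id_sigma mGA)). Qed.

Let meB i : measurable_fun setT (e i : g_sigma_algebraType innovation_sets -> Rd R m).
Proof.
move=> _ C mC; rewrite setTI; apply: sub_sigma_algebra.
exists (fun j => if j == i then C else setT); split; first by move=> j; case: ifP.
apply/seteqP; split => [w h j _ /=|w /(_ i I)]; last by rewrite /= eqxx.
by case: eqP => // ->.
Qed.

Let msA : measurable_fun setT (s : g_sigma_algebraType GA -> R).
Proof.
apply: measurable_funM => //.
apply: (measurableT_comp (f := fun b : R => b `^ p^-1)) => //.
apply: measurable_funD => //; apply: measurable_funM => //; apply: measurable_funM => //.
apply: measurable_sum => i; apply/measurable_EFinP; exact: measurable_enorm_pow.
Qed.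

Let past_future : measurableType _ :=
  (g_sigma_algebraType GA * g_sigma_algebraType innovation_sets)%type.

Let mzeta2 i : measurable_fun setT (fun q : past_future => zeta q.1 i q.2).
Proof.
apply: (measurable_step_empirical hf _ _ (X := fun q : past_future => X i q.1)
  (Y := fun j (q : past_future) => X j q.1) (z := fun q : past_future => e i q.2)) => //.
- exact: (measurableT_comp (mX i) measurable_fst).
- by move=> j; exact: (measurableT_comp (mX j) measurable_fst).
- exact: (measurableT_comp (meB i) measurable_snd).
Qed.

Let mErr2 : measurable_fun setT (fun q : past_future =>
  cell_error (s q.1) (fun i => zeta q.1 i q.2) (cond_tail M s X q.1) (cond_cell (M := M) s X q.1)).
Proof.
have h1 : measurable_fun setT (fun q : past_future => s q.1) := measurableT_comp msA measurable_fst.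
have h2 : measurable_fun setT (fun q : past_future => cond_tail M s X q.1).
  exact: (measurableT_comp (measurable_cond_tail M N0 msA mX) measurable_fst).
have h3 c : measurable_fun setT (fun q : past_future => cond_cell (M := M) s X q.1 c).
  have h := @measurable_cond_cell _ (g_sigma_algebraType GA) N M s X N0 s0 msA mX c.
  exact: (measurableT_comp h measurable_fst).
exact: (@measurable_cell_error _ past_future N M (fun q => s q.1) _ _ _ (fun q => s0 q.1) h1 h2 mzeta2 h3).
Qed.

Let mErr : measurable_fun setT Err.
Proof.
have mAB : measurable_fun setT (fun w : T => (w, w) : past_future).
  by apply: measurable_fun_pair; exact: measurable_id_sigma.
exact: (measurableT_comp mErr2 mAB).
Qed.

Let cond_tail0 w : 0 <= cond_tail M s X w.
Proof.
rewrite mulr_ge0 ?invr_ge0// sumr_ge0// => i _; rewrite fine_ge0//.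
by apply: integral_ge0 => z _; rewrite lee_fin tail_ge0.
Qed.

Let Err0 w : 0 <= Err w.
Proof. by apply: cell_error_ge0; [exact: ltW (s0 w)|exact: cond_tail0]. Qed.

Variable K : R.
Hypothesis hK : (\sum_(i < N) \int[P]_w (enorm (X i w : 'cV[R]_d) `^ p)%:E <= (N%:R * K)%:E)%E.

Let NR0 : 0 < N%:R :> R. Proof. by rewrite ltr0n. Qed.

Let moment_le w : (\sum_(i < N) \int[P]_v (enorm (zeta w i v : 'cV[R]_d) `^ p)%:E <=
  (drift_factor * \sum_(i < N) enorm (X i w : 'cV[R]_d) `^ p + N%:R * drift_const)%:E)%E.
Proof.
apply: le_trans (sum_step_moment (X_ w) N0); apply: lee_sum => i _.
rewrite (integral_e i (h := fun z => (enorm (step (X_ w i) (emp (X_ w)) z : 'cV[R]_d) `^ p)%:E))//.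
  by apply: measurable_enorm_pow; exact: mzeta_z.
by move=> z; rewrite lee_fin powR_ge0.
Qed.

Let integral_affine (b c : R) : 0 <= b -> 0 <= c ->
  (\int[P]_w (b + c * \sum_(i < N) enorm (X i w : 'cV[R]_d) `^ p)%:E <= (b + c * (N%:R * K))%:E)%E.
Proof.
move=> b0 c0.
have mp i : measurable_fun setT (fun w => (enorm (X i w : 'cV[R]_d) `^ p)%:E).
  exact: measurable_enorm_pow.
have pp i w : (0 <= (enorm (X i w : 'cV[R]_d) `^ p)%:E)%E by rewrite lee_fin powR_ge0.
under eq_integral do rewrite EFinD EFinM -sumEFin.
rewrite ge0_integralD//; last 2 first.
- by move=> w _; rewrite mule_ge0// sume_ge0.
- by apply: emeasurable_funM => //; exact: emeasurable_sum.
rewrite integral_cst_probability ge0_integralZl//; last 2 first.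
- exact: emeasurable_sum.
- by move=> w _; exact: sume_ge0.
rewrite ge0_integral_sum//.
by rewrite EFinD leeD2l// EFinM lee_wpmul2l.
Qed.

Let moment_step : (\sum_(i < N) \int[P]_w (enorm (zeta w i w : 'cV[R]_d) `^ p)%:E <=
  (N%:R * (drift_factor * K + drift_const))%:E)%E.
Proof.
have mz i : measurable_fun setT (fun q : past_future => (enorm (zeta q.1 i q.2 : 'cV[R]_d) `^ p)%:E).
  exact: measurable_enorm_pow.
have mAB : measurable_fun setT (fun w : T => (w, w) : past_future).
  by apply: measurable_fun_pair; exact: measurable_id_sigma.
have z0 i w v : (0 <= (enorm (zeta w i v : 'cV[R]_d) `^ p)%:E)%E by rewrite lee_fin powR_ge0.
rewrite -ge0_integral_sum//; last by move=> i; exact: (measurableT_comp (mz i) mAB).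
rewrite (decoupling_integral mGA mGB IGA IGB TGA TGB indepAB (F := fun q : past_future =>
  (\sum_(i < N) (enorm (zeta q.1 i q.2 : 'cV[R]_d) `^ p)%:E)%E)); last 2 first.
- exact: emeasurable_sum.
- by move=> q; exact: sume_ge0.
apply: (@le_trans _ _ (\int[P]_w (N%:R * drift_const + drift_factor * \sum_(i < N) enorm (X i w : 'cV[R]_d) `^ p)%:E)%E).
  apply: le_integral_nm => w; first by apply: integral_ge0 => v _; exact: sume_ge0.
  rewrite ge0_integral_sum//; first by rewrite addrC; exact: moment_le.
  by move=> i; apply: measurable_enorm_pow; exact: mzeta.
apply: le_trans (integral_affine _ _) _ => //; first by rewrite mulr_ge0.
by rewrite lee_fin le_eqVlt; apply/orP; left; apply/eqP; ring.
Qed.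

(** With the configuration frozen, particle i is a function of its own noise only. *)
Let indep_zeta w (B : 'I_N -> set (Rd R d)) : (forall i, measurable (B i)) ->
  P (\bigcap_(i in [set: 'I_N]) (zeta w i @^-1` B i)) = (\prod_(i < N) P (zeta w i @^-1` B i))%E.
Proof.
move=> mB; have mC i : measurable (step (X i w) (emp (X_ w)) @^-1` B i).
  by rewrite -[X in measurable X]setTI; exact: mzeta_z.
rewrite (P_innovation mC); apply: eq_bigr => i _.
by rewrite -(law_e i (mC i)).
Qed.

Let frozen w : (\int[P]_v (cell_error (s w) (fun i => zeta w i v) (cond_tail M s X w)
    (cond_cell (M := M) s X w) `^ p)%:E <=
  (sampling_const d alpha * (rho w `^ p * x `^ (- alpha)))%:E)%E.
Proof.
have := integral_cell_error alpha0 (mzeta w) (indep_zeta w) N0 (rho0 w) x1 xN xM Mx.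
rewrite -/p -/(s w).
have -> : N%:R^-1 * (\sum_(i < N) fine (\int[P]_v (tail (M%:R * s w) (zeta w i v))%:E)%E) = cond_tail M s X w.
  congr (_ * _); apply: eq_bigr => i _; congr fine.
  rewrite (integral_e i (h := fun z => (tail (M%:R * s w) (step (X_ w i) (emp (X_ w)) z))%:E)).
  - by [].
  - exact: mtail_z.
  - by move=> z; rewrite lee_fin tail_ge0.
have -> : (fun c : grid d M => N%:R^-1 * \sum_(i < N) cell_prob P (zeta w) (grid_cell M (s w)) i c) =
    cond_cell s X w.
  apply/funext => c; congr (_ * _); apply: eq_bigr => i _; congr fine.
  rewrite -(law_e i (C := [set z | grid_cell M (s w) (step (X i w) (emp (X_ w)) z) = c]))//.
(* N rho^p exceeds the conditional moment bound by exactly N: the summand 1 in rho^p keeps rho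
   positive. *)
apply; apply: le_trans (moment_le w) _; rewrite lee_fin rhop.
rewrite [X in _ <= X](_ : _ = drift_factor * (\sum_(i < N) enorm (X i w : 'cV[R]_d) `^ p) +
  N%:R * drift_const + N%:R); first by rewrite lerDl.
by field; rewrite gt_eqF.
Qed.

Lemma sampling_const_ge0 : 0 <= sampling_const d alpha.
Proof.
rewrite /sampling_const /rosenthal_const !mulr_ge0 ?addr_ge0 ?mulr_ge0 ?powR_ge0 ?expR_ge0//.
Qed.

Let integral_Err : (\int[P]_w (Err w `^ p)%:E <=
  (sampling_const d alpha * (1 + drift_const + drift_factor * K) * x `^ (- alpha))%:E)%E.
Proof.
rewrite (decoupling_integral mGA mGB IGA IGB TGA TGB indepAB (F := fun q : past_future =>
  (cell_error (s q.1) (fun i => zeta q.1 i q.2) (cond_tail M s X q.1) (cond_cell (M := M) s X q.1) `^ p)%:E)); last 2 first.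
- apply/measurable_EFinP.
  by apply: (measurableT_comp (f := fun b : R => b `^ p) _ mErr2).
- by move=> q; rewrite lee_fin powR_ge0.
set C := sampling_const d alpha; have C0 : 0 <= C by exact: sampling_const_ge0.
set y := x `^ (- alpha); have y0 : 0 <= y by exact: powR_ge0.
apply: (@le_trans _ _ (\int[P]_w (C * y * (1 + drift_const) + (C * y * drift_factor / N%:R) * \sum_(i < N) enorm (X i w : 'cV[R]_d) `^ p)%:E)%E).
  apply: le_integral_nm => w; first by apply: integral_ge0 => v _; rewrite lee_fin powR_ge0.
  apply: le_trans (frozen w) _; rewrite lee_fin rhop -/C -/y.
  by rewrite le_eqVlt; apply/orP; left; apply/eqP; ring.
apply: le_trans (integral_affine _ _) _.
- by apply: mulr_ge0; [exact: mulr_ge0|exact: addr_ge0].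
- by apply: mulr_ge0; [do 2!apply: mulr_ge0 => //|rewrite invr_ge0].
rewrite lee_fin le_eqVlt; apply/orP; left; apply/eqP; field.
by rewrite gt_eqF.
Qed.

(** Grid, frozen configuration and pi-systems stay hidden: what follows uses only a pointwise
    recursion, an L^p bound on the error and the propagation of the moment bound. *)
Lemma one_step : exists E : T -> R, [/\ measurable_fun setT E, forall w, 0 <= E w,
  (forall w mu, P1 mu -> (W1 (emp (fun i => step (X i w) (emp (fun j => X j w)) (e i w))) (Psi mu) <=
     (E w)%:E + (a + 2 * delta * sigma)%:E * W1 (emp (fun j => X j w)) mu)%E),
  (\int[P]_w (E w `^ p)%:E <=
     (sampling_const d alpha * (1 + drift_const + drift_factor * K) * x `^ (- alpha))%:E)%E &
  (\sum_(i < N) \int[P]_w (enorm (step (X i w) (emp (fun j => X j w)) (e i w) : 'cV[R]_d) `^ p)%:E <=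
    (N%:R * (drift_factor * K + drift_const))%:E)%E].
Proof. exists Err; split.
- exact: mErr.
- exact: Err0.
- exact: Err_W1.
- exact: integral_Err.
- exact: moment_step. Qed.
End one_step.

(** * Tail recursion and independence of the past *)

Section tail_recursion.
Context dd (T : measurableType dd) (R : realType) (P : probability T R).
Variables (W : nat -> T -> \bar R) (E : nat -> T -> R) (q eta p L : R).
Hypothesis mW : forall n (e : R), measurable [set w | (e%:E < W n w)%E].
Hypothesis W0 : forall n w, (0 <= W n w)%E.
Hypothesis mE : forall n, measurable_fun setT (E n).
Hypothesis E0 : forall n w, 0 <= E n w.
Hypothesis WE : forall n w, (W n.+1 w <= (E n w)%:E + q%:E * W n w)%E.
Hypothesis EL : forall n, (\int[P]_w (E n w `^ p)%:E <= L%:E)%E.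
Hypotheses (q0 : 0 < q) (eta0 : 0 < eta) (qeta : q < 1 - eta) (p0 : 0 < p).

Let mEc n (c : R) : measurable [set w | c < E n w].
Proof.
rewrite -[X in measurable X]setTI.
exact: (measurable_fun_ltr (measurable_cst c) (mE n) measurableT (Y := [set true])).
Qed.

Lemma markov_powR n (c : R) : 0 < c -> (P [set w | (c < E n w)%R] <= (L * c `^ (- p))%:E)%E.
Proof.
move=> c0; have cp : 0 < c `^ p by rewrite powR_gt0.
suff h : ((c `^ p)%:E * P [set w | (c < E n w)%R] <= L%:E)%E.
  have := lee_wpmul2l (x := ((c `^ p)^-1)%:E) _ h.
  rewrite muleA -!EFinM mulVf ?gt_eqF// mul1e powRN mulrC; apply.
  by rewrite lee_fin invr_ge0 ltW.
apply: le_trans (EL n).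
have -> : P [set w | (c < E n w)%R] = (\int[P]_w (\1_[set w | (c < E n w)%R] w)%:E)%E.
  by rewrite integral_indic// setIT.
rewrite -ge0_integralZl//; last 2 first.
- by apply/measurable_EFinP; exact: measurable_indic.
- by rewrite lee_fin ltW.
apply: le_integral_nm => w; first by rewrite -EFinM lee_fin mulr_ge0// ltW.
rewrite -EFinM lee_fin indicE; case: (boolP (w \in _)) => [|_]; last by rewrite mulr0 powR_ge0.
rewrite inE /= mulr1 => cE; apply: powR_le; exact: ltW.
Qed.

Let r : R := ((1 - eta) / q) `^ (- p).

Let ratio1 : 1 < (1 - eta) / q. Proof. by rewrite ltr_pdivlMr// mul1r. Qed.

Let r1 : r < 1. Proof. exact: powRN_lt1. Qed.

Lemma tail_recursion n (e : R) : 0 < e ->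
  (P [set w | (e%:E < W n w)%E] <= P [set w | ((((1 - eta) / q) ^+ n * e)%:E < W 0%N w)%E] +
    (L * eta `^ (- p) / (1 - r) * e `^ (- p))%:E)%E.
Proof.
have L0 : 0 <= L.
  by rewrite -lee_fin; apply: le_trans (EL 0); apply: integral_ge0 => w _; rewrite lee_fin powR_ge0.
have r1' : 0 < 1 - r by have := r1; lra.
elim: n e => [|n IH] e e0.
  rewrite expr0 mul1r leeDl// lee_fin !mulr_ge0 ?powR_ge0 ?invr_ge0// ltW//.
pose t := (1 - eta) / q; have t0 : 0 < t by exact: lt_trans ltr01 ratio1.
(* Since q t = 1 - eta, an error of at most eta e and a previous distance of at most t e add up to
   at most e. *)
have sub : [set w | (e%:E < W n.+1 w)%E] `<=`
    [set w | eta * e < E n w] `|` [set w | ((t * e)%:E < W n w)%E].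
  move=> w /= ew; have [|Ew] := ltP (eta * e) (E n w); first by left.
  right; rewrite ltNge; apply/negP => Ww.
  have := lt_le_trans ew (WE n w); apply/negP; rewrite -leNgt.
  have qW := lee_wpmul2l (x := q%:E) (ltW q0) Ww.
  apply: (@le_trans _ _ ((eta * e)%:E + q%:E * (t * e)%:E)%E); first by rewrite leeD ?lee_fin.
  rewrite -EFinM -EFinD lee_fin le_eqVlt; apply/orP; left; apply/eqP.
  by rewrite /t; field; exact: lt0r_neq0.
apply: (@le_trans _ _ (P [set w | (eta * e < E n w)%R] + P [set w | ((t * e)%:E < W n w)%E])%E).
  apply: le_trans (measureU2 _ _ _) => //.
  apply: le_measure; rewrite ?inE//.
  exact: measurableU.
have te0 : 0 < t * e by rewrite mulr_gt0.
apply: le_trans (leeD (markov_powR n (mulr_gt0 eta0 e0)) (IH _ te0)) _.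
rewrite addeCA exprSr -/t mulrA; apply: leeD; first exact: lexx.
(* Passing from e to t e multiplies e^(-p) by r, and 1 / (1 - r) is the fixed point of c -> 1 + r c;
   the constant is reproduced exactly. *)
rewrite -EFinD lee_fin (powRM _ (ltW eta0) (ltW e0)) (powRM _ (ltW t0) (ltW e0)) -/r.
rewrite le_eqVlt; apply/orP; left; apply/eqP; field.
exact: lt0r_neq0.
Qed.
End tail_recursion.

(** * Independence of the new noises from the past *)

Section past.
Variables (R : realType) (d m : nat).
Context dO (Omega : measurableType dO) (P : probability Omega R).
Variables (theta : probability (Rd R m) R).
Variables (X0 : forall N : nat, 'I_N -> Omega -> Rd R d) (eps : nat -> nat -> Omega -> Rd R m).
Hypothesis mX0 : forall N (i : 'I_N), measurable_fun setT (X0 i).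
Hypothesis meps : forall n i, measurable_fun setT (eps n i).
Hypothesis iid : iid_indep P (theta : meas R m) X0 eps.
Variables N n : nat.

Definition past_index : seq (nat * nat) := [seq (j, i) | j <- iota 0 n, i <- iota 0 N].

Definition past_event (B : 'I_N -> set (Rd R d)) (C : nat * nat -> set (Rd R m)) : set Omega :=
  \bigcap_(i in [set: 'I_N]) (X0 i @^-1` B i) `&` \bigcap_(k in [set` past_index]) (eps k.1 k.2 @^-1` C k).

(** Rectangles are the events for which [iid_indep] gives product formulas, and they are stable
    under intersection, as the decoupling requires. *)
Definition past_sets : set (set Omega) := [set G | exists B C,
  [/\ forall i, measurable (B i), forall k, measurable (C k) & G = past_event B C]].

Lemma past_indexE k : (k \in past_index) = (k.1 < n)%N && (k.2 < N)%N.
Proof.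
apply/allpairsP/andP => [[[j i] /= [+ + ->]]|[jn iN]]; first by rewrite !mem_iota.
by exists k => /=; rewrite !mem_iota; split => //; case: k {jn iN}.
Qed.

Lemma past_index_uniq : uniq past_index.
Proof. by apply: allpairs_uniq; rewrite ?iota_uniq// => -[? ?] [? ?]. Qed.

Lemma measurable_past_sets : past_sets `<=` measurable.
Proof.
move=> _ [B [C [mB mC ->]]]; apply: measurableI.
  apply: fin_bigcap_measurable => // i _.
  by rewrite -[X in measurable X]setTI; exact: mX0.
apply: fin_bigcap_measurable => [|k _]; first exact: finite_seq.
by rewrite -[X in measurable X]setTI; exact: meps.
Qed.

Lemma setI_closed_past_sets : setI_closed past_sets.
Proof.
move=> _ _ [B [C [mB mC ->]]] [B' [C' [mB' mC' ->]]].
exists (fun i => B i `&` B' i), (fun k => C k `&` C' k); split.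
- by move=> i; exact: measurableI.
- by move=> k; exact: measurableI.
rewrite /past_event setIACA -!bigcapI.
by congr (_ `&` _).
Qed.

Lemma past_sets_setT : past_sets setT.
Proof.
exists (fun=> setT), (fun=> setT); split => //.
by apply/esym/seteqP; split.
Qed.

Lemma measurable_X0_past (i : 'I_N) : measurable_fun setT (X0 i : g_sigma_algebraType past_sets -> Rd R d).
Proof.
move=> _ B mB; rewrite setTI; apply: sub_sigma_algebra.
exists (fun j => if j == i then B else setT), (fun=> setT); split => //; first by move=> j; case: ifP.
apply/seteqP; split => [w h|w [/(_ i I)]]; last by rewrite /= eqxx.
by split => [j _ /=|//]; case: eqP => // ->.
Qed.

Lemma measurable_eps_past j i : (j < n)%N -> (i < N)%N ->
  measurable_fun setT (eps j i : g_sigma_algebraType past_sets -> Rd R m).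
Proof.
move=> jn iN _ C mC; rewrite setTI; apply: sub_sigma_algebra.
exists (fun=> setT), (fun k => if k == (j, i) then C else setT); split => //; first by move=> k; case: ifP.
apply/seteqP; split => [w h|w [_ /(_ (j, i))]].
  by split => [//|k _ /=]; case: eqP => // ->.
by rewrite /= eqxx; apply; rewrite past_indexE/= jn.
Qed.

(** [iid] is applied twice, to the past indices followed by the row (n, i), i < N, and to the past
    indices alone; substituting the second formula into the first isolates the factor P G. *)
Lemma indep_past G (C : 'I_N -> set (Rd R m)) : past_sets G -> (forall i, measurable (C i)) ->
  P (G `&` \bigcap_(i in [set: 'I_N]) (eps n i @^-1` C i)) = (P G * \prod_(i < N) theta (C i))%E.
Proof.
move=> [B [C0 [mB mC0 ->]]] mC.
(* Noises are indexed by pairs of naturals: [Cn] is C on row n, with setT from column N on, and the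
   constraint of the past elsewhere. *)
pose Cn k := if k.1 == n then (if insub k.2 is Some i then C i else setT) else C0 k.
have mCn k : measurable (Cn k).
  by rewrite /Cn; case: ifP => // _; case: insub.
pose sn := [seq (n, i) | i <- iota 0 N].
have us : uniq (past_index ++ sn).
  rewrite cat_uniq past_index_uniq/= map_inj_uniq ?iota_uniq ?andbT; last by move=> ? ? [].
  by apply/hasPn => _ /mapP[i _ ->]; rewrite past_indexE/= ltnn.
have := iid mB us mCn; rewrite big_cat/=.
have -> : (\prod_(k <- past_index) theta (Cn k) = \prod_(k <- past_index) theta (C0 k))%E.
  rewrite big_seq [RHS]big_seq; apply: eq_bigr => k; rewrite past_indexE => /andP[kn _].
  by rewrite /Cn (ltn_eqF kn).
have -> : (\prod_(k <- sn) theta (Cn k) = \prod_(i < N) theta (C i))%E.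
  rewrite big_map (_ : iota 0 N = index_iota 0 N) ?big_mkord; last by rewrite /index_iota subn0.
  apply: eq_bigr => i _.
  by rewrite /Cn eqxx/= valK.
have := iid mB past_index_uniq mC0; rewrite -/(past_event B C0) muleA => <- <-.
congr (P _); rewrite /past_event -setIA; congr (_ `&` _).
apply/seteqP; split => [w [h1 h2] k /=|w h].
  rewrite mem_cat => /orP[ks|/mapP[i]].
    by move: (ks); rewrite past_indexE /Cn => /andP[kn _]; rewrite (ltn_eqF kn); exact: h1.
  rewrite mem_iota => /= iN ->; rewrite /Cn eqxx/= insubT.
  exact: (h2 (Sub i iN)).
split => [k /= ks|i _ /=].
  have := h k; rewrite /= mem_cat ks => /(_ isT).
  by move: (ks); rewrite past_indexE /Cn => /andP[kn _]; rewrite (ltn_eqF kn).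
have := h (n, i : nat); rewrite /= mem_cat map_f ?orbT ?mem_iota => [/(_ isT)|]; last exact: ltn_ord.
by rewrite /Cn eqxx/= valK.
Qed.
End past.

(** * The particle system *)

Section particle_system.
Variables (R : realType) (d m : nat).
Context dO (Omega : measurableType dO) (P : probability Omega R).
Variables (A : 'M[R]_d) (delta : R) (f : Rd R d -> meas R d -> Rd R m -> Rd R d).
Variables (theta : probability (Rd R m) R) (mu0 : probability (Rd R d) R).
Variables (X0 : forall N : nat, 'I_N -> Omega -> Rd R d) (eps : nat -> nat -> Omega -> Rd R m).
Variables (a alpha S1 D1p D1i sigma m0 : R).
Hypothesis hf : f_measurable f.
Hypothesis hmu0 : P1 (mu0 : meas R d).
Hypothesis mX0 : forall N (i : 'I_N), measurable_fun setT (X0 i).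
Hypothesis meps : forall n i, measurable_fun setT (eps n i).
Hypothesis X0law : forall N (i : 'I_N) (B : set (Rd R d)), measurable B ->
  P (X0 i @^-1` B) = mu0 B.
Hypothesis iid : iid_indep P (theta : meas R m) X0 eps.
Hypothesis a0 : 0 < a.
Hypothesis hA : forall x : 'cV[R]_d, enorm (A *m x) <= a * enorm x.
Hypothesis delta0 : 0 <= delta.
Hypothesis alpha0 : 0 < alpha.
Let p := 1 + alpha.
Hypothesis hS1 : (\int[theta]_z poweR (Dlip f z) p = S1%:E)%E.
Hypothesis hD1p : (\int[theta]_z poweR (D1 f z) p = D1p%:E)%E.
Hypothesis hD1 : (\int[theta]_z D1 f z = D1i%:E)%E.
Hypothesis hsigma : (\int[theta]_z poweR (Dlip f z) 1 = sigma%:E)%E.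
Hypothesis hm0 : (\int[mu0]_x ((enorm (x : 'cV[R]_d)) `^ p)%:E = m0%:E)%E.
Let lam := drift_factor delta a alpha S1.
Let B := drift_const delta alpha D1p.
Hypothesis lam1 : lam < 1.

Local Notation particles := (particles A delta f X0 eps).
Local Notation mu_nl := (mu_nl A delta f (theta : meas R m) (mu0 : meas R d)).

Lemma P1_mu_nl n : P1 (mu_nl n).
Proof.
elim: n => [//|n IH]; exact: (P1_Psi hf (ltW a0) hA delta0 hsigma hD1 IH).
Qed.

(** B / (1 - lam) is the fixed point of k -> lam k + B; the summand m0 covers the initial moment
    and, as lam < 1, preserves invariance. *)
Definition moment_bound : R := m0 + B / (1 - lam).
Let K := moment_bound.

Let lamK : lam * K + B <= K.
Proof.
have h : 0 < 1 - lam by have := lam1; lra.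
have m00 : 0 <= m0 by rewrite -lee_fin -hm0; apply: integral_ge0 => x _; rewrite lee_fin powR_ge0.
rewrite [X in X <= _](_ : _ = lam * m0 + B / (1 - lam)).
  by rewrite /K /moment_bound lerD2r ler_piMl// ltW// lam1.
by rewrite /K /moment_bound; field; exact: lt0r_neq0.
Qed.

Section fixed_size.
Variable N : nat.
Hypothesis N0 : (0 < N)%N.

Lemma measurable_particles_past n (i : 'I_N) :
  measurable_fun setT (particles N n i : g_sigma_algebraType (past_sets X0 eps N n) -> Rd R d).
Proof.
apply: (measurable_particles hf A delta (T := g_sigma_algebraType (past_sets X0 eps N n))) => //.
- by move=> j; exact: measurable_X0_past.
- by move=> j k jn; apply: measurable_eps_past.
Qed.

Lemma particle_step n :
  (\sum_(i < N) \int[P]_w (enorm (particles N n i w : 'cV[R]_d) `^ p)%:E <= (N%:R * K)%:E)%E ->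
  exists E : Omega -> R, [/\ measurable_fun setT E, forall w, 0 <= E w,
    (forall w, (W1 (empirical (fun i => particles N n.+1 i w)) (mu_nl n.+1) <=
       (E w)%:E + (a + 2 * delta * sigma)%:E * W1 (empirical (fun i => particles N n i w)) (mu_nl n))%E),
    (\int[P]_w (E w `^ p)%:E <=
       (sampling_const d alpha * (1 + B + lam * K) * N%:R `^ (- (alpha / (d + 2)%:R)))%:E)%E &
    (\sum_(i < N) \int[P]_w (enorm (particles N n.+1 i w : 'cV[R]_d) `^ p)%:E <=
      (N%:R * (lam * K + B))%:E)%E].
Proof.
(* The number of cubes is of order x^d = N^(d/(d+2)). M is the integer part of x plus 1, which lies
   between x and 2 x because x >= 1. *)
move=> hK; pose x : R := N%:R `^ ((d + 2)%:R^-1).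
have d2 : (d + 2)%:R != 0 :> R by rewrite pnatr_eq0 addn2.
have x1 : 1 <= x by apply: powR_ge1; rewrite ?invr_ge0// ler1n.
have xN : x ^+ (d + 2) = N%:R.
  by rewrite -powR_mulrn ?powR_ge0// -powRrM mulVf// powRr1.
have xtr := truncn_itv (le_trans ler01 x1).
have xM : x <= (Num.truncn x).+1%:R by have /andP[_ /ltW] := xtr.
have Mx : (Num.truncn x).+1%:R <= 2 * x.
  by have /andP[h _] := xtr; rewrite -natr1; have := x1; lra.
have [E [mE E0 EW EL EM]] := one_step hf a0 hA delta0 alpha0 hS1 hD1p hsigma
  (measurable_past_sets mX0 meps (n := n)) (@setI_closed_past_sets _ _ _ _ _ X0 eps N n)
  (past_sets_setT X0 eps N n) (@measurable_particles_past n) (fun i => meps n i)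
  (fun G C => indep_past iid (C := C)) N0 x1 xN xM Mx hK.
exists E; split => //.
- by move=> w; exact: (EW w _ (P1_mu_nl n)).
- apply: le_trans EL _; rewrite /x -powRrM mulrN.
  by rewrite -/p -/lam -/B mulrC [X in - X](mulrC _ alpha) mulrC.
Qed.

Lemma particle_moment n :
  (\sum_(i < N) \int[P]_w (enorm (particles N n i w : 'cV[R]_d) `^ p)%:E <= (N%:R * K)%:E)%E.
Proof.
elim: n => [|n IH]; last first.
  have [E [_ _ _ _ h]] := particle_step IH; apply: le_trans h _.
  by rewrite lee_fin ler_wpM2l.
rewrite (eq_bigr (fun=> m0%:E)) => [|i _]; last first.
  have [Q [QE QI]] := pushforward_probability P (mX0 i).
  rewrite -hm0 -(eq_set_integral (mu := Q)).
    rewrite QI//; last by move=> y; rewrite lee_fin powR_ge0.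
    by apply: measurable_enorm_pow; exact: measurable_id.
  by move=> C mC; rewrite QE X0law.
rewrite sumEFin sumr_const card_ord lee_fin -[X in X <= _]mulr_natl ler_wpM2l//.
rewrite /K /moment_bound lerDl divr_ge0//; last by have := lam1; lra.
by rewrite /B /drift_const !mulr_ge0 ?powR_ge0// -lee_fin -hD1p; apply: integral_ge0 => z _; exact: poweR_ge0.
Qed.

Lemma measurable_W1_particles n (e : R) :
  measurable [set w | (e%:E < W1 (empirical (fun i => particles N n i w)) (mu_nl n))%E].
Proof.
rewrite -[X in measurable X]setTI; apply: emeasurable_fun_o_infty => //.
apply: measurable_W1_empirical => // i.
exact: (measurable_particles hf A delta).
Qed.

Lemma particle_tail (eta : R) (n : nat) (e : R) : 0 < eta -> a + 2 * delta * sigma < 1 - eta -> 0 < e ->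
  (P [set w | (e%:E < W1 (empirical (fun i => particles N n i w)) (mu_nl n))%E] <=
   P [set w | ((((1 - eta) / (a + 2 * delta * sigma)) ^+ n * e)%:E <
      W1 (empirical (fun i => @X0 N i w)) (mu0 : meas R d))%E] +
   (sampling_const d alpha * (1 + B + lam * K) * N%:R `^ (- (alpha / (d + 2)%:R)) * eta `^ (- p) /
     (1 - ((1 - eta) / (a + 2 * delta * sigma)) `^ (- p)) * e `^ (- p))%:E)%E.
Proof.
move=> eta0 qeta e0.
have s0 : 0 <= sigma by rewrite -lee_fin -hsigma; apply: integral_ge0 => z _; exact: poweR_ge0.
have [E HE] := choice (fun n => particle_step (particle_moment n)).
apply: (tail_recursion (W := fun n w => W1 (empirical (fun i => particles N n i w)) (mu_nl n)) (E := E)) => //.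
- by move=> k e'; exact: measurable_W1_particles.
- by move=> k; have [] := HE k.
- by move=> k; have [] := HE k.
- by move=> k; have [_ _ _ + _] := HE k; exact.
- by rewrite ltr_wpDr// !mulr_ge0.
- by rewrite /p addr_gt0.
Qed.
End fixed_size.
End particle_system.

(** * Extended-real constants of the statement and the conclusion *)

Lemma Dlip_ge0 (R : realType) (d m : nat) (f : Rd R d -> meas R d -> Rd R m -> Rd R d) (z : Rd R m) :
  (0 < d)%N -> (0 <= Dlip f z)%E.
Proof.
(* The supremum of an empty family would be -oo; d > 0 supplies two distinct points and thus a
   nonnegative quotient. *)
move=> d0; pose x1 : Rd R d := (const_mx 1 : 'cV[R]_d); pose x2 : Rd R d := (0 : 'cV[R]_d).
have P1d := P1_dirac x2.
have ne : (x1, @dirac _ (Rd R d) x2 R : meas R d) <> (x2, @dirac _ (Rd R d) x2 R : meas R d).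
  move=> [/(congr1 (fun x : 'cV[R]_d => x (Ordinal d0) ord0))]; rewrite !mxE => /eqP.
  by rewrite oner_eq0.
pose u := enorm ((x1 : 'cV[R]_d) - x2) + fine (W1 (@dirac _ (Rd R d) x2 R) (@dirac _ (Rd R d) x2 R)) + 1.
have W0 := W1_ge0 (@dirac _ (Rd R d) x2 R : meas R d) (@dirac _ (Rd R d) x2 R).
have Wfin : W1 (@dirac _ (Rd R d) x2 R : meas R d) (@dirac _ (Rd R d) x2 R) \is a fin_num.
  by rewrite ge0_fin_numE//; apply: le_lt_trans (W1_dirac P1d.1) P1d.2.
have u0 : 0 < u by rewrite ltr_wpDl// addr_ge0 ?enorm_ge0 ?fine_ge0.
apply: le_trans (Dlip_ge f z P1d P1d ne u0 _).
  by rewrite lee_fin divr_ge0 ?enorm_ge0// ltW.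
by rewrite -(fineK Wfin) -EFinD lee_fin lerDl.
Qed.

(** When s = 0 the inverse is +oo and the hypothesis still forces c > 0; this covers the degenerate
    thresholds a0 and a(alpha) with sigma or sigma_1 equal to 0. *)
Lemma lt_inve_twice (R : realType) (s x c : R) : 0 <= s -> 0 < x ->
  (x%:E < c%:E * (2%:E * s%:E)^-1)%E -> 2 * s * x < c.
Proof.
move=> s0 x0; rewrite -EFinM inver; have [s2|s2] := eqVneq (2 * s) 0.
  rewrite s2 mul0r => h; rewrite ltNge; apply/negP => c0; move: h; apply/negP; rewrite -leNgt.
  apply: (@le_trans _ _ 0%E); last by rewrite lee_fin ltW.
  by rewrite mule_le0_ge0 ?leey// lee_fin.
have s20 : 0 < 2 * s by rewrite lt_neqAle eq_sym s2 mulr_ge0.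
by rewrite -EFinM lte_fin ltr_pdivlMr// mulrC.
Qed.

(* [eta] is the share of [e] given to the sampling error of the last step: the constant
   [2 sigma gamma0] of the statement, or any small number when [sigma = 0]. *)
Lemma splitting_fraction (R : realType) (a sigma delta gamma0 : R) :
  0 < a -> 0 <= sigma -> 0 < delta -> 0 < gamma0 -> 2 * sigma * (delta + gamma0) < 1 - a ->
  exists eta, [/\ 0 < eta, a + 2 * delta * sigma < 1 - eta &
    forall n, 2 * sigma * gamma0 * ((1 - 2 * sigma * gamma0) / (a + 2 * delta * sigma)) ^+ n <=
      ((1 - eta) / (a + 2 * delta * sigma)) ^+ n].
Proof.
move=> a0 s0 d0 g0; have [->|sN0] := eqVneq sigma 0.
  rewrite !(mulr0, mul0r, addr0) => a1; exists ((1 - a) / 2); split; [lra|lra|].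
  by move=> n; rewrite mul0r exprn_ge0// divr_ge0 ?(ltW a0)//; lra.
have sp : 0 < sigma by rewrite lt_neqAle eq_sym sN0.
have ds : 0 < delta * sigma by exact: mulr_gt0.
have gs : 0 < sigma * gamma0 by exact: mulr_gt0.
rewrite mulrDr => h; exists (2 * sigma * gamma0); split; [lra|lra|move=> n].
by rewrite ler_piMl// ?exprn_ge0 ?divr_ge0//; lra.
Qed.

Theorem theorem3p7
  (R : realType) (d m : nat) (hd : (0 < d)%N) (hm : (0 < m)%N)
  (dO : measure_display) (Omega : measurableType dO) (P : probability Omega R)
  (A : 'M[R]_d) (delta : R)
  (f : Rd R d -> meas R d -> Rd R m -> Rd R d)
  (theta : probability (Rd R m) R) (mu0 : probability (Rd R d) R)
  (X0 : forall N : nat, 'I_N -> Omega -> Rd R d)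
  (eps : nat -> nat -> Omega -> Rd R m)
  (omega alpha gamma0 : R)
  (* standing setting *)
  (hf : f_measurable f)
  (hmu0 : P1 (mu0 : meas R d))
  (hX0m : forall N (i : 'I_N), measurable_fun setT (X0 N i))
  (hepsm : forall n i, measurable_fun setT (eps n i))
  (hX0law : forall N (i : 'I_N) (B : set (Rd R d)), measurable B ->
              P (X0 N i @^-1` B) = mu0 B)
  (hexch : exchangeable P X0)
  (hiid : iid_indep P (theta : meas R m) X0 eps)
  (* (A3) *)
  (homega : 0 < omega) (hA3 : opnorm A <= expR (- omega))
  (* (A4) *)
  (halpha : 0 < alpha)
  (hA4mu0 : (\int[mu0]_x ((enorm (x : 'cV[R]_d)) `^ (1 + alpha))%:E < +oo)%E)
  (hA4D : (\int[theta]_z poweR (Dlip f z) (1 + alpha) < +oo)%E)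
  (hA4D1 : (\int[theta]_z poweR (D1 f z) (1 + alpha) < +oo)%E)
  (* gamma0 in (0, a0) *)
  (hgamma0 : 0 < gamma0)
  (hgamma0a0 : (gamma0%:E < (1 - expR (- omega))%:E
                  * (2%:E * \int[theta]_z Dlip f z)^-1)%E)
  (* delta in (0, min{a(alpha)^(1/(1+alpha)), a0 - gamma0}) *)
  (hdelta : 0 < delta)
  (hdelta_a : ((delta `^ (1 + alpha))%:E <
                 (4 `^ (- alpha) - expR (- ((1 + alpha) * omega)))%:E
                 * (2%:E * \int[theta]_z poweR (Dlip f z) (1 + alpha))^-1)%E)
  (hdelta_a0 : (delta%:E < (1 - expR (- omega))%:E
                  * (2%:E * \int[theta]_z Dlip f z)^-1 - gamma0%:E)%E) :
  let sigma : R := fine (\int[theta]_z Dlip f z)%E in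
  let vartheta : R :=
    (1 - 2 * sigma * gamma0) / (expR (- omega) + 2 * delta * sigma) in
  exists (N0 : nat) (C1 : R), 0 < C1 /\
    forall (e : R) (n N : nat), 0 < e ->
      N0%:R * (Num.max 1 (logp e)) `^ ((d + 2)%:R / d%:R) < N%:R ->
      (P [set w | (e%:E < W1 (empirical (fun i => particles A delta f X0 eps N n i w))
                            (mu_nl A delta f (theta : meas R m) (mu0 : meas R d) n))%E]
       <= P [set w | ((2 * sigma * gamma0 * vartheta ^+ n * e)%:E
                        < W1 (empirical (fun i => X0 N i w)) (mu0 : meas R d))%E]
          + (C1 * e `^ (- (1 + alpha)) * N%:R `^ (- (alpha / (d + 2)%:R)))%:E)%E.
Proof.
move=> sigma vartheta; pose a := expR (- omega); pose p := 1 + alpha.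
have a0 : 0 < a by exact: expR_gt0.
have p0 : 0 < p by rewrite /p; lra.
have hA (x : 'cV[R]_d) : enorm (A *m x) <= a * enorm x.
  by apply: le_trans (enorm_mulmx A x) _; rewrite ler_wpM2r// enorm_ge0.
have D0 z := Dlip_ge0 f z hd.
have ID0 : (0 <= \int[theta]_z Dlip f z)%E by apply: integral_ge0 => z _; exact: D0.
have IDfin : (\int[theta]_z Dlip f z)%E \is a fin_num.
  (* An infinite sigma would make a0 equal to 0, which contradicts 0 < gamma0 < a0. *)
  rewrite ge0_fin_numE// ltNge leye_eq; apply/negP => /eqP IDy.
  move: hgamma0a0; rewrite IDy (_ : (2%:E * +oo)%E = +oo%E); last by rewrite gt0_muley// lte_fin.
  rewrite invey mule0 lte_fin.
  by rewrite ltNge (ltW hgamma0).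
have hsig : (\int[theta]_z Dlip f z = sigma%:E)%E by rewrite fineK.
have s0 : 0 <= sigma by rewrite fine_ge0.
have hsigma : (\int[theta]_z poweR (Dlip f z) 1 = sigma%:E)%E.
  by rewrite -hsig; apply: eq_integral => z _; rewrite poweRe1.
pose S1 := fine (\int[theta]_z poweR (Dlip f z) p)%E.
have hS1 : (\int[theta]_z poweR (Dlip f z) p = S1%:E)%E.
  by rewrite fineK// ge0_fin_numE//; apply: integral_ge0 => z _; exact: poweR_ge0.
have S10 : 0 <= S1 by rewrite -lee_fin -hS1; apply: integral_ge0 => z _; exact: poweR_ge0.
pose D1p := fine (\int[theta]_z poweR (D1 f z) p)%E.
have hD1p : (\int[theta]_z poweR (D1 f z) p = D1p%:E)%E.
  by rewrite fineK// ge0_fin_numE//; apply: integral_ge0 => z _; exact: poweR_ge0.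
pose D1i := fine (\int[theta]_z D1 f z)%E.
have hD1 : (\int[theta]_z D1 f z = D1i%:E)%E.
  rewrite fineK// ge0_fin_numE; last by apply: integral_ge0 => z _; rewrite lee_fin enorm_ge0.
  apply: (@le_lt_trans _ _ (\int[theta]_z (1%:E + poweR (D1 f z) p))%E).
    apply: le_integral_nm => z; first by rewrite lee_fin enorm_ge0.
    by rewrite /D1 poweR_EFin -EFinD lee_fin le_one_plus_powR ?enorm_ge0// /p lerDl ltW.
  rewrite ge0_integralD//; last 2 first.
  - by move=> z _; exact: poweR_ge0.
  - rewrite /D1; under eq_fun do rewrite poweR_EFin.
    apply: measurable_enorm_pow; apply: (measurable_f_cst hf) => //.
    exact: P1_dirac.
  by rewrite integral_cst_probability hD1p ltry.
pose m0 := fine (\int[mu0]_x ((enorm (x : 'cV[R]_d)) `^ p)%:E)%E.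
have hm0 : (\int[mu0]_x ((enorm (x : 'cV[R]_d)) `^ p)%:E = m0%:E)%E.
  by rewrite fineK// ge0_fin_numE//; apply: integral_ge0 => x _; rewrite lee_fin powR_ge0.
have lam1 : drift_factor delta a alpha S1 < 1.
  have h : 2 * S1 * delta `^ p < 4 `^ (- alpha) - expR (- (p * omega)).
    by apply: lt_inve_twice; rewrite -?hS1// powR_gt0.
  rewrite /drift_factor -/p (_ : a `^ p = expR (- (p * omega))); last first.
    by rewrite /a -expRM; congr expR; ring.
  rewrite mulrC -ltr_pdivlMr ?powR_gt0// mul1r -powRN.
  by rewrite [X in 2 * X]mulrC mulrA addrC -ltrBrDr.
have contraction : 2 * sigma * (delta + gamma0) < 1 - a.
  apply: lt_inve_twice => //; first by rewrite addr_gt0.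
  by rewrite -hsig EFinD -lteBrDr.
have [eta [eta0 qeta heta]] := splitting_fraction a0 s0 hdelta hgamma0 contraction.
pose q := a + 2 * delta * sigma.
have q0 : 0 < q by rewrite ltr_wpDr// !mulr_ge0// ltW.
pose G := 1 - ((1 - eta) / q) `^ (- p).
have G0 : 0 < G by rewrite subr_gt0 powRN_lt1// ltr_pdivlMr// mul1r.
pose Kc := 1 + drift_const delta alpha D1p + drift_factor delta a alpha S1 * moment_bound delta a alpha S1 D1p m0.
pose C := sampling_const d alpha * Kc * eta `^ (- p) / G.
(* |C| + 1 is positive without any discussion of the sign of C. *)
exists 0%N, (`|C| + 1); split; first by rewrite ltr_wpDl.
move=> e n N e0; rewrite mul0r ltr0n => N0.
apply: le_trans (particle_tail hf hmu0 hX0m hepsm hX0law hiid a0 hA (ltW hdelta) halpha hS1 hD1p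
  hD1 hsigma hm0 lam1 N0 n eta0 qeta e0) _.
apply: leeD.
  (* By [heta] the threshold of the statement is no larger than the one from the recursion, so its
     event contains the other. *)
  apply: le_measure; rewrite ?inE.
  - exact: (measurable_W1_particles A delta theta mu0 hf hX0m hepsm N0 0).
  - exact: (measurable_W1_particles A delta theta mu0 hf hX0m hepsm N0 0).
  - move=> w /=; apply: le_lt_trans; rewrite lee_fin ler_wpM2r ?(ltW e0)//.
rewrite lee_fin -/p -/q -/G -/Kc.
rewrite (_ : _ * e `^ (- p) = C * (e `^ (- p) * N%:R `^ (- (alpha / (d + 2)%:R)))); last by rewrite /C; ring.
rewrite -[X in _ <= X]mulrA ler_wpM2r ?mulr_ge0 ?powR_ge0//.
by apply: le_trans (ler_norm _) _; rewrite lerDl.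
Qed.
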